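(* Let $M$ be a smooth manifold. The horizontal and vertical compositions of 2-tracks are well defined on the set $S_2(M)/\!\cong_2$ of 2-tracks, and together with the boundary maps $\partial_u,\partial_d,\partial_l,\partial_r$ from 2-tracks to 1-tracks they define a double groupoid $\mathcal S_2(M)$ (the thin homotopy double groupoid of $M$), whose set of objects is the set of points of $M$, whose set of 1-morphisms is the set of 1-tracks in $M$, and whose set of 2-morphisms is the set of 2-tracks in $M$. In addition, $\mathcal S_2(M)$ admits a thin structure given by: a 2-track is thin if it admits a representative whose derivative has rank less than or equal to $1$ at every point of $[0,1]^2$.
   Context: A 1-path in $M$ is a smooth map $\gamma\colon[0,1]\to M$ which is constant on $[0,\epsilon]\cup[1-\epsilon,1]$ for some $\epsilon>0$. A 2-path is a smooth map $\Gamma\colon[0,1]^2\to M$ such that for some $\epsilon>0$: $\Gamma(t,s)=\Gamma(0,s)$ for $t\le\epsilon$, $\Gamma(t,s)=\Gamma(1,s)$ for $t\ge1-\epsilon$, $\Gamma(t,s)=\Gamma(t,0)$ for $s\le\epsilon$, $\Gamma(t,s)=\Gamma(t,1)$ for $s\ge1-\epsilon$. $S_2(M)$ is the set of 2-paths. Boundaries of a 2-path: $\partial_l\Gamma(s)=\Gamma(0,s)$, $\partial_r\Gamma(s)=\Gamma(1,s)$, $\partial_d\Gamma(t)=\Gamma(t,0)$, $\partial_u\Gamma(t)=\Gamma(t,1)$. Concatenation of 1-paths, and horizontal ($\circ_{\rm h}$, when $\partial_r\Gamma=\partial_l\Gamma'$) and vertical ($\circ_{\rm v}$, when $\partial_u\Gamma=\partial_d\Gamma'$,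 $\Gamma$ below) concatenation of 2-paths are defined in the usual way, each half at double speed. Two 1-paths $\phi,\gamma$ are rank-1 homotopic ($\phi\cong_1\gamma$) if there is a 2-path $\Gamma$ with $\partial_l\Gamma,\partial_r\Gamma$ constant, $\partial_d\Gamma=\phi$, $\partial_u\Gamma=\gamma$ and derivative of rank $\le1$ everywhere. Equivalence classes are called 1-tracks; under concatenation they form a groupoid with object set $M$. Two 2-paths $\Gamma,\Gamma'$ are rank-2 homotopic ($\Gamma\cong_2\Gamma'$) if there is a smooth $J\colon[0,1]^3\to M$ such that: $J(t,s,0)=\Gamma(t,s)$, $J(t,s,1)=\Gamma'(t,s)$; the restriction of $J$ to each of the four faces $t=0$, $t=1$, $s=0$, $s=1$ is a rank-1 homotopy between the corresponding boundary 1-paths of $\Gamma$ and $\Gamma'$; $J$ has a product structure close to the boundary of $[0,1]^3$ (for some $\epsilon>0$, $J(t,s,x)=J(t,s,0)$ for $x\le\epsilon$, and analogously for all other faces); and the derivative of $J$ has rank $\le2$ everywhere. Equivalence classes are called 2-tracks; boundary maps descend to maps from 2-tracks to 1-tracks. If $\partial_u\Gamma\cong_1\partial_d\Gamma'$, choose a rank-1 homotopy $J$ from $\partial_u\Gamma$ to $\partial_d\Gamma'$ and put $[\Gamma]\circ_{\rm v}[\Gamma']=[(\Gamma\circ_{\rm v}J)\circ_{\rm v}\Gamma']$; horizontal composition of 2-tracks is defined analogously. An (edge symmetric, strict) double groupoid is a 2-truncated cubical set (sets of 0-, 1-, 2-cubes with face and degeneracy maps satisfying the cubical relations) whose 1-cubes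 form a groupoid over the 0-cubes and whose 2-cubes (squares) have partial horizontal and vertical compositions, each a groupoid structure with the 1-cubes as objects and degenerate squares as identities, satisfying the interchange law and compatible with faces and degeneracies. A thin structure is a class of squares, called thin, such that: degenerate squares are thin; whenever $a,b,c,d$ are 1-cubes with $ab=cd$ there is a unique thin square with bottom $a$, right $b$, left $c$, top $d$; any composition of thin squares is thin. *)

(* Defs.v *)
From HB Require Import structures.
From mathcomp Require Import all_boot all_order all_algebra.
From mathcomp Require Import interval_inference.
From mathcomp Require Import boolp classical_sets functions cardinality reals.
From mathcomp Require Import topology normedtype derive.

Set Implicit Arguments.
Unset Strict Implicit.
Unset Printing Implicit Defensive.

Import Order.TTheory GRing.Theory Num.Theory.
Import numFieldNormedType.Exports.
Local Open Scope classical_set_scope.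
Local Open Scope ring_scope.

Section SmoothEuclidean.
Variables (R : realType) (m n : nat).

(* Only meant for open [U]. *)
Fixpoint Ck_on (k : nat) (U : set 'rV[R]_m) (f : 'rV[R]_m -> 'rV[R]_n) : Prop :=
  match k with
  | 0 => forall x, U x -> {for x, continuous f}
  | k'.+1 => (forall x, U x -> differentiable f x) /\
             (forall v, Ck_on k' U (fun x => 'D_v f x))
  end.

Definition smooth_on (U : set 'rV[R]_m) (f : 'rV[R]_m -> 'rV[R]_n) : Prop :=
  forall k, Ck_on k U f.

End SmoothEuclidean.

(* [to_coord] and [of_coord] are total functions, meaningful on [chart_dom]
   and [chart_cod] only. *)
Record chart (R : realType) (n : nat) (T : topologicalType) := Chart {
  chart_dom : set T;
  chart_cod : set 'rV[R]_n;
  to_coord : T -> 'rV[R]_n;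
  of_coord : 'rV[R]_n -> T;
  open_chart_dom : open chart_dom;
  open_chart_cod : open chart_cod;
  to_coord_cod : forall p, chart_dom p -> chart_cod (to_coord p);
  of_coord_dom : forall y, chart_cod y -> chart_dom (of_coord y);
  to_coordK : forall p, chart_dom p -> of_coord (to_coord p) = p;
  of_coordK : forall y, chart_cod y -> to_coord (of_coord y) = y;
  to_coord_continuous : forall p, chart_dom p -> {for p, continuous to_coord};
  of_coord_continuous : forall y, chart_cod y -> {for y, continuous of_coord}
}.

(* The atlas is not required to be maximal. *)
Record smoothManifold (R : realType) (n : nat) := SmoothManifold {
  manifold_sort :> topologicalType;
  manifold_hausdorff : hausdorff_space manifold_sort;
  manifold_second_countable : @second_countable manifold_sort;
  atlas : set (chart R n manifold_sort);
  atlas_cover : forall p, exists2 c, atlas c & chart_dom c p;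
  atlas_smooth : forall c c', atlas c -> atlas c' ->
    smooth_on [set y | chart_cod c y /\ chart_dom c' (of_coord c y)]
      (fun y => to_coord c' (of_coord c y))
}.

Section Cubes.
Variables (R : realType) (n : nat) (M : smoothManifold R n) (k : nat).
Implicit Types (F : 'rV[R]_k -> M) (x : 'rV[R]_k).

Definition unit_cube : set 'rV[R]_k := [set x | forall i, 0 <= x 0 i <= 1].

(* Maps on [0,1]^k are handled as functions on R^k of which only the values on
   the cube matter.  [local_extension F x c V g] says that near [x] the map [F],
   read in the chart [c], is the restriction to the cube of the map [g], smooth
   on the open set [V] of R^k. *)
Record local_extension F x (c : chart R n M)
    (V : set 'rV[R]_k) (g : 'rV[R]_k -> 'rV[R]_n) : Prop := LocalExtension {
  local_extension_atlas : atlas c;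
  local_extension_open : open V;
  local_extension_mem : V x;
  local_extension_smooth : smooth_on V g;
  local_extension_agree : forall y, V y -> unit_cube y ->
    chart_dom c (F y) /\ to_coord c (F y) = g y
}.

Definition smooth_on_cube F : Prop :=
  forall x, unit_cube x -> exists c V g, local_extension F x c V g.

(* As the cube is the closure of its interior, ['J g x] depends on [g] only
   through [F]; a change of chart multiplies it by an invertible matrix. *)
Definition rank_le (r : nat) F : Prop :=
  forall x, unit_cube x -> exists c V g,
    local_extension F x c V g /\ (\rank (jacobian g x) <= r)%N.

End Cubes.

Section UnitInterval.
Variable R : realType.

Lemma clamp_subproof (x : R) : 0 <= Num.max 0 (Num.min x 1) <= 1.
Proof. by rewrite le_max lexx ge_max ler01 ge_min lexx orbT. Qed.

(* The retraction of R onto [0,1]. *)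
Definition clamp (x : R) : {i01 R} :=
  Itv01 (proj1 (andP (clamp_subproof x))) (proj2 (andP (clamp_subproof x))).

Lemma clampE (t : {i01 R}) : clamp t%:num = t.
Proof.
apply/val_inj => /=; have /andP[t0 t1] : 0 <= t%:num <= 1 by apply/andP; split.
by rewrite (min_idPl t1) (max_idPr t0).
Qed.

Definition concat (T : Type) (f g : {i01 R} -> T) (t : {i01 R}) : T :=
  if t%:num <= 2^-1 then f (clamp (2 * t%:num)) else g (clamp (2 * t%:num - 1)).

End UnitInterval.

Section Paths.
Variables (R : realType) (n : nat) (M : smoothManifold R n).
Local Notation I := {i01 R}.
Local Notation zero := (0%:i01 : I).
Local Notation one := (1%:i01 : I).
Implicit Types (f : I -> M) (G H : I -> I -> M) (J : I -> I -> I -> M).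

Definition fun1 f (v : 'rV[R]_1) : M := f (clamp (v 0 0)).
Definition fun2 G (v : 'rV[R]_2) : M := G (clamp (v 0 0)) (clamp (v 0 1)).
Definition fun3 J (v : 'rV[R]_3) : M :=
  J (clamp (v 0 0)) (clamp (v 0 1)) (clamp (v 0 2)).

(* [f] is constant near 0 and constant near 1, with possibly different values. *)
Definition stationary_ends (T : Type) (e : R) (f : I -> T) : Prop :=
  forall t, (t%:num <= e -> f t = f zero) /\ (1 - e <= t%:num -> f t = f one).

Definition path1 f : Prop :=
  smooth_on_cube (fun1 f) /\ exists2 e : R, 0 < e & stationary_ends e f.

Definition path2 G : Prop :=
  smooth_on_cube (fun2 G) /\
  exists2 e : R, 0 < e &
    (forall s, stationary_ends e (fun t => G t s)) /\
    (forall t, stationary_ends e (fun s => G t s)).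

Definition bdl G : I -> M := fun s => G zero s.
Definition bdr G : I -> M := fun s => G one s.
Definition bdd G : I -> M := fun t => G t zero.
Definition bdu G : I -> M := fun t => G t one.

Definition constant_path f : Prop := forall t, f t = f zero.

Definition hconcat G H : I -> I -> M :=
  fun t s => concat (fun t' => G t' s) (fun t' => H t' s) t.
Definition vconcat G H : I -> I -> M :=
  fun t s => concat (fun s' => G t s') (fun s' => H t s') s.

Definition transpose G : I -> I -> M := fun t s => G s t.

Record rank1_homotopy H f f' : Prop := Rank1Homotopy {
  rank1_homotopy_path2 : path2 H;
  rank1_homotopy_bdl : constant_path (bdl H);
  rank1_homotopy_bdr : constant_path (bdr H);
  rank1_homotopy_bdd : bdd H = f;
  rank1_homotopy_bdu : bdu H = f';
  rank1_homotopy_rank : rank_le 1 (fun2 H)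
}.

Definition rank1_homotopic f f' : Prop := exists H, rank1_homotopy H f f'.

Record rank2_homotopy J G G' : Prop := Rank2Homotopy {
  rank2_homotopy_smooth : smooth_on_cube (fun3 J);
  rank2_homotopy_start : forall t s, J t s zero = G t s;
  rank2_homotopy_end : forall t s, J t s one = G' t s;
  rank2_homotopy_l :
    rank1_homotopy (fun s x => J zero s x) (bdl G) (bdl G');
  rank2_homotopy_r :
    rank1_homotopy (fun s x => J one s x) (bdr G) (bdr G');
  rank2_homotopy_d :
    rank1_homotopy (fun t x => J t zero x) (bdd G) (bdd G');
  rank2_homotopy_u :
    rank1_homotopy (fun t x => J t one x) (bdu G) (bdu G');
  rank2_homotopy_product : exists2 e : R, 0 < e &
    [/\ forall s x, stationary_ends e (fun t => J t s x),
        forall t x, stationary_ends e (fun s => J t s x) &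
        forall t s, stationary_ends e (fun x => J t s x)];
  rank2_homotopy_rank : rank_le 2 (fun3 J)
}.

Definition rank2_homotopic G G' : Prop := exists J, rank2_homotopy J G G'.

Definition class1 f : set (I -> M) :=
  [set f' | path1 f' /\ rank1_homotopic f f'].
Definition class2 G : set (I -> I -> M) :=
  [set G' | path2 G' /\ rank2_homotopic G G'].

Definition track1 : Type :=
  {X : set (I -> M) | exists2 f, path1 f & X = class1 f}.
Definition track2 : Type :=
  {X : set (I -> I -> M) | exists2 G, path2 G & X = class2 G}.

Definition represents1 f (X : track1) : Prop := sval X f.
Definition represents2 G (X : track2) : Prop := sval X G.

Definition thin_track (X : track2) : Prop :=
  exists2 G, represents2 G X & rank_le 1 (fun2 G).

End Paths.

Definition equivalence_on (T : Type) (A : set T) (r : T -> T -> Prop) : Prop :=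
  [/\ forall x, A x -> r x x,
      forall x y, A x -> A y -> r x y -> r y x &
      forall x y z, A x -> A y -> A z -> r x y -> r y z -> r x z].

(* Partial compositions are total functions, constrained only on composable
   pairs.  Compositions are written in diagrammatic order. *)
Record is_groupoid (Ob Mor : Type) (src tgt : Mor -> Ob) (idm : Ob -> Mor)
    (comp : Mor -> Mor -> Mor) : Prop := IsGroupoid {
  groupoid_src_id : forall x, src (idm x) = x;
  groupoid_tgt_id : forall x, tgt (idm x) = x;
  groupoid_src_comp : forall a b, tgt a = src b -> src (comp a b) = src a;
  groupoid_tgt_comp : forall a b, tgt a = src b -> tgt (comp a b) = tgt b;
  groupoid_assoc : forall a b c, tgt a = src b -> tgt b = src c ->
    comp a (comp b c) = comp (comp a b) c;
  groupoid_id_l : forall a, comp (idm (src a)) a = a;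
  groupoid_id_r : forall a, comp a (idm (tgt a)) = a;
  groupoid_inv : forall a, exists b,
    [/\ src b = tgt a, tgt b = src a,
        comp a b = idm (src a) & comp b a = idm (tgt a)]
}.

(* [fl], [fr], [fd], [fu] are the left, right, bottom and top faces of a square.
   [degh a] has left and right faces [a], and is an identity for [hcomp];
   [degv a] has bottom and top faces [a], and is an identity for [vcomp].
   [hcomp X Y] puts [Y] to the right of [X]; [vcomp X Y] puts [Y] above [X]. *)
Record doubleGroupoid (C0 C1 C2 : Type) := DoubleGroupoid {
  src : C1 -> C0;
  tgt : C1 -> C0;
  deg : C0 -> C1;
  fl : C2 -> C1;
  fr : C2 -> C1;
  fd : C2 -> C1;
  fu : C2 -> C1;
  degh : C1 -> C2;
  degv : C1 -> C2;
  comp : C1 -> C1 -> C1;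
  hcomp : C2 -> C2 -> C2;
  vcomp : C2 -> C2 -> C2;
  (* cubical relations; those not listed are part of the groupoid axioms *)
  src_fl : forall X, src (fl X) = src (fd X);
  tgt_fl : forall X, tgt (fl X) = src (fu X);
  src_fr : forall X, src (fr X) = tgt (fd X);
  tgt_fr : forall X, tgt (fr X) = tgt (fu X);
  fd_degh : forall a, fd (degh a) = deg (src a);
  fu_degh : forall a, fu (degh a) = deg (tgt a);
  fl_degv : forall a, fl (degv a) = deg (src a);
  fr_degv : forall a, fr (degv a) = deg (tgt a);
  deg_deg : forall x, degh (deg x) = degv (deg x);
  comp_groupoid : is_groupoid src tgt deg comp;
  hcomp_groupoid : is_groupoid fl fr degh hcomp;
  vcomp_groupoid : is_groupoid fd fu degv vcomp;
  fd_hcomp : forall X Y, fr X = fl Y -> fd (hcomp X Y) = comp (fd X) (fd Y);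
  fu_hcomp : forall X Y, fr X = fl Y -> fu (hcomp X Y) = comp (fu X) (fu Y);
  fl_vcomp : forall X Y, fu X = fd Y -> fl (vcomp X Y) = comp (fl X) (fl Y);
  fr_vcomp : forall X Y, fu X = fd Y -> fr (vcomp X Y) = comp (fr X) (fr Y);
  degh_comp : forall a b, tgt a = src b ->
    degh (comp a b) = vcomp (degh a) (degh b);
  degv_comp : forall a b, tgt a = src b ->
    degv (comp a b) = hcomp (degv a) (degv b);
  interchange : forall X Y Z W,
    fr X = fl Y -> fr Z = fl W -> fu X = fd Z -> fu Y = fd W ->
    vcomp (hcomp X Y) (hcomp Z W) = hcomp (vcomp X Z) (vcomp Y W)
}.

Record thin_structure (C0 C1 C2 : Type) (D : doubleGroupoid C0 C1 C2)
    (thin : C2 -> Prop) : Prop := ThinStructure {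
  thin_degh : forall a, thin (degh D a);
  thin_degv : forall a, thin (degv D a);
  thin_filler : forall a b c d,
    tgt D a = src D b -> tgt D c = src D d -> comp D a b = comp D c d ->
    exists! X, thin X /\ [/\ fd D X = a, fr D X = b, fl D X = c & fu D X = d];
  thin_hcomp : forall X Y, fr D X = fl D Y ->
    thin X -> thin Y -> thin (hcomp D X Y);
  thin_vcomp : forall X Y, fu D X = fd D Y ->
    thin X -> thin Y -> thin (vcomp D X Y)
}.

(* The operations of [D] are computed on arbitrary representatives, and, for the
   two compositions of 2-tracks, with an arbitrary choice of the rank-1 homotopy
   inserted in the middle.  Membership of the result in the composite 2-track
   says in particular that it is a 2-path.  In [hcomp] the inserted homotopy runs
   from left to right, whence the transposition. *)
Record is_thin_homotopy_double_groupoid (R : realType) (n : nat)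
    (M : smoothManifold R n) (D : doubleGroupoid M (track1 M) (track2 M)) : Prop :=
  IsThinHomotopyDoubleGroupoid {
  thdg_src : forall X f, represents1 f X -> src D X = f 0%:i01;
  thdg_tgt : forall X f, represents1 f X -> tgt D X = f 1%:i01;
  thdg_deg : forall p, represents1 (fun=> p) (deg D p);
  thdg_comp : forall X Y f g, represents1 f X -> represents1 g Y ->
    f 1%:i01 = g 0%:i01 -> represents1 (concat f g) (comp D X Y);
  thdg_fl : forall X G, represents2 G X -> represents1 (bdl G) (fl D X);
  thdg_fr : forall X G, represents2 G X -> represents1 (bdr G) (fr D X);
  thdg_fd : forall X G, represents2 G X -> represents1 (bdd G) (fd D X);
  thdg_fu : forall X G, represents2 G X -> represents1 (bdu G) (fu D X);
  thdg_degh : forall a f, represents1 f a ->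
    represents2 (fun t s => f s) (degh D a);
  thdg_degv : forall a f, represents1 f a ->
    represents2 (fun t s => f t) (degv D a);
  thdg_hcomp : forall X Y G G' H, represents2 G X -> represents2 G' Y ->
    rank1_homotopy H (bdr G) (bdl G') ->
    represents2 (hconcat (hconcat G (transpose H)) G') (hcomp D X Y);
  thdg_vcomp : forall X Y G G' H, represents2 G X -> represents2 G' Y ->
    rank1_homotopy H (bdu G) (bdd G') ->
    represents2 (vconcat (vconcat G H) G') (vcomp D X Y)
}.

(* Main.v *)
Require Import Defs.
From mathcomp Require Import all_boot all_order all_algebra.
From mathcomp Require Import interval_inference.
From mathcomp Require Import boolp classical_sets functions reals.
From mathcomp Require Import topology normedtype landau derive sequences realfun exp.
From mathcomp Require Import ring lra.

Set Implicit Arguments.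
Unset Strict Implicit.
Unset Printing Implicit Defensive.

Import Order.TTheory GRing.Theory Num.Theory.
Import numFieldNormedType.Exports.
Local Open Scope classical_set_scope.
Local Open Scope ring_scope.

(** The theorem holds because composing a map into M with a smooth map between
cubes cannot raise its rank.  A family G(h(t,s,x)) of reparametrizations of a
2-path G factors through a square, so it has rank at most 2 whatever G is; and
if G has rank at most 1, so has any such family.  All homotopies below are of
this kind, or are glued from pieces of this kind.

Two devices make the formulas smooth.  A 2-path is constant in the normal
direction near each side, so it extends to a map on the whole plane, smooth
without boundary; and it is unchanged by precomposition with [softclamp], a
smooth map onto [0,1] which is itself constant near 0 and 1.  Hence a formula in
[softclamp] and in a smooth step [ramp] has the required product structure, and
two maps that agree in overlapping margins can be glued.

The groupoid laws are reparametrizations of the first variable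
([homotopic_reparam]).  That compositions do not depend on representatives needs
more.  Two homotopies G1 ~ G2 and H1 ~ H2 of composable squares induce on the
common side two rank-1 homotopies K and L with the same ends, which need not be
equal.  But K and L are squares of rank at most 1 that agree on three sides, and
such squares are always homotopic relative to these three sides
([three_sides]): pulling each of them down towards the middle one of the three
sides leaves a map that depends only on what they share.  What is left over is
pushed out through the fourth side, and the faces of a rank-2 homotopy are free
to move by rank-1 homotopies.  So K can be replaced by L
([change_right_face]), and the two homotopies can be glued ([concatR_wd]).

The same lemma gives the uniqueness of thin fillers.  Their existence comes from
bending a rank-1 homotopy from ab to cd into a square with sides a, b, c, d
([thin_filler_square]).

A rank-1 homotopy ending at a side of a square can be inserted in the margin of
the square along that side, leaving the other sides as they are ([collar_left]).
So any square can be given prescribed boundary paths within their 1-tracks, and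
the double groupoid axioms only have to be checked on squares whose sides match
exactly.  Vertical composition is the transpose of horizontal composition, and
1-tracks compose as the bottom faces of degenerate squares. *)

(** * Calculus of functions of class C^k *)

Section CkDef.
Variables (R : realType) (V W : normedModType R).

(** The recursion of [Ck_on], between arbitrary normed modules: scalar
functions obey the product rule, and maps into row vectors are handled one
coordinate at a time. *)
Fixpoint Ck k (U : set V) (f : V -> W) : Prop :=
  match k with
  | 0 => forall x, U x -> {for x, continuous f}
  | k'.+1 => (forall x, U x -> differentiable f x) /\
             (forall v, Ck k' U (fun x => 'D_v f x))
  end.

End CkDef.

Section Ck.
Variable R : realType.

Lemma Ck_onE m n k U (f : 'rV[R]_m -> 'rV[R]_n) : Ck_on k U f = Ck k U f.
Proof. reflexivity. Qed.

(** Differentiability from an estimate alone: the candidate derivative is 0.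
This covers a difference that vanishes near x as well as functions flat at x.
*)
Lemma differentiable_littleo (V W : normedModType R) (f : V -> W) x :
  (forall eps, 0 < eps -> \forall y \near (0 : V), `|f (y + x) - f x| <= eps * `|y|) ->
  differentiable f x /\ 'd f x = (\0 : V -> W) :> (V -> W).
Proof.
move=> fx.
have E : f \o shift x = cst (f x) + \0 +o_ 0 id.
  apply/eqaddoP => _/posnumP[eps]; near=> y; rewrite /= !fctE /= addr0; near: y;
    exact: fx.
have c0 : continuous (\0 : V -> W) by move=> y; exact: cst_continuous.
split; first by apply/diff_locallyP; rewrite (diff_unique c0 E).
by rewrite (diff_unique c0 E).
Unshelve. all: by end_near. Qed.

Lemma near_eq_differentiable (V W : normedModType R) (f g : V -> W) x :
  (\near x, f x = g x) -> differentiable f x -> differentiable g x.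
Proof.
move=> fg df.
have fgx : f x = g x := nbhs_singleton fg.
have -> : g = f + (g \- f) by apply/funext => y /=; rewrite fctE addrC subrK.
have [|dh _] := @differentiable_littleo V W (g \- f) x; last exact: differentiableD.
move=> eps e0.
near=> y.
have -> : (g \- f) (y + x) = 0.
  rewrite /= (_ : f (y + x) = g (y + x)) ?subrr //.
  by near: y; move: fg; rewrite (near_shift 0 x) /= ; apply: filterS => z /=;
    rewrite subr0.
by rewrite /= fgx subrr subrr normr0 mulr_ge0 // ltW.
Unshelve. all: by end_near. Qed.

Section Scalar.
Variable V : normedModType R.
Implicit Types (f g : V -> R) (U : set V).

Lemma Ck_ext (W : normedModType R) k U (f g : V -> W) : open U ->
  (forall x, U x -> f x = g x) -> Ck k U f -> Ck k U g.
Proof.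
move=> oU; elim: k f g => [|k IH] f g fg /= => [fc x Ux|[fd fD]].
  have nfg : \near x, f x = g x.
    by apply: filterS fg _; exact: open_nbhs_nbhs.
  rewrite /prop_for /continuous_at -(fg _ Ux).
  by apply: (cvg_trans _ (fc x Ux)); exact: near_eq_cvg.
have nfg x : U x -> \near x, f x = g x.
  by move=> Ux; apply: filterS fg _; exact: open_nbhs_nbhs.
split=> [x Ux|v]; first exact: near_eq_differentiable (nfg x Ux) (fd x Ux).
by apply: (IH _ _ _ (fD v)) => x Ux; apply/near_eq_derive/nfg.
Qed.

Lemma CkW (W : normedModType R) k U (f : V -> W) : Ck k.+1 U f -> Ck k U f.
Proof.
elim: k f => [|k IH] f [fd fD]; first by move=> x /fd /differentiable_continuous.
by split=> // v; exact/IH/fD.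
Qed.

Lemma Ck_sub (W : normedModType R) k U U' (f : V -> W) :
  U' `<=` U -> Ck k U f -> Ck k U' f.
Proof.
move=> UU; elim: k f => [|k IH] f; first by move=> h x /UU /h.
by move=> [fd fD]; split=> [x /UU /fd//|v]; exact/IH/fD.
Qed.

Lemma Ck_cst k U (a : R) : Ck k U (fun _ : V => a).
Proof.
elim: k a => [|k IH] a /=; first by move=> x _; exact: cst_continuous.
split=> [x _|v]; first exact: differentiable_cst.
have -> : (fun x => 'D_v (fun _ : V => a) x) = (fun=> 0); last exact: IH.
by apply/funext => x; exact: derive_cst.
Qed.

Lemma Ck_add k U f g : open U -> Ck k U f -> Ck k U g -> Ck k U (fun x => f x + g x).
Proof.
move=> oU; elim: k f g => [|k IH] f g /= => [fc gc x Ux|[fd fD] [gd gD]].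
  by apply: continuousD; [exact: fc|exact: gc].
split=> [x Ux|v]; first by apply: differentiableD; [exact: fd|exact: gd].
apply: (@Ck_ext _ k U (fun x => 'D_v f x + 'D_v g x)) => //; last exact: IH.
move=> x Ux; rewrite -[RHS]/('D_v (f + g) x) deriveD //; apply/diff_derivable;
  [exact: fd|exact: gd].
Qed.

Lemma Ck_mul k U f g : open U -> Ck k U f -> Ck k U g -> Ck k U (fun x => f x * g x).
Proof.
move=> oU; elim: k f g => [|k IH] f g => [fc gc x Ux|fS gS].
  by apply: continuousM; [exact: fc|exact: gc].
have [[fd fD] [gd gD]] := (fS, gS).
split=> [x Ux|v]; first by apply: differentiableM; [exact: fd|exact: gd].
apply: (@Ck_ext _ k U (fun x => f x * 'D_v g x + g x * 'D_v f x)) => //.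
  move=> x Ux; rewrite -[RHS]/('D_v (f * g) x) deriveM //;
    apply/diff_derivable; [exact: fd|exact: gd].
by apply: Ck_add => //; apply: IH; solve [exact: CkW fS|exact: CkW gS|exact: fD|exact:
  gD].
Qed.

Lemma Ck_sum k U m (f : 'I_m -> V -> R) : open U ->
  (forall i, Ck k U (f i)) -> Ck k U (fun x => \sum_i f i x).
Proof.
move=> oU; elim: m f => [|m IH] f fC.
  by apply: (Ck_ext oU _ (@Ck_cst k U 0)) => x _; rewrite big_ord0.
pose g x := f ord0 x + \sum_i f (lift ord0 i) x.
apply: (@Ck_ext _ k U g) => // [x _|]; first by rewrite big_ord_recl.
by apply: Ck_add => //; apply: IH => i; exact: fC.
Qed.

End Scalar.

Lemma continuous_sumZ (V : topologicalType) (W : normedModType R) m (e : 'I_m -> W)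
    (c : 'I_m -> V -> R) (x : V) :
  (forall i, {for x, continuous (c i)}) ->
  {for x, continuous (fun y => \sum_i c i y *: e i)}.
Proof.
elim: m e c => [|m IH] e c cc; rewrite /prop_for /continuous_at.
  by under eq_fun do rewrite big_ord0; rewrite big_ord0; exact: cvg_cst.
under eq_fun do rewrite big_ord_recl; rewrite big_ord_recl.
apply: cvgD; first by apply: cvgZr_tmp; exact: cc.
by apply: (IH (fun i => e (lift ord0 i)) (fun i => c (lift ord0 i))) => i; exact: cc.
Qed.

(** The chain rule D_v (g o f) = sum_i D_v (c i) * ((D_(e i) g) o f) writes a
derivative of the composite with c and D g composed with f, all of one order
less; this is why f is given by its coordinates c in a finite family e. *)
Lemma Ck_comp (V W : normedModType R) k m (e : 'I_m -> W) (c : 'I_m -> V -> R)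
    (U : set V) (U' : set W) (g : W -> R) : open U ->
  (forall i, Ck k U (c i)) -> Ck k U' g ->
  (forall x, U x -> U' (\sum_i c i x *: e i)) ->
  Ck k U (fun x => g (\sum_i c i x *: e i)).
Proof.
move=> oU; elim: k g => [|k IH] g cC gC UU'.
  move=> x Ux; apply: continuous_comp; last exact/gC/UU'.
  apply: continuous_sumZ => i; exact: cC.
have [gd gD] := gC.
have cd x i : U x -> differentiable (c i) x by move=> Ux; have [+ _] := cC i; apply.
pose f x := \sum_i c i x *: e i.
have fE : f = \sum_i (fun x => c i x *: e i).
  by apply/funext => x; rewrite fct_sumE.
have fd x : U x -> differentiable f x.
  move=> Ux; rewrite fE; apply: differentiable_sum => i; exact/differentiableZl/cd.
split=> [x Ux|v].
  by apply: (@differentiable_comp _ _ _ _ f g); [exact: fd|exact/gd/UU'].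
apply: (@Ck_ext _ _ k U (fun x => \sum_i 'D_v (c i) x * 'D_(e i) g (f x))) => //.
  move=> x Ux.
  have dgf : differentiable g (f x) by exact/gd/UU'.
  rewrite -[RHS]/('D_v (g \o f) x) deriveE; last first.
    by apply: differentiable_comp => //; exact: fd.
  rewrite diff_comp //=; last exact: fd.
  rewrite -[X in 'd g _ X]deriveE; last exact: fd.
  rewrite fE derive_sum; last first.
    by move=> i; apply/diff_derivable/differentiableZl/cd.
  rewrite linear_sum; apply: eq_bigr => i _ /=.
  rewrite (deriveE (f := fun x => _ *: _)); last exact/differentiableZl/cd.
  rewrite diffZl /=; last exact: cd.
  rewrite linearZ /= -fE (deriveE _ dgf) (deriveE (f := c i)) //; exact: cd.
apply: Ck_sum => // i; apply: Ck_mul => //; first by have [_] := cC i; apply.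
apply: (IH (fun y => 'D_(e i) g y)) => // [j|]; [exact/CkW/cC|exact: gD].
Qed.

Lemma Ck_comp1 (V : normedModType R) k (U : set V) (U' : set R) (f : V -> R) (g : R ->
  R) :
  open U -> Ck k U f -> Ck k U' g -> (forall x, U x -> U' (f x)) ->
  Ck k U (fun x => g (f x)).
Proof.
move=> oU fC gC UU'.
have E x : \sum_(i < 1) f x *: (1 : R) = f x by rewrite big_ord1 /GRing.scale /= mulr1.
apply: (Ck_ext oU (f := fun x => g (\sum_(i < 1) f x *: (1 : R)))).
  by move=> x _; rewrite E.
by apply: (Ck_comp oU (c := fun=> f) _ gC) => // x Ux; rewrite E; exact: UU'.
Qed.

Lemma Ck_comp_row (V : normedModType R) k m (U : set V) (U' : set 'rV[R]_m)
    (h : V -> 'rV[R]_m) (g : 'rV[R]_m -> R) :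
  open U -> (forall i, Ck k U (fun x => h x 0 i)) -> Ck k U' g ->
  (forall x, U x -> U' (h x)) -> Ck k U (fun x => g (h x)).
Proof.
move=> oU hC gC UU'.
have E x : \sum_i h x 0 i *: delta_mx 0 i = h x by rewrite [RHS]row_sum_delta.
apply: (Ck_ext oU (f := fun x => g (\sum_i h x 0 i *: delta_mx 0 i))).
  by move=> x _; rewrite E.
by apply: (Ck_comp oU _ gC) => [i|x Ux]; [exact: hC|rewrite E; exact: UU'].
Qed.

Lemma differentiable_rowP (V : normedModType R) n (f : V -> 'rV[R]_n) x :
  differentiable f x <-> forall i, differentiable (fun y => f y 0 i) x.
Proof.
split=> [df i|df].
  apply: (@differentiable_comp _ _ _ _ f (fun w : 'rV[R]_n => w 0 i)) => //.
  exact: differentiable_coord.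
have -> : f = \sum_i (fun y => f y 0 i *: (delta_mx 0 i : 'rV[R]_n)).
  by apply/funext => y; rewrite fct_sumE; exact: row_sum_delta.
by apply: differentiable_sum => i; exact/differentiableZl/df.
Qed.

Lemma Ck_rowP (V : normedModType R) n k (U : set V) (f : V -> 'rV[R]_n) : open U ->
  Ck k U f <-> forall i, Ck k U (fun x => f x 0 i).
Proof.
move=> oU; elim: k f => [|k IH] f /=.
  split=> [fc i x Ux|fc x Ux].
    apply: (@continuous_comp _ _ _ f (fun w : 'rV[R]_n => w 0 i)); first exact: fc.
    exact: coord_continuous.
  rewrite /prop_for /continuous_at.
  have E : f = \sum_i (fun y => f y 0 i *: (delta_mx 0 i : 'rV[R]_n)).
    by apply/funext => y; rewrite fct_sumE; exact: row_sum_delta.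
  rewrite {1}E (_ : (\sum_i _) = fun y => \sum_i f y 0 i *: (delta_mx 0 i : 'rV[R]_n));
    last first.
    by apply/funext => y; rewrite fct_sumE.
  rewrite [X in _ --> X](row_sum_delta (f x)); apply: continuous_sumZ => i; exact: fc.
have DE v x : U x -> differentiable f x -> forall i,
    'D_v (fun y => f y 0 i) x = 'D_v f x 0 i.
  by move=> Ux df i; rewrite derive_mx ?mxE //; exact: diff_derivable.
split=> [[fd fD] i|fC].
  split=> [x Ux|v]; first by have /differentiable_rowP := fd x Ux; apply.
  apply: (Ck_ext oU (f := fun x => 'D_v f x 0 i)) => [x Ux|].
    by rewrite DE //; exact: fd.
  by have /IH := fD v; apply.
have fd x : U x -> differentiable f x.
  by move=> Ux; apply/differentiable_rowP => i; have [+ _] := fC i; apply.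
split=> // v; apply/IH => i; have [_ /(_ v)] := fC i.
by apply: (Ck_ext oU) => x Ux; rewrite DE //; exact: fd.
Qed.

Lemma Ck_coord k n (U : set 'rV[R]_n) (i : 'I_n) :
  open U -> Ck (V := 'rV[R]_n) (W := R) k U (fun v => v 0 i).
Proof.
move=> oU; case: k => [|k] /=; first by move=> x _; exact: coord_continuous.
split=> [x _|v]; first exact: differentiable_coord.
rewrite (_ : (fun _ => _) = fun=> v 0 i); first exact: Ck_cst.
apply/funext => x.
pose W : normedModType R := 'rV[R]_n.
have := @derive_mx R W 1 n (@id W) x v (@derivable_id _ W x v).
by rewrite derive_id => /(congr1 (fun w : 'rV_n => w 0 i)); rewrite mxE.
Qed.

End Ck.

(** * Smooth step functions *)

Section Step.
Variable R : realType.

Lemma Ck_inv (V : normedModType R) k U (f : V -> R) : open U -> Ck k U f ->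
  (forall x, U x -> f x != 0) -> Ck k U (fun x => (f x)^-1).
Proof.
move=> oU; elim: k => [|k IH] fC f0.
  by move=> x Ux; apply: continuousV; [exact: f0|exact: fC].
have [fd fD] := fC.
split=> [x Ux|v]; first by apply: differentiableV; [exact: fd|exact: f0].
have iC : Ck k U (fun x => (f x)^-1) by apply: IH => //; exact: CkW.
apply: (Ck_ext oU (f := fun x => -1 * ((f x)^-1 * (f x)^-1 * 'D_v f x))).
  move=> x Ux; rewrite deriveV; [|exact: f0|exact/diff_derivable/fd].
  by rewrite scaleNr mulN1r -exprVn expr2.
by apply: Ck_mul => //; [exact: Ck_cst|apply: Ck_mul => //; [exact: Ck_mul|exact: fD]].
Qed.

(** The derivative of x^-n exp(-1/x) is a combination of two members of the
same family, so smoothness of all of them follows by one induction. *)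
Definition flat_exp n (x : R) : R :=
  if 0 < x then x^-1 ^+ n * expR (- x^-1) else 0.

Lemma flat_exp_le0 n x : x <= 0 -> flat_exp n x = 0.
Proof. by rewrite /flat_exp ltNge => ->. Qed.

Lemma flat_exp_gt0 n x : 0 < x -> 0 < flat_exp n x.
Proof. by move=> x0; rewrite /flat_exp x0 mulr_gt0 ?expR_gt0 ?exprn_gt0 ?invr_gt0. Qed.

Lemma flat_exp_ge0 n x : 0 <= flat_exp n x.
Proof. by case: (lerP x 0) => [/flat_exp_le0->//|/flat_exp_gt0 /ltW]. Qed.

(** The square on the right gives differentiability at 0. It comes from exp y
>= y^(n+2) / (n+2)! at y = 1/x. *)
Lemma flat_exp_bound n x : `|flat_exp n x| <= n.+2`!%:R * `|x| ^+ 2.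
Proof.
have [x0|x0] := lerP x 0.
  by rewrite flat_exp_le0 // normr0 mulr_ge0 ?exprn_ge0.
rewrite (gtr0_norm (flat_exp_gt0 _ x0)) (gtr0_norm x0) /flat_exp x0.
have y0 : 0 < x^-1 by rewrite invr_gt0.
rewrite -[X in _ * X ^+ 2]invrK; move: (x^-1) y0 => y y0.
have f0 : 0 < (n.+2`!)%:R :> R by rewrite ltr0n fact_gt0.
rewrite expRN ler_pdivrMr ?expR_gt0 // exprVn.
apply: (@le_trans _ _ (n.+2`!%:R * y ^- 2 * (y ^+ n.+2 / n.+2`!%:R))); last first.
  apply: ler_wpM2l; first by rewrite mulr_ge0 ?invr_ge0 ?exprn_ge0 ?(ltW y0).
  by apply: le_trans (expR_ge1Dxn n.+1 (ltW y0)); rewrite lerDr ler01.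
have E : n.+2`!%:R / y ^+ 2 * (y ^+ n.+2 / n.+2`!%:R) = y ^+ n :> R.
  by rewrite -addn2 exprD; field; rewrite ?(gt_eqF f0) ?addn2 ?(gt_eqF f0) ?gt_eqF.
by rewrite E.
Qed.

Lemma is_derive_flat_exp n x :
  differentiable (flat_exp n) x /\
  'D_1 (flat_exp n) x = flat_exp n.+2 x - n%:R * flat_exp n.+1 x.
Proof.
have [x0|x0|x0] := ltgtP x 0.
- have nE : \near x, cst 0 x = flat_exp n x.
    near=> y; rewrite flat_exp_le0 // ltW //; near: y.
    by apply: open_nbhs_nbhs; split => //; exact: open_lt.
  split; first by apply: near_eq_differentiable nE _; exact: differentiable_cst.
  by rewrite -(near_eq_derive _ nE) derive_cst !flat_exp_le0 ?ltW// mulr0 subrr.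
- have xn0 : x != 0 by rewrite gt_eqF.
  have nE : \forall y \near x, (y^-1 ^+ n * expR (- y^-1)) = flat_exp n y.
    near=> y; rewrite /flat_exp ifT //; near: y.
    by apply: open_nbhs_nbhs; split => //; exact: open_gt.
  have dV : is_derive x 1 (fun y : R => y^-1) (- x ^- 2).
    by apply: DeriveDef; [exact: derivableV|rewrite deriveV // derive_id /GRing.scale
      /= mulr1].
  have dE : is_derive x 1 (fun y : R => expR (- y^-1)) (expR (- x^-1) * x ^- 2).
    have := @is_derive1_comp _ expR (fun y => - y^-1) x _ _ (is_derive_expR (- x^-1))
      (is_deriveN dV).
    by rewrite opprK.
  have dX : is_derive x 1 (fun y : R => y^-1 ^+ n) (- n%:R * x^-1 ^+ n.+1).
    case: n {nE} => [|n].
      apply: is_derive_eq; first exact: (is_derive_cst (1 : R) x 1).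
      by rewrite oppr0 mul0r.
    have := is_deriveX n.+1 dV; rewrite exprfctE => dX.
    rewrite (_ : - _ * _ = ((n.+1%:R * x^-1 ^+ n.+1.-1) *: - x ^- 2)); first exact: dX.
    by rewrite /GRing.scale /= -exprVn !exprS expr0; ring.
  have d : is_derive x 1 (fun y : R => y^-1 ^+ n * expR (- y^-1))
    (flat_exp n.+2 x - n%:R * flat_exp n.+1 x).
    rewrite (_ : _ - _ = x^-1 ^+ n *: (expR (- x^-1) * x ^- 2) +
      expR (- x^-1) *: (- n%:R * x^-1 ^+ n.+1)); first exact: (is_deriveM dX dE).
    by rewrite /flat_exp x0 /GRing.scale /= -exprVn !exprS; ring.
  have d' := near_eq_is_derive nE d.
  split; first by apply/derivable1_diffP; exact: ex_derive.
  by rewrite derive_val.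
- rewrite x0.
  have [] := @differentiable_littleo R R R (flat_exp n) 0.
    move=> e e0; near=> y; rewrite addr0 (flat_exp_le0 _ (lexx 0)) subr0.
    apply: le_trans (flat_exp_bound n y) _.
    rewrite expr2 mulrA ler_wpM2r // -ler_pdivlMl ?ltr0n ?fact_gt0 //.
    near: y.
    apply: (@nbhs0_le R R); rewrite mulr_gt0 ?invr_gt0 ?ltr0n ?fact_gt0 //.
  move=> df dE; split => //; rewrite deriveE // dE /= !flat_exp_le0 // mulr0 subrr //.
Unshelve. all: end_near. Qed.

Definition smooth (V : normedModType R) (f : V -> R) := forall k, Ck k setT f.

Lemma smooth_flat_exp n : smooth (flat_exp n).
Proof.
move=> k; elim: k n => [|k IH] n.
  by move=> x _; apply: differentiable_continuous; have [] := is_derive_flat_exp n x.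
split=> [x _|v]; first by have [] := is_derive_flat_exp n x.
have -> : 'D_v (flat_exp n) =
    (fun x => v * (flat_exp n.+2 x + - n%:R * flat_exp n.+1 x)).
  apply/funext => x; have [d E] := is_derive_flat_exp n x.
  rewrite mulNr -E deriveE // deriveE //.
  by rewrite -[v in LHS]mulr1 -[v * 1]/(v *: (1 : R)) linearZ.
do ?[apply: Ck_mul || apply: Ck_add || apply: Ck_cst || apply: IH];
  exact: openT.
Qed.

Section SmoothClosure.
Variable V : normedModType R.
Implicit Types f g : V -> R.

Lemma smooth_cst (a : R) : smooth (fun _ : V => a).
Proof. move=> k; exact: Ck_cst. Qed.

Lemma smoothD f g : smooth f -> smooth g -> smooth (fun x => f x + g x).
Proof. by move=> fS gS k; apply: Ck_add; [exact: openT|exact: fS|exact: gS]. Qed.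

Lemma smoothM f g : smooth f -> smooth g -> smooth (fun x => f x * g x).
Proof. by move=> fS gS k; apply: Ck_mul; [exact: openT|exact: fS|exact: gS]. Qed.

Lemma smoothN f : smooth f -> smooth (fun x => - f x).
Proof.
move=> fS; rewrite (_ : (fun x => - f x) = (fun x => -1 * f x)).
  by apply: smoothM => //; exact: smooth_cst.
by apply/funext => x; rewrite mulN1r.
Qed.

Lemma smoothB f g : smooth f -> smooth g -> smooth (fun x => f x - g x).
Proof. by move=> fS gS; apply: smoothD => //; exact: smoothN. Qed.

Lemma smooth_comp (g : R -> R) f : smooth g -> smooth f -> smooth (fun x => g (f x)).
Proof. by move=> gS fS k; apply: (Ck_comp1 openT (fS k) (gS k)). Qed.

End SmoothClosure.

Lemma smooth_id : smooth (fun x : R => x).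
Proof.
case=> [|k]; first by move=> x _; exact: cvg_id.
split=> [x _|v]; first by apply/derivable1_diffP.
rewrite (_ : (fun x => 'D_v _ x) = fun=> v); last by apply/funext => x;
  exact: derive_id.
exact: (@Ck_cst R R).
Qed.

Lemma smooth_mull (a : R) : smooth ( *%R a).
Proof. by apply: smoothM; [exact: smooth_cst|exact: smooth_id]. Qed.

Lemma smooth_coord n (i : 'I_n) : smooth (fun v : 'rV[R]_n => v 0 i).
Proof. by move=> k; apply: Ck_coord; exact: openT. Qed.

Definition step (x : R) : R := flat_exp 0 x / (flat_exp 0 x + flat_exp 0 (1 - x)).

Lemma step_den x : 0 < flat_exp 0 x + flat_exp 0 (1 - x).
Proof.
have [x0|x0] := lerP x 0.
  by rewrite flat_exp_le0 // add0r flat_exp_gt0 //; lra.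
by rewrite ltr_pwDl ?flat_exp_gt0 // flat_exp_ge0.
Qed.

Lemma smooth_step : smooth step.
Proof.
have e1 : smooth (flat_exp 0) by exact: smooth_flat_exp.
have e2 : smooth (fun x : R => flat_exp 0 (1 - x)).
  by apply: smooth_comp => //; apply: smoothB; [exact: smooth_cst|exact: smooth_id].
apply: smoothM => // k; apply: Ck_inv; [exact: openT|exact: smoothD|].
by move=> x _; rewrite gt_eqF // step_den.
Qed.

Lemma step_le0 x : x <= 0 -> step x = 0.
Proof. by move=> x0; rewrite /step flat_exp_le0 // mul0r. Qed.

Lemma step_ge1 x : 1 <= x -> step x = 1.
Proof.
move=> x1; have := step_den x; rewrite /step (@flat_exp_le0 _ (1 - x)) ?addr0;
  last by lra.
by move=> /gt_eqF /negbT ?; rewrite divff.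
Qed.

Lemma step_ge0 x : 0 <= step x.
Proof. by rewrite divr_ge0 ?flat_exp_ge0 // ltW // step_den. Qed.

Lemma step_le1 x : step x <= 1.
Proof. by rewrite ler_pdivrMr ?step_den // mul1r lerDl flat_exp_ge0. Qed.

(** Squeezed so as to be constant near 0 and near 1: a homotopy whose parameter
is [ramp x] is stationary at both ends. *)
Definition ramp (x : R) := step (2 * x - 2^-1).

Lemma ramp0 x : x <= 4^-1 -> ramp x = 0.
Proof. by move=> h; apply: step_le0; lra. Qed.

Lemma ramp1 x : 3 / 4 <= x -> ramp x = 1.
Proof. by move=> h; apply: step_ge1; lra. Qed.

Definition rise (e t : R) := step (2 / e * t - 1).

(** A smooth stand-in for the retraction onto [0,1]. It differs from the
identity of [0,1] only in the margins [0,e] and [1-e,1], which it maps to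
themselves, so maps that are constant on the margins do not see it. *)
Definition softclamp (e t : R) := t * rise e t + (1 - t) * (1 - rise e (1 - t)).

Section Softclamp.
Implicit Types e t : R.

Lemma rise0 e t : 0 < e -> t <= e / 2 -> rise e t = 0.
Proof.
move=> e0 h; apply: step_le0; rewrite subr_le0 mulrAC ler_pdivrMr //; lra.
Qed.

Lemma rise1 e t : 0 < e -> e <= t -> rise e t = 1.
Proof.
move=> e0 h; apply: step_ge1; rewrite lerBrDr mulrAC ler_pdivlMr //; lra.
Qed.

Lemma softclamp0 e t : 0 < e <= 4^-1 -> t <= e / 2 -> softclamp e t = 0.
Proof. by move=> /andP[e0 e4] h; rewrite /softclamp rise0 // rise1; lra. Qed.

Lemma softclamp1 e t : 0 < e <= 4^-1 -> 1 - e / 2 <= t -> softclamp e t = 1.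
Proof. by move=> /andP[e0 e4] h; rewrite /softclamp rise1 ?rise0; lra. Qed.

Lemma softclamp_id e t : 0 < e <= 4^-1 -> e <= t -> t <= 1 - e -> softclamp e t = t.
Proof. by move=> /andP[e0 e4] h h'; rewrite /softclamp !rise1; lra. Qed.

Lemma softclamp_le e t : 0 < e <= 4^-1 -> t <= e -> 0 <= softclamp e t <= e.
Proof.
move=> ee h; have [h'|h'] := lerP t (e / 2).
  by rewrite softclamp0 //; lra.
have /andP[l0 l1] : 0 <= rise e t <= 1 by rewrite step_ge0 step_le1.
have ? : 0 < e by lra.
rewrite /softclamp (@rise1 e (1 - t)) //; last by lra.
by apply/andP; split; nra.
Qed.

Lemma softclamp_ge e t : 0 < e <= 4^-1 -> 1 - e <= t -> 1 - e <= softclamp e t <= 1.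
Proof.
move=> ee h; have [h'|h'] := lerP (1 - e / 2) t.
  by rewrite softclamp1 //; lra.
have /andP[l0 l1] : 0 <= rise e (1 - t) <= 1 by rewrite step_ge0 step_le1.
have ? : 0 < e by lra.
rewrite /softclamp (@rise1 e t) //; last by lra.
by apply/andP; split; nra.
Qed.

Lemma softclamp_01 e t : 0 < e <= 4^-1 -> 0 <= softclamp e t <= 1.
Proof.
move=> ee; have [/(softclamp_le ee) h|h] := lerP t e; first by lra.
have [/(softclamp_ge ee) h'|h'] := lerP (1 - e) t; first by lra.
by rewrite softclamp_id //; lra.
Qed.

End Softclamp.

End Step.

Section SmoothProfiles.
Variables (R : realType) (V : normedModType R).
Implicit Types f : V -> R.

Lemma smooth_ramp f : smooth f -> smooth (fun v => ramp (f v)).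
Proof.
move=> fS; apply: (smooth_comp (@smooth_step R)); apply: smoothB.
  by apply: smoothM => //; exact: smooth_cst.
exact: smooth_cst.
Qed.

Lemma smooth_rise e f : smooth f -> smooth (fun v => rise e (f v)).
Proof.
move=> fS; apply: (smooth_comp (@smooth_step R)); apply: smoothB.
  by apply: smoothM => //; exact: smooth_cst.
exact: smooth_cst.
Qed.

Lemma smooth_softclamp e f : smooth f -> smooth (fun v => softclamp e (f v)).
Proof.
move=> fS; have f1 : smooth (fun v => 1 - f v).
  by apply: smoothB => //; exact: smooth_cst.
apply: smoothD; apply: smoothM => //; first exact: smooth_rise.
by apply: smoothB; [exact: smooth_cst|exact: smooth_rise].
Qed.

End SmoothProfiles.

Lemma smooth_softclampE (R : realType) (e : R) : smooth (softclamp e).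
Proof. by apply: smooth_softclamp; exact: smooth_id. Qed.

Ltac solve_smooth := repeat first
  [ assumption | exact: smooth_coord | exact: smooth_id | exact: smooth_cst
  | exact: smooth_mull | exact: smooth_softclampE |
  lazymatch goal with
  | |- smooth (fun x => ramp (@?f x)) => apply: smooth_ramp
  | |- smooth (fun x => rise _ (@?f x)) => apply: smooth_rise
  | |- smooth (fun x => softclamp _ (@?f x)) => apply: smooth_softclamp
  | |- smooth (fun x => @?f x + @?g x) => apply: smoothD
  | |- smooth (fun x => @?f x * @?g x) => apply: smoothM
  | |- smooth (fun x => - @?f x) => apply: smoothN
  | |- smooth (fun x => ?a (@?f x)) => apply: (smooth_comp (g := a)); first assumption
  end].

(** * Smooth maps of bounded rank into a manifold *)

Section SmoothRank.
Variables (R : realType) (n : nat) (M : smoothManifold R n).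

Lemma Ck_comp_vec k m p (U : set 'rV[R]_k) (V : set 'rV[R]_m) (h : 'rV[R]_k -> 'rV[R]_m)
    (g : 'rV[R]_m -> 'rV[R]_p) : open U -> open V ->
  (forall i, smooth (fun x : 'rV[R]_k => h x 0 i)) -> smooth_on V g ->
  (forall x, U x -> V (h x)) -> smooth_on U (fun x => g (h x)).
Proof.
move=> oU oV hS gS UV j; rewrite Ck_onE; apply/(Ck_rowP _ _ oU) => i.
apply: (Ck_comp_row oU _ _ UV (g := fun y : 'rV[R]_m => g y 0 i)) => [l|].
  by apply: (Ck_sub (@subsetT _ U)); exact: hS.
by have := gS j; rewrite Ck_onE => /(Ck_rowP _ _ oV); apply.
Qed.

Lemma smooth_differentiable k m (h : 'rV[R]_k -> 'rV[R]_m) x :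
  (forall i, smooth (fun x : 'rV[R]_k => h x 0 i)) -> differentiable h x.
Proof.
by move=> hS; apply/differentiable_rowP => i; have [+ _] := hS i 1%N; apply.
Qed.

Lemma jacobian_comp k m p (h : 'rV[R]_k -> 'rV[R]_m) (g : 'rV[R]_m -> 'rV[R]_p) x :
  differentiable h x -> differentiable g (h x) ->
  'J (fun y => g (h y)) x = 'J h x *m 'J g (h x).
Proof.
move=> dh dg; apply/row_matrixP => i; rewrite !rowE mulmxA.
have dgh : differentiable (g \o h) x by exact: differentiable_comp.
rewrite -!deriveEjacobian // deriveE // [in RHS]deriveE // (deriveE _ dh).
by rewrite -[RHS]/(('d g (h x) \o 'd h x) _) -diff_comp.
Qed.

(** Points are interior here: the chart expression g must be that of F on a
whole neighbourhood of x, not only on the part of it inside a cube. *)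
Definition smooth_rank_at k (r : nat) (F : 'rV[R]_k -> M) (x : 'rV[R]_k) : Prop :=
  exists (c : chart R n M) V g, [/\ atlas c, open V, V x, smooth_on V g &
    forall y, V y -> chart_dom c (F y) /\ to_coord c (F y) = g y] /\
    (\rank ('J g x) <= r)%N.

Definition smooth_rank k (r : nat) (F : 'rV[R]_k -> M) : Prop :=
  forall x, smooth_rank_at r F x.

Lemma smooth_rank_at_eq k r (F G : 'rV[R]_k -> M) (U : set 'rV[R]_k) x :
  open U -> U x -> (forall y, U y -> F y = G y) ->
  smooth_rank_at r F x -> smooth_rank_at r G x.
Proof.
move=> oU Ux FG [c [V [g [[ac oV Vx gS gF] gr]]]].
exists c, (V `&` U), g; split => //; split=> //; first exact: openI.
  by move=> j; rewrite Ck_onE; apply: Ck_sub (gS j); exact: subIsetl.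
by move=> y [Vy Uy]; rewrite -FG //; exact: gF.
Qed.

Lemma preimage_open k m (h : 'rV[R]_k -> 'rV[R]_m) V :
  (forall i, smooth (fun x : 'rV[R]_k => h x 0 i)) -> open V -> open (h @^-1` V).
Proof.
move=> hS oV; apply: open_comp => // x _.
exact/differentiable_continuous/smooth_differentiable.
Qed.

(** By the chain rule the Jacobian of g o h has that of g as a factor. *)
Lemma smooth_rank_local k m r (F : 'rV[R]_k -> M) (h : 'rV[R]_k -> 'rV[R]_m)
    (c : chart R n M) V g x :
  (forall i, smooth (fun x : 'rV[R]_k => h x 0 i)) ->
  atlas c -> open V -> V (h x) -> smooth_on V g ->
  (forall y, V (h y) -> chart_dom c (F y) /\ to_coord c (F y) = g (h y)) ->
  (\rank ('J g (h x)) <= r)%N -> smooth_rank_at r F x.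
Proof.
move=> hS ac oV Vx gS gF gr; have oU := preimage_open hS oV.
exists c, (h @^-1` V), (fun y => g (h y)); split.
  by split=> //; exact: (Ck_comp_vec (V := V)).
have dg : differentiable g (h x) by have [+ _] := gS 1%N; apply.
rewrite jacobian_comp //; last exact: smooth_differentiable.
exact: leq_trans (mxrankM_maxr _ _) gr.
Qed.

Lemma smooth_rank_comp k m r (h : 'rV[R]_k -> 'rV[R]_m) (F : 'rV[R]_m -> M) :
  (forall i, smooth (fun x : 'rV[R]_k => h x 0 i)) -> smooth_rank r F ->
  smooth_rank r (fun y => F (h y)).
Proof.
move=> hS FS x; have [c [V [g [[ac oV Vx gS gF] gr]]]] := FS (h x).
by apply: (smooth_rank_local hS ac oV Vx gS) => // y /gF.
Qed.

Lemma smooth_rankW k r r' (F : 'rV[R]_k -> M) : (r <= r')%N ->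
  smooth_rank r F -> smooth_rank r' F.
Proof.
move=> rr FS x; have [c [V [g [? gr]]]] := FS x.
by exists c, V, g; split => //; exact: leq_trans gr rr.
Qed.

(** The rank is at most the dimension of the source. With k = 1, maps that
factor through a line have rank at most 1. *)
Lemma smooth_rank_dim k r (F : 'rV[R]_k -> M) : smooth_rank r F -> smooth_rank k F.
Proof.
move=> FS x; have [c [V [g [? gr]]]] := FS x.
by exists c, V, g; split => //; exact: rank_leq_row.
Qed.

Lemma smooth_rank_rank_le k r (F : 'rV[R]_k -> M) : smooth_rank r F -> rank_le r F.
Proof.
move=> FS x _; have [c [V [g [[ac oV Vx gS gF] gr]]]] := FS x.
by exists c, V, g; split => //; split => // y /gF.
Qed.

Lemma rank_le_smooth k r (F : 'rV[R]_k -> M) : rank_le r F -> smooth_on_cube F.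
Proof. by move=> FS x /FS [c [V [g [? _]]]]; exists c, V, g. Qed.

Lemma smooth_on_cube_rank_le k (F : 'rV[R]_k -> M) : smooth_on_cube F -> rank_le k F.
Proof.
move=> FS x /FS [c [V [g ?]]]; exists c, V, g; split => //; exact: rank_leq_row.
Qed.

(** Since F does not see [softclamp], which sends the whole space into the
cube, a local extension of F at the image of x, composed with [softclamp], is a
chart expression of F around x, even when x lies on the boundary. *)
Lemma rank_le_smooth_rank k r e (F : 'rV[R]_k -> M) : 0 < e <= 4^-1 ->
  (forall y, F y = F (\row_i softclamp e (y 0 i))) -> rank_le r F -> smooth_rank r F.
Proof.
move=> ee FE FS x; pose h (y : 'rV[R]_k) : 'rV[R]_k := \row_i softclamp e (y 0 i).
have hc y : unit_cube (h y) by move=> i; rewrite mxE softclamp_01.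
have [c [V [g [[ac oV Vx gS gF] gr]]]] := FS _ (hc x).
apply: (smooth_rank_local (h := h) _ ac oV Vx gS) => // [i|y Vy].
  have -> : (fun y => h y 0 i) = (fun y : 'rV[R]_k => softclamp e (y 0 i)).
    by apply/funext => y; rewrite mxE.
  by solve_smooth.
by rewrite FE; exact: gF _ Vy (hc y).
Qed.

(** Because F and G agree on a strip around the seam, near each point the glued
map is one of the two. *)
Lemma smooth_rank_glue k r (F G : 'rV[R]_k -> M) (h : 'rV[R]_k -> R) (a d : R) :
  smooth h -> 0 < d -> smooth_rank r F -> smooth_rank r G ->
  (forall y, a - d < h y -> h y < a + d -> F y = G y) ->
  smooth_rank r (fun y => if h y <= a then F y else G y).
Proof.
move=> hS d0 FS GS FG x.
have hc : continuous h by move=> y; exact: (hS 0%N).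
have lo : open (h @^-1` [set z | z < a + d]).
  by apply: open_comp => [? _|]; [exact: hc|exact: open_lt].
have ro : open (h @^-1` [set z | a - d < z]).
  by apply: open_comp => [? _|]; [exact: hc|exact: open_gt].
have [xa|ax] := lerP (h x) a.
  apply: (smooth_rank_at_eq lo _ _ (FS x)) => [|y /= hy]; first by rewrite /=; lra.
  by case: ifPn => //; rewrite -ltNge => ay; apply: FG => //; lra.
apply: (smooth_rank_at_eq ro _ _ (GS x)) => [|y /= hy]; first by rewrite /=; lra.
by case: ifPn => // ya; apply/esym/FG => //; lra.
Qed.

(** The rank is written 1 because any map on the line has rank at most 1. *)
Definition smooth_path (f : R -> M) := smooth_rank 1 (fun v : 'rV[R]_1 => f (v 0 0)).
Definition smooth_square r (A : R -> R -> M) :=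
  smooth_rank r (fun v : 'rV[R]_2 => A (v 0 0) (v 0 1)).
Definition smooth_cube r (J : R -> R -> R -> M) :=
  smooth_rank r (fun v : 'rV[R]_3 => J (v 0 0) (v 0 1) (v 0 2)).

Lemma smooth_rank1 k f (h : 'rV[R]_k -> R) : smooth_path f -> smooth h ->
  smooth_rank 1 (fun v => f (h v)).
Proof.
move=> fS hS; pose H (v : 'rV[R]_k) : 'rV[R]_1 := \row_i h v.
have -> : (fun v => f (h v)) = (fun v => f (H v 0 0)) by apply/funext => v; rewrite mxE.
apply: (smooth_rank_comp _ fS) => i.
by rewrite (_ : (fun _ => _) = h) //; apply/funext => v; rewrite mxE.
Qed.

Lemma smooth_rank2 k r A (h1 h2 : 'rV[R]_k -> R) : smooth_square r A ->
  smooth h1 -> smooth h2 -> smooth_rank r (fun v => A (h1 v) (h2 v)).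
Proof.
move=> AS h1S h2S.
pose H (v : 'rV[R]_k) : 'rV[R]_2 := \row_i (if i == 0 then h1 v else h2 v).
have -> : (fun v => A (h1 v) (h2 v)) = (fun v => A (H v 0 0) (H v 0 1)).
  by apply/funext => v; rewrite !mxE.
apply: (smooth_rank_comp _ AS) => i; case: (eqVneq i 0) => i0.
  by rewrite (_ : (fun _ => _) = h1) //; apply/funext => v; rewrite mxE i0.
by rewrite (_ : (fun _ => _) = h2) //; apply/funext => v; rewrite mxE (negbTE i0).
Qed.

Lemma smooth_rank3 k r J (h1 h2 h3 : 'rV[R]_k -> R) : smooth_cube r J ->
  smooth h1 -> smooth h2 -> smooth h3 -> smooth_rank r (fun v => J (h1 v) (h2 v)
    (h3 v)).
Proof.
move=> JS h1S h2S h3S.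
pose H (v : 'rV[R]_k) : 'rV[R]_3 :=
  \row_i (if i == 0 then h1 v else if i == 1 then h2 v else h3 v).
have -> : (fun v => J (h1 v) (h2 v) (h3 v)) = (fun v => J (H v 0 0) (H v 0 1)
  (H v 0 2)).
  by apply/funext => v; rewrite !mxE.
apply: (smooth_rank_comp _ JS) => i; case: (eqVneq i 0) => i0.
  by rewrite (_ : (fun _ => _) = h1) //; apply/funext => v; rewrite mxE i0.
case: (eqVneq i 1) => i1.
  by rewrite (_ : (fun _ => _) = h2) //; apply/funext => v; rewrite mxE (negbTE i0) i1.
by rewrite (_ : (fun _ => _) = h3) //; apply/funext => v;
  rewrite mxE (negbTE i0) (negbTE i1).
Qed.

End SmoothRank.

(** * Margins and gluing in one variable *)

Section Flat.
Variable R : realType.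
Implicit Types (e t : R).

Definition flat (T : Type) e (f : R -> T) : Prop :=
  forall t, (t <= e -> f t = f 0) /\ (1 - e <= t -> f t = f 1).

Lemma flat0 T e (f : R -> T) t : flat e f -> t <= e -> f t = f 0.
Proof. by move=> /(_ t)[]. Qed.

Lemma flat1 T e (f : R -> T) t : flat e f -> 1 - e <= t -> f t = f 1.
Proof. by move=> /(_ t)[]. Qed.

Lemma flatW T e e' (f : R -> T) : e' <= e -> flat e f -> flat e' f.
Proof.
by move=> ee ff t; split=> ?; [apply: (flat0 ff)|apply: (flat1 ff)]; lra.
Qed.

Lemma flat_comp T U e (f : R -> T) (g : T -> U) : flat e f -> flat e (fun t => g (f t)).
Proof. by move=> ff t; split=> ?; [rewrite (flat0 ff)|rewrite (flat1 ff)]. Qed.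

Lemma flat_rev T e (f : R -> T) : flat e f -> flat e (fun t => f (1 - t)).
Proof.
move=> ff t; split=> ?.
  by rewrite (flat1 ff) ?subr0 //; lra.
by rewrite (flat0 ff) ?subrr //; lra.
Qed.

Lemma flat_ramp e : 0 < e <= 4^-1 -> flat e (@ramp R).
Proof. by move=> e4 t; split=> ?; [rewrite !ramp0|rewrite !ramp1] ; lra. Qed.

Lemma flat_softclamp e : 0 < e <= 4^-1 -> flat (e / 2) (softclamp e).
Proof.
by move=> e4 t; split=> ?; [rewrite !(softclamp0 e4)|rewrite !(softclamp1 e4)]; lra.
Qed.

Lemma softclamp_flat T e (f : R -> T) t : 0 < e <= 4^-1 -> flat e f ->
  f (softclamp e t) = f t.
Proof.
move=> e4 ff; have [h|h] := lerP t e.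
  by have := softclamp_le e4 h => ?; rewrite !(flat0 ff) //; lra.
have [h'|h'] := lerP (1 - e) t.
  by have := softclamp_ge e4 h' => ?; rewrite !(flat1 ff) //; lra.
by rewrite softclamp_id //; lra.
Qed.

Definition glue (T : Type) (c : R) (p q : R -> R) (f g : R -> T) t : T :=
  if t <= c then f (p t) else g (q t).

(** Conditions for f o p on the left of c and g o q on the right to fit
together: at the seam p has reached the right margin and q has not left the
left one, and near the ends both are in the outer margins, which leaves a
margin e' for the result. *)
Record cut e e' c (p q : R -> R) : Prop := Cut {
  cut_p : smooth p;
  cut_q : smooth q;
  cut_pos : 0 < e' <= 4^-1;
  cut_posW : e' <= e;
  cut_left : forall t, t <= e' -> t <= c /\ p t <= e;
  cut_right : forall t, 1 - e' <= t -> c < t /\ 1 - e <= q t;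
  cut_mid : exists2 d, 0 < d & forall t, c - d < t -> t < c + d ->
    1 - e <= p t /\ q t <= e }.

Lemma glue0 T e e' c p q (f g : R -> T) t : cut e e' c p q -> flat e f ->
  t <= e' -> glue c p q f g t = f 0.
Proof.
move=> C ff te; have [tc pt] := cut_left C te.
by rewrite /glue tc (flat0 ff).
Qed.

Lemma glue1 T e e' c p q (f g : R -> T) t : cut e e' c p q -> flat e g ->
  1 - e' <= t -> glue c p q f g t = g 1.
Proof.
move=> C fg te; have [tc pt] := cut_right C te.
by rewrite /glue leNgt tc (flat1 fg).
Qed.

Lemma flat_glue T e e' c p q (f g : R -> T) : cut e e' c p q -> flat e f -> flat e g ->
  flat e' (glue c p q f g).
Proof.
move=> C ff fg t; have := cut_pos C => e'0; split=> ?.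
  by rewrite !(glue0 _ C) //; lra.
by rewrite !(glue1 _ C) //; lra.
Qed.

Lemma cut_concat e : 0 < e <= 4^-1 -> cut e (e / 2) 2^-1 (fun t => 2 * t)
  (fun t => 2 * t - 1).
Proof.
move=> e4; split; [solve_smooth|solve_smooth|lra|lra| | |exists (e / 2); first lra].
- by move=> t ?; split; lra.
- by move=> t ?; split; lra.
- by move=> t ? ?; split; lra.
Qed.

(** Here f is squeezed into the left half of the left margin of g, where g is
constant. *)
Lemma cut_collar0 e : 0 < e <= 4^-1 ->
  cut e (e ^+ 2 / 4) (e / 2) (fun t => 2 / e * t) (fun t => t).
Proof.
move=> e4; have e0 : 0 < e by lra.
split; [solve_smooth|solve_smooth|nra|nra| | |exists (e ^+ 2 / 2); first nra].
- by move=> t ?; split; [nra|rewrite mulrAC ler_pdivrMr //; nra].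
- by move=> t ?; split; nra.
- by move=> t ? ?; split; [rewrite mulrAC ler_pdivlMr //; nra|nra].
Qed.

(** Here g is squeezed into the right half of the right margin of f. *)
Lemma cut_collar1 e : 0 < e <= 4^-1 ->
  cut e (e ^+ 2 / 4) (1 - e / 2) (fun t => t) (fun t => 2 / e * (t - 1) + 1).
Proof.
move=> e4; have e0 : 0 < e by lra.
split; [solve_smooth|solve_smooth|nra|nra| | |exists (e ^+ 2 / 2); first nra].
- by move=> t ?; split; nra.
- move=> t ?; split; first nra.
  have : 2 / e * (1 - t) <= e by rewrite mulrAC ler_pdivrMr //; nra.
  by lra.
- move=> t ? ?; split; first nra.
  have : 1 - e <= 2 / e * (1 - t) by rewrite mulrAC ler_pdivlMr //; nra.
  by lra.
Qed.

End Flat.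

(** * Homotopies of squares on the whole plane *)

Section Homotopies.
Variables (R : realType) (n : nat) (M : smoothManifold R n).
Implicit Types (f : R -> M) (A B C D H : R -> R -> M) (J K : R -> R -> R -> M) (e : R).

Lemma smooth_path_comp k f (h : 'rV[R]_k -> R) r : smooth_path f -> smooth h ->
  (0 < r)%N ->
  smooth_rank r (fun v => f (h v)).
Proof. by move=> fS hS r0; apply: smooth_rankW r0 _; exact: smooth_rank1. Qed.

Lemma smooth_square_row r A a : smooth_square r A -> smooth_path (A a).
Proof.
by move=> AS; apply: (smooth_rank_dim (r := r)); apply: (smooth_rank2 AS); solve_smooth.
Qed.

Lemma smooth_square_col r A a : smooth_square r A -> smooth_path (fun t => A t a).
Proof.
move=> AS; apply: (smooth_rank_dim (r := r)).
by apply: (smooth_rank2 (h1 := fun v : 'rV[R]_1 => v 0 0) (h2 := fun=> a) AS);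
  solve_smooth.
Qed.

Lemma smooth_cube_face0 r J a : smooth_cube r J -> smooth_square r (J a).
Proof. by move=> JS; apply: (smooth_rank3 JS); solve_smooth. Qed.

Lemma smooth_cube_face1 r J a : smooth_cube r J -> smooth_square r (fun t x => J t a x).
Proof.
move=> JS; apply: (smooth_rank3 (h1 := fun v : 'rV[R]_2 => v 0 0) (h2 := fun=> a)
  (h3 := fun v => v 0 1) JS); solve_smooth.
Qed.

Lemma smooth_squareW r r' A : (r <= r')%N -> smooth_square r A -> smooth_square r' A.
Proof. exact: smooth_rankW. Qed.

Lemma smooth_cubeW r r' J : (r <= r')%N -> smooth_cube r J -> smooth_cube r' J.
Proof. exact: smooth_rankW. Qed.

Lemma smooth_square_glue r e e' c p q A B : cut e e' c p q ->
  (forall s, flat e (fun t => A t s)) -> (forall s, flat e (fun t => B t s)) ->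
  (forall s, A 1 s = B 0 s) -> smooth_square r A -> smooth_square r B ->
    smooth_square r (glue c p q A B).
Proof.
move=> Cut fA fB AB AS BS; have [d d0 mid] := cut_mid Cut.
have [pS qS] := (cut_p Cut, cut_q Cut).
have -> : glue c p q A B = fun t s => if t <= c then A (p t) s else B (q t) s.
  by apply/funext => t; apply/funext => s; rewrite /glue; case: ifP.
apply: (smooth_rank_glue (h := fun v : 'rV[R]_2 => v 0 0)
  (F := fun v => A (p (v 0 0)) (v 0 1)) (G := fun v => B (q (v 0 0)) (v 0 1)) _ d0).
- by solve_smooth.
- by apply: (smooth_rank2 AS); solve_smooth.
- by apply: (smooth_rank2 BS); solve_smooth.
- move=> v h1 h2; have [h3 h4] := mid _ h1 h2.
  by rewrite (flat1 (fA _) h3) AB (flat0 (fB _) h4).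
Qed.

Lemma smooth_cube_glue r e e' c p q J K : cut e e' c p q ->
  (forall s x, flat e (fun t => J t s x)) -> (forall s x, flat e (fun t => K t s x)) ->
  (forall s x, J 1 s x = K 0 s x) -> smooth_cube r J -> smooth_cube r K ->
    smooth_cube r (glue c p q J K).
Proof.
move=> Cut fJ fK JK JS KS; have [d d0 mid] := cut_mid Cut.
have [pS qS] := (cut_p Cut, cut_q Cut).
have -> : glue c p q J K = fun t s x => if t <= c then J (p t) s x else K (q t) s x.
  by apply/funext => t; apply/funext => s; apply/funext => x; rewrite /glue; case: ifP.
apply: (smooth_rank_glue (h := fun v : 'rV[R]_3 => v 0 0)
  (F := fun v => J (p (v 0 0)) (v 0 1) (v 0 2))
  (G := fun v => K (q (v 0 0)) (v 0 1) (v 0 2)) _ d0).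
- by solve_smooth.
- by apply: (smooth_rank3 JS); solve_smooth.
- by apply: (smooth_rank3 KS); solve_smooth.
- move=> v h1 h2; have [h3 h4] := mid _ h1 h2.
  by rewrite (flat1 (fJ _ _) h3) JK (flat0 (fK _ _) h4).
Qed.

Lemma smooth_square_swap r A : smooth_square r A -> smooth_square r (fun t s => A s t).
Proof.
move=> AS; apply: (smooth_rank2 (h1 := fun v : 'rV[R]_2 => v 0 1)
  (h2 := fun v => v 0 0) AS); solve_smooth.
Qed.

(** A 2-path of rank at most r, extended by constancy beyond its sides to the
whole plane, with a margin e that is recorded so that constructions can refer
to it. *)
Record square e r A : Prop := Square {
  square_smooth : smooth_square r A;
  square_flat_t : forall s, flat e (fun t => A t s);
  square_flat_s : forall t, flat e (A t) }.

Lemma squareW e e' r A : e' <= e -> square e r A -> square e' r A.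
Proof. by move=> ee [? At As]; split=> // ?; exact: flatW ee _. Qed.

Lemma square_swap e r A : square e r A -> square e r (fun t s => A s t).
Proof. by move=> [AS At As]; split=> //; exact: smooth_square_swap. Qed.

Lemma square_rank2 e r A : square e r A -> square e 2 A.
Proof. by move=> [? ? ?]; split=> //; exact: smooth_rank_dim. Qed.

Lemma square_glue r e e' c p q A B : cut e e' c p q -> square e r A -> square e r B ->
  (forall s, A 1 s = B 0 s) -> square e' r (glue c p q A B).
Proof.
move=> Cut [AS At As] [BS Bt Bs] AB; split; first exact: (smooth_square_glue Cut).
- move=> s; have -> : (fun t => glue c p q A B t s) =
      glue c p q (fun t => A t s) (fun t => B t s).
    by apply/funext => t; rewrite /glue; case: ifP.
  exact: flat_glue Cut _ _.
- move=> t; apply: (flatW (cut_posW Cut)); rewrite /glue.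
  by case: ifP => _; [exact: As|exact: Bs].
Qed.

(** A rank-2 homotopy J from A to B, extended to the whole space. The corner
and face conditions say that its lateral faces are rank-1 homotopies;
smoothness and margins of the faces follow from those of J. *)
Record cube e J A B : Prop := Cube {
  cube_smooth : smooth_cube 2 J;
  cube_flat_t : forall s x, flat e (fun t => J t s x);
  cube_flat_s : forall t x, flat e (fun s => J t s x);
  cube_flat_x : forall t s, flat e (J t s);
  cube_start : forall t s, J t s 0 = A t s;
  cube_end : forall t s, J t s 1 = B t s;
  cube_corners : forall x, [/\ J 0 0 x = A 0 0, J 0 1 x = A 0 1, J 1 0 x = A 1 0 &
    J 1 1 x = A 1 1];
  cube_faces : [/\ smooth_square 1 (J 0), smooth_square 1 (J 1),
    smooth_square 1 (fun t x => J t 0 x) &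
    smooth_square 1 (fun t x => J t 1 x)] }.

Definition homotopic A B := exists J, exists2 e, 0 < e <= 4^-1 & cube e J A B.

Lemma cubeW e e' J A B : e' <= e -> cube e J A B -> cube e' J A B.
Proof.
by move=> ee [? Jt Js Jx ? ? ? ?]; split=> // ? ?; exact: flatW ee _.
Qed.

Lemma cube_homotopic e J A B : 0 < e <= 4^-1 -> cube e J A B -> homotopic A B.
Proof. by move=> ? ?; exists J, e. Qed.

Lemma thin_cube_faces J : smooth_cube 1 J -> [/\ smooth_square 1 (J 0),
  smooth_square 1 (J 1), smooth_square 1 (fun t x => J t 0 x) &
    smooth_square 1 (fun t x => J t 1 x)].
Proof. by move=> JS; split; (apply: smooth_cube_face0 || apply: smooth_cube_face1). Qed.

(** Gluing preserves the rank of the faces because the left and right faces are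
those of J and K, and the other two are glued from faces of J and K. *)
Lemma cube_glue e e' c p q J K A A' B B' : cut e e' c p q -> cube e J A B ->
  cube e K A' B' -> (forall s x, J 1 s x = K 0 s x) ->
  cube e' (glue c p q J K) (glue c p q A A') (glue c p q B B').
Proof.
move=> Cut [JS Jt Js Jx J0 J1 Jc [Jl Jr Jd Ju]] [KS Kt Ks Kx K0 K1 Kc [Kl Kr Kd Ku]] JK.
have e'0 := cut_pos Cut; have e'e := cut_posW Cut.
have gl0 s x : glue c p q J K 0 s x = J 0 s x.
  have [] := cut_left Cut (t := 0); first by lra.
  by rewrite /glue => -> h; rewrite (flat0 (Jt s x)).
have gl1 s x : glue c p q J K 1 s x = K 1 s x.
  have [] := cut_right Cut (t := 1); first by lra.
  by move=> h1 h; rewrite /glue leNgt h1 /= (flat1 (Kt s x)).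
have gA s : glue c p q A A' 0 s = A 0 s.
  have [] := cut_left Cut (t := 0); first by lra.
  by rewrite /glue => -> h; rewrite -!J0 (flat0 (Jt s 0)).
have gA' s : glue c p q A A' 1 s = A' 1 s.
  have [] := cut_right Cut (t := 1); first by lra.
  by move=> h1 h; rewrite /glue leNgt h1 /= -!K0 (flat1 (Kt s 0)).
split.
- exact: (smooth_cube_glue Cut).
- move=> s x; have -> : (fun t => glue c p q J K t s x) =
      glue c p q (fun t => J t s x) (fun t => K t s x).
    by apply/funext => t; rewrite /glue; case: ifP.
  exact: flat_glue Cut _ _.
- by move=> t x; apply: (flatW e'e); rewrite /glue; case: ifP.
- by move=> t s; apply: (flatW e'e); rewrite /glue; case: ifP.
- by move=> t s; rewrite /glue; case: ifP.
- by move=> t s; rewrite /glue; case: ifP.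
- by move=> x; rewrite !gl0 !gl1 !gA !gA'; have [? ? _ _] := Jc x; have [] := Kc x.
- split.
  + by rewrite (_ : glue _ _ _ _ _ 0 = J 0) //; apply/funext => s; apply/funext => x.
  + by rewrite (_ : glue _ _ _ _ _ 1 = K 1) //; apply/funext => s; apply/funext => x.
  + have -> : (fun t x => glue c p q J K t 0 x) =
        glue c p q (fun t => J t 0) (fun t => K t 0).
      by apply/funext => t; apply/funext => x; rewrite /glue; case: ifP.
    exact: (smooth_square_glue Cut).
  + have -> : (fun t x => glue c p q J K t 1 x) =
        glue c p q (fun t => J t 1) (fun t => K t 1).
      by apply/funext => t; apply/funext => x; rewrite /glue; case: ifP.
    exact: (smooth_square_glue Cut).
Qed.

Lemma cube_refl e A : square e 2 A -> cube e (fun t s _ => A t s) A A.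
Proof.
move=> [AS At As]; split=> //; first by apply: (smooth_rank2 AS); solve_smooth.
split.
- by apply: (smooth_path_comp (f := A 0)) => //;
  [exact: smooth_square_row AS|solve_smooth].
- by apply: (smooth_path_comp (f := A 1)) => //;
  [exact: smooth_square_row AS|solve_smooth].
- by apply: (smooth_path_comp (f := A^~ 0)) => //;
  [exact: smooth_square_col AS|solve_smooth].
- by apply: (smooth_path_comp (f := A^~ 1)) => //;
  [exact: smooth_square_col AS|solve_smooth].
Qed.

Lemma cube_sym e J A B : cube e J A B -> cube e (fun t s x => J t s (1 - x)) B A.
Proof.
move=> [JS Jt Js Jx J0 J1 Jc [Jl Jr Jd Ju]].
have rv (S : R -> R -> M) : smooth_square 1 S ->
  smooth_square 1 (fun t x => S t (1 - x)).
  by move=> SS; apply: (smooth_rank2 (h2 := fun v : 'rV[R]_2 => 1 - v 0 1) SS);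
    solve_smooth.
split=> //.
- by apply: (smooth_rank3 (h3 := fun v : 'rV[R]_3 => 1 - v 0 2) JS); solve_smooth.
- by move=> t s; exact: flat_rev.
- by move=> t s; rewrite subr0.
- by move=> t s; rewrite subrr.
- move=> x; have [a b c d] := Jc (1 - x); have [a1 b1 c1 d1] := Jc 1.
  by rewrite a b c d -!J1 a1 b1 c1 d1.
- by split; [exact: rv Jl|exact: rv Jr|exact: rv Jd|exact: rv Ju].
Qed.

Lemma cube_trans e J K A B C : 0 < e <= 4^-1 -> cube e J A B -> cube e K B C ->
  cube (e / 2) (fun t s => glue 2^-1 (fun x => 2 * x) (fun x => 2 * x - 1) (J t s)
    (K t s))
    A C.
Proof.
move=> e4 [JS Jt Js Jx J0 J1 Jc [Jl Jr Jd Ju]] [KS Kt Ks Kx K0 K1 Kc [Kl Kr Kd Ku]].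
move: (cut_concat e4); move: (2^-1 : R) (fun x : R => 2 * x)
  (fun x : R => 2 * x - 1) => c p q Cut.
have gl (S T : R -> R -> M) : (forall a, flat e (S a)) -> (forall a, flat e (T a)) ->
    (forall a, S a 1 = T a 0) -> smooth_square 1 S -> smooth_square 1 T ->
      smooth_square 1 (fun a => glue c p q (S a) (T a)).
  move=> fS fT ST SS TS.
  have := smooth_square_glue (A := fun x a => S a x) (B :=
    fun x a => T a x) Cut fS fT ST
    (smooth_square_swap SS) (smooth_square_swap TS).
  move=> /smooth_square_swap; congr smooth_square; apply/funext => a; apply/funext => x.
  by rewrite /glue; case: ifP.
split.
- have := smooth_cube_glue (J := fun x t s => J t s x) (K :=
  fun x t s => K t s x) (r := 2) Cut.
  move=> /(_ _ _ _ _ _) h.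
  have {}h : smooth_cube 2 (glue c p q (fun x t s => J t s x) (fun x t s => K t s x)).
    apply: h => //; first by move=> t s; rewrite J1 K0.
    - by apply: (smooth_rank3 (h1 := fun v : 'rV[R]_3 => v 0 1) (h2 := fun v => v 0 2)
        (h3 := fun v => v 0 0) JS); solve_smooth.
    - by apply: (smooth_rank3 (h1 := fun v : 'rV[R]_3 => v 0 1) (h2 := fun v => v 0 2)
        (h3 := fun v => v 0 0) KS); solve_smooth.
  have -> : (fun t s => glue c p q (J t s) (K t s)) =
     (fun t s x => glue c p q (fun x t s => J t s x) (fun x t s => K t s x) x t s).
    by apply/funext => t; apply/funext => s; apply/funext => x; rewrite /glue;
      case: ifP.
  by apply: (smooth_rank3 (h1 := fun v : 'rV[R]_3 => v 0 2) (h2 := fun v => v 0 0)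
        (h3 := fun v => v 0 1) h); solve_smooth.
- by move=> s x; apply: (flatW (cut_posW Cut)); rewrite /glue; case: (_ <= _).
- by move=> t x; apply: (flatW (cut_posW Cut)); rewrite /glue; case: (_ <= _).
- by move=> t s; exact: flat_glue Cut _ _.
- by move=> t s; rewrite (glue0 _ Cut (Jx t s)) ?J0 //; have := cut_pos Cut; lra.
- by move=> t s; rewrite (glue1 _ Cut (Kx t s)) ?K1 //; have := cut_pos Cut; lra.
- move=> x; have [a b cc d] := Jc 1; rewrite !J1 in a b cc d.
  rewrite /glue; case: ifP => _; first exact: Jc.
  by have [-> -> -> ->] := Kc (q x).
- have JK t s : J t s 1 = K t s 0 by rewrite J1 K0.
  split; [exact: (gl (J 0) (K 0))|exact: (gl (J 1) (K 1))|..].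
  + exact: (gl (fun t => J t 0) (fun t => K t 0)).
  + exact: (gl (fun t => J t 1) (fun t => K t 1)).
Qed.

Lemma homotopic_refl e A : 0 < e <= 4^-1 -> square e 2 A -> homotopic A A.
Proof. by move=> e4 /cube_refl; exact: cube_homotopic. Qed.

Lemma homotopic_sym A B : homotopic A B -> homotopic B A.
Proof. by move=> [J [e e4 /cube_sym]]; exact: cube_homotopic. Qed.

(** Margins can be shrunk, so the smaller of two works for both. *)
Lemma common_margin (P Q : R -> Prop) (e1 e2 : R) : 0 < e1 <= 4^-1 -> 0 < e2 <= 4^-1 ->
  (forall e e', e' <= e -> P e -> P e') -> (forall e e', e' <= e -> Q e -> Q e') ->
  P e1 -> Q e2 -> exists e, [/\ 0 < e <= 4^-1, P e & Q e].
Proof.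
move=> h1 h2 PW QW P1 Q2; have [e12|e21] := lerP e1 e2.
  by exists e1; split => //; exact: QW e12 Q2.
by exists e2; split => //; exact: PW (ltW e21) P1.
Qed.

Lemma homotopic_trans A B C : homotopic A B -> homotopic B C -> homotopic A C.
Proof.
move=> [J [e1 e1P H1]] [K [e2 e2P H2]].
have [||e [e4 Je Ke]] := common_margin (P := fun e => cube e J A B) (Q :=
  fun e => cube e K B C)
  e1P e2P _ _ H1 H2.
- by move=> ? ?; exact: cubeW.
- by move=> ? ?; exact: cubeW.
by apply: cube_homotopic (cube_trans e4 Je Ke); lra.
Qed.

Lemma cube_swap e J A B : cube e J A B ->
  cube e (fun t s x => J s t x) (fun t s => A s t) (fun t s => B s t).
Proof.
move=> [JS Jt Js Jx J0 J1 Jc [Jl Jr Jd Ju]]; split => //.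
- apply: (smooth_rank3 (h1 := fun v : 'rV[R]_3 => v 0 1) (h2 := fun v => v 0 0)
    (h3 := fun v => v 0 2) JS); solve_smooth.
- by move=> x; have [] := Jc x.
Qed.

Lemma homotopic_swap A B : homotopic A B -> homotopic (fun t s => A s t)
  (fun t s => B s t).
Proof. by move=> [J [e e4 /cube_swap]]; exact: cube_homotopic. Qed.

End Homotopies.

(** * Reparametrization and the groupoid laws *)

Section Constructions.
Variables (R : realType) (n : nat) (M : smoothManifold R n).
Implicit Types (f : R -> M) (A B C D H : R -> R -> M) (J K : R -> R -> R -> M) (e : R).

Definition concatR (T : Type) (f g : R -> T) : R -> T :=
  glue 2^-1 (fun t => 2 * t) (fun t => 2 * t - 1) f g.

Lemma square_flat e r A : square e r A -> flat e A.
Proof.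
by move=> [_ At _] t; split=> ?; apply/funext => s;
  [rewrite (flat0 (At s))|rewrite (flat1 (At s))].
Qed.

(** Smoothness of a function of two variables, stated by substitution so that
it can be used both on the plane and on the space. *)
Definition jointly_smooth (k : R -> R -> R) := forall (V : normedModType R) (f g : V ->
  R),
  smooth f -> smooth g -> smooth (fun v => k (f v) (g v)).

(** A homotopy that only moves the first variable of B. Its bottom and top
faces lie in a path, hence have rank at most 1. *)
Lemma cube_param e B k : smooth_square 2 B -> (forall t, flat e (B t)) ->
  jointly_smooth k ->
  (forall x, flat e (k^~ x)) -> (forall t, flat e (k t)) ->
  (forall x, [/\ B (k 0 x) 0 = B (k 0 0) 0, B (k 0 x) 1 = B (k 0 0) 1,
                 B (k 1 x) 0 = B (k 1 0) 0 & B (k 1 x) 1 = B (k 1 0) 1]) ->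
  smooth_square 1 (fun s x => B (k 0 x) s) ->
    smooth_square 1 (fun s x => B (k 1 x) s) ->
  cube e (fun t s x => B (k t x) s) (fun t s => B (k t 0) s) (fun t s => B (k t 1) s).
Proof.
move=> BS Bs kS kt kx kc k0 k1; split => //.
- apply: (smooth_rank2 (h1 := fun v : 'rV[R]_3 => k (v 0 0) (v 0 2)) BS);
  last by solve_smooth.
  by apply: kS; solve_smooth.
- by move=> s x; exact: (flat_comp (fun u => B u s) (kt x)).
- by move=> t s; exact: (flat_comp (fun u => B u s) (kx t)).
- split => //.
  + apply: (smooth_path_comp (f := B^~ 0) (h :=
    fun v : 'rV[R]_2 => k (v 0 0) (v 0 1))) => //.
      exact: smooth_square_col BS.
    by apply: kS; solve_smooth.
  + apply: (smooth_path_comp (f := B^~ 1) (h :=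
    fun v : 'rV[R]_2 => k (v 0 0) (v 0 1))) => //.
      exact: smooth_square_col BS.
    by apply: kS; solve_smooth.
Qed.

(** Reparametrizations with the same ends are joined by the segment between
them. The maps a and b may leave [0,1], as A is defined on the whole plane. *)
Lemma homotopic_reparam e e' A (a b : R -> R) : 0 < e' <= 4^-1 -> e' <= e ->
  square e 2 A ->
  smooth a -> smooth b -> flat e' a -> flat e' b -> a 0 = b 0 -> a 1 = b 1 ->
  homotopic (fun t => A (a t)) (fun t => A (b t)).
Proof.
move=> e'4 ee [AS At As] aS bS fa fb ab0 ab1.
pose k t x := (1 - ramp x) * a t + ramp x * b t.
have k0 x : k 0 x = a 0 by rewrite /k ab0; ring.
have k1 x : k 1 x = a 1 by rewrite /k ab1; ring.
have E : homotopic (fun t s => A (k t 0) s) (fun t s => A (k t 1) s).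
  apply: (cube_homotopic e'4 (J := fun t s x => A (k t x) s)); apply: cube_param => //.
  - by move=> t; exact: flatW ee _.
  - by move=> V f g fS gS; rewrite /k; solve_smooth.
  - by move=> x t; rewrite /k; split=> ?; [rewrite (flat0 fa) ?(flat0 fb)|rewrite
    (flat1 fa) ?(flat1 fb)].
  - by move=> t; exact: (flat_comp (fun u => (1 - u) * a t + u * b t) (flat_ramp e'4)).
  - by move=> x; rewrite !k0 !k1.
  - under eq_fun do under eq_fun do rewrite k0.
    apply: (smooth_path_comp (f := A (a 0)) (h := fun v : 'rV[R]_2 => v 0 0)) => //;
      last by solve_smooth.
    exact: smooth_square_row AS.
  - under eq_fun do under eq_fun do rewrite k1.
    apply: (smooth_path_comp (f := A (a 1)) (h := fun v : 'rV[R]_2 => v 0 0)) => //;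
      last by solve_smooth.
    exact: smooth_square_row AS.
have kx0 t : k t 0 = a t by rewrite /k ramp0; lra.
have kx1 t : k t 1 = b t by rewrite /k ramp1; lra.
by move: E; congr homotopic; apply/funext => t; apply/funext => s; rewrite ?kx0 ?kx1.
Qed.

Lemma square_softclamp e r A t : 0 < e <= 4^-1 -> square e r A ->
  A (softclamp e t) = A t.
Proof. by move=> e4 AS; exact: softclamp_flat (square_flat AS). Qed.

Lemma concatR_idl e A : 0 < e <= 4^-1 -> square e 2 A ->
  homotopic (concatR (fun=> A 0) A) A.
Proof.
move=> e4 AS; have softA t := square_softclamp t e4 AS.
have E : concatR (fun=> A 0) A = fun t => A (softclamp e (2 * t - 1)).
  apply/funext => t; rewrite /concatR /glue softA; case: lerP => // t2.
  by rewrite (flat0 (square_flat AS)) //; lra.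
have E' : A = fun t => A (softclamp e t) by apply/funext => t; rewrite softA.
(* The argument 2 t - 1 doubles the speed, hence the smaller margin. *)
rewrite E {2}E'; apply: (homotopic_reparam (e' := e / 4) _ _ AS);
  [lra|lra|solve_smooth|solve_smooth|..].
- by move=> t; split=> ?; [rewrite !softclamp0|rewrite !softclamp1]; lra.
- by apply: flatW (flat_softclamp e4); lra.
- by rewrite !softclamp0; lra.
- by rewrite !softclamp1; lra.
Qed.

Lemma concatR_idr e A : 0 < e <= 4^-1 -> square e 2 A ->
  homotopic (concatR A (fun=> A 1)) A.
Proof.
move=> e4 AS; have softA t := square_softclamp t e4 AS.
have E : concatR A (fun=> A 1) = fun t => A (softclamp e (2 * t)).
  apply/funext => t; rewrite /concatR /glue softA; case: lerP => // t2.
  by rewrite (flat1 (square_flat AS)) //; lra.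
have E' : A = fun t => A (softclamp e t) by apply/funext => t; rewrite softA.
rewrite E {2}E'; apply: (homotopic_reparam (e' := e / 4) _ _ AS);
  [lra|lra|solve_smooth|solve_smooth|..].
- by move=> t; split=> ?; [rewrite !softclamp0|rewrite !softclamp1]; lra.
- by apply: flatW (flat_softclamp e4); lra.
- by rewrite !softclamp0; lra.
- by rewrite !softclamp1; lra.
Qed.

(** Going along A and back follows a parameter that returns to 0, namely the
difference of two softclamps; it is contracted to 0. *)
Lemma concatR_inv e A : 0 < e <= 4^-1 -> square e 2 A ->
  homotopic (concatR A (fun t => A (1 - t))) (fun=> A 0).
Proof.
move=> e4 AS; have softA t := square_softclamp t e4 AS.
have E : concatR A (fun t => A (1 - t)) = fun t => A (softclamp e
  (2 * t) - softclamp e (2 * t - 1)).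
  apply/funext => t; rewrite /concatR /glue; case: lerP => t2.
    by rewrite (@softclamp0 _ _ (2 * t - 1)) ?subr0 ?softA //; lra.
  rewrite (@softclamp1 _ _ (2 * t)) //; last by lra.
  exact/esym/(softclamp_flat (2 * t - 1) e4 (flat_rev (square_flat AS))).
rewrite E.
apply: (homotopic_reparam (e' := e / 4) (b := fun=> 0) _ _ AS);
  [lra|lra|solve_smooth|solve_smooth|..].
- by move=> t; split=> ?; [rewrite !softclamp0|rewrite !softclamp1]; lra.
- by [].
- by rewrite !softclamp0; lra.
- by rewrite !softclamp1; lra.
Qed.

(** One bracketing is a reparametrization of the other: b maps the halves and
quarters of one to those of the other, with a stop at each junction. *)
Lemma concatR_assoc e A B C : 0 < e <= 4^-1 -> square e 2 A -> square e 2 B ->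
  square e 2 C ->
  A 1 = B 0 -> B 1 = C 0 -> homotopic (concatR A (concatR B C)) (concatR
    (concatR A B) C).
Proof.
move=> e4 AS BS CS AB BC.
have softA t := square_softclamp t e4 AS.
have softB t := square_softclamp t e4 BS.
have softC t := square_softclamp t e4 CS.
pose D := concatR (concatR A B) C.
have DS : square (e / 4) 2 D.
  rewrite (_ : e / 4 = e / 2 / 2); last by lra.
  have Cut2 : cut (e / 2) (e / 2 / 2) 2^-1 (fun t : R => 2 * t) (fun t => 2 * t - 1).
    by apply: cut_concat; lra.
  apply: (square_glue Cut2).
  - by apply: square_glue (cut_concat e4) AS BS _ => s; rewrite AB.
  - by apply: squareW CS; lra.
  - by move=> s; rewrite /concatR (glue1 _ (cut_concat e4) (square_flat BS)) ?BC //;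
    lra.
pose b t := softclamp e (2 * t) / 4 + softclamp e (4 * t - 2) / 4 + softclamp e
  (4 * t - 3) / 2.
(* D runs through A, B and C on quarter, quarter and half of [0,1]. *)
have D1 u : u <= 1 -> D (u / 4) = A u.
  move=> u1; rewrite /D /concatR /glue !ifT; [|lra|lra].
  by congr (A _); lra.
have D2 u : 0 <= u -> u <= 1 -> D (4^-1 + u / 4) = B u.
  move=> u0 u1; rewrite /D /concatR /glue ifT; last by lra.
  case: lerP => h; last by congr (B _); lra.
  have -> : u = 0 by lra.
  by rewrite -AB; congr (A _); lra.
have D3 u : 0 <= u -> D (2^-1 + u / 2) = C u.
  move=> u0; rewrite /D /concatR /glue; case: lerP => h; last by congr (C _); lra.
  rewrite ifF; last by apply/negbTE; rewrite -ltNge; lra.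
  have -> : u = 0 by lra.
  by rewrite -BC; congr (B _); lra.
have E : concatR A (concatR B C) = fun t => D (b t).
  apply/funext => t; rewrite {1}/concatR /glue; case: lerP => t2.
    have /andP[h0 h1] := softclamp_01 (2 * t) e4.
    have -> : b t = softclamp e (2 * t) / 4 by rewrite /b !(softclamp0 (t :=
      _ - _)) //; lra.
    by rewrite D1.
  rewrite /concatR /glue; case: lerP => t3.
    have /andP[h0 h1] := softclamp_01 (4 * t - 2) e4.
    have -> : b t = 4^-1 + softclamp e (4 * t - 2) / 4.
      by rewrite /b (@softclamp1 _ _ (2 * t)) // ?(@softclamp0 _ _ (4 * t - 3)) //; lra.
    by rewrite D2 // softB; congr (B _); lra.
  have /andP[h0 h1] := softclamp_01 (4 * t - 3) e4.
  have -> : b t = 2^-1 + softclamp e (4 * t - 3) / 2.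
    by rewrite /b (@softclamp1 _ _ (2 * t)) // ?(@softclamp1 _ _ (4 * t - 2)) //; lra.
  by rewrite D3 // softC; congr (C _); lra.
have E' : D = fun t => D (softclamp (e / 4) t).
  by apply/funext => t; rewrite (softclamp_flat _ _ (square_flat DS)) //; lra.
rewrite -/D E {2}E'; apply: (homotopic_reparam (e' := e / 8) _ _ DS);
  [lra|lra|rewrite /b; solve_smooth|solve_smooth|..].
- by move=> t; rewrite /b; split=> ?; [rewrite !softclamp0|rewrite !softclamp1]; lra.
- by apply: flatW (flat_softclamp _); lra.
- by rewrite /b !softclamp0; lra.
- by rewrite /b !softclamp1; lra.
Qed.

End Constructions.

(** * Squares of rank at most 1 and independence of representatives *)

Section Thin.
Variables (R : realType) (n : nat) (M : smoothManifold R n).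
Implicit Types (f : R -> M) (A B D H K L : R -> R -> M) (J C : R -> R -> R ->
  M) (e : R).

(** Vanishes near 0 and 1, and is 1 away from the margins. *)
Definition bump e x : R := rise e x * rise e (1 - x).

Lemma bump0 e x : 0 < e <= 4^-1 -> x <= e / 2 -> bump e x = 0.
Proof. by move=> ? ?; rewrite /bump rise0 ?mul0r; lra. Qed.

Lemma bump1 e x : 0 < e <= 4^-1 -> 1 - e / 2 <= x -> bump e x = 0.
Proof. by move=> ? ?; rewrite /bump mulrC rise0 ?mul0r; lra. Qed.

Lemma bump_mid e x : 0 < e <= 4^-1 -> e <= x -> x <= 1 - e -> bump e x = 1.
Proof. by move=> ? ? ?; rewrite /bump !rise1 ?mulr1; lra. Qed.

(** As y goes from 0 to 1/2, the point (s, x) is pulled down in s by the factor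
m y x, except for x near 0 and 1. In the middle, K is only evaluated where K
and L agree: on the side s = 0 for x away from 0 and 1, and for x in the
margins, where K and L depend on s through their sides x = 0 and x = 1 only.
Then L is unfolded in the same way. The side s = 1 sweeps across both squares,
which is harmless as they have rank at most 1. *)
Lemma three_sides e K L : 0 < e <= 4^-1 -> square e 1 K -> square e 1 L -> K 0 = L 0 ->
  (forall s, K s 0 = L s 0) -> (forall s, K s 1 = L s 1) ->
  exists J, [/\ cube (e / 2) J K L, smooth_cube 1 J, forall x y, J 0 x y = K 0 x,
    forall s y, J s 0 y = K s 0 & forall s y, J s 1 y = K s 1].
Proof.
move=> e4 KS LS KL0 KLd KLu; have [e0 e1] := andP e4.
have ? : 0 < (4^-1 : R) <= 4^-1 by lra.
pose m y x := 1 - bump 4^-1 y * bump e x.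
pose J s x y := if y <= 2^-1 then K (softclamp e s * m y x) x else L
  (softclamp e s * m y x) x.
have K0 s x : x <= e -> K s x = K s 0 by move=> h; exact: (flat0 (square_flat_s KS s)).
have K1 s x : 1 - e <= x -> K s x = K s 1 by move=> h;
  exact: (flat1 (square_flat_s KS s)).
have L0 s x : x <= e -> L s x = L s 0 by move=> h; exact: (flat0 (square_flat_s LS s)).
have L1 s x : 1 - e <= x -> L s x = L s 1 by move=> h;
  exact: (flat1 (square_flat_s LS s)).
have Kl s x : s <= e -> K s x = K 0 x by move=> h; exact: (flat0 (square_flat_t KS x)).
have Ks s x : K (softclamp e s) x = K s x by exact: (softclamp_flat (f :=
  K^~ x) s e4 (square_flat_t KS x)).
have Ls s x : L (softclamp e s) x = L s x by exact: (softclamp_flat (f :=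
  L^~ x) s e4 (square_flat_t LS x)).
have mx0 y x : x <= e / 2 -> m y x = 1 by move=> h; rewrite /m (bump0 e4 h) mulr0 subr0.
have mx1 y x : 1 - e / 2 <= x -> m y x = 1 by move=> h;
  rewrite /m (bump1 e4 h) mulr0 subr0.
have my0 y x : y <= 8^-1 -> m y x = 1.
  by move=> h; rewrite /m bump0 ?mul0r ?subr0 //; lra.
have my1 y x : 1 - 8^-1 <= y -> m y x = 1.
  by move=> h; rewrite /m bump1 ?mul0r ?subr0 //; lra.
(* K and L are pulled down completely for y between 1/4 and 3/4. *)
have KLmid y x s : 4^-1 <= y -> y <= 3 / 4 -> K (s * m y x) x = L (s * m y x) x.
  move=> y0 y1; have [h|h] := lerP x e; first by rewrite K0 // L0 // KLd.
  have [h'|h'] := lerP (1 - e) x; first by rewrite K1 // L1 // KLu.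
  have -> : m y x = 0 by rewrite /m !bump_mid ?mulr1 ?subrr //; lra.
  by rewrite mulr0 KL0.
have smm k (h1 h2 h3 : 'rV[R]_k -> R) : smooth h1 -> smooth h2 -> smooth h3 ->
    smooth (fun v => softclamp e (h1 v) * m (h2 v) (h3 v)).
  by move=> ? ? ?; rewrite /m /bump; solve_smooth.
have JS : smooth_cube 1 J.
  apply: (@smooth_rank_glue _ _ _ _ _
    (fun v : 'rV[R]_3 => K (softclamp e (v 0 0) * m (v 0 2) (v 0 1)) (v 0 1))
    (fun v : 'rV[R]_3 => L (softclamp e (v 0 0) * m (v 0 2) (v 0 1)) (v 0 1))
    (fun v => v 0 2) 2^-1 4^-1); [by solve_smooth|lra| | |].
  - by apply: (smooth_rank2 (square_smooth KS)); [apply: smm|]; solve_smooth.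
  - by apply: (smooth_rank2 (square_smooth LS)); [apply: smm|]; solve_smooth.
  - by move=> v h1 h2; apply: KLmid; lra.
have Jy0 s x y : y <= 8^-1 -> J s x y = K s x.
  by move=> h; rewrite /J ifT ?my0 // ?mulr1 ?Ks //; lra.
have Jy1 s x y : 1 - 8^-1 <= y -> J s x y = L s x.
  by move=> h; rewrite /J leNgt ifF ?my1 // ?mulr1 ?Ls //; apply/negbTE; rewrite negbK;
    lra.
have J0 x y : J 0 x y = K 0 x.
  by rewrite /J softclamp0 ?mul0r ?KL0; [case: ifP|lra|lra].
have Jd s x y : x <= e / 2 -> J s x y = K s 0.
  move=> h; have xe : x <= e by lra.
  by rewrite /J !mx0 // mulr1 Ks Ls K0 // L0 // KLd; case: ifP.
have Ju s x y : 1 - e / 2 <= x -> J s x y = K s 1.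
  move=> h; have xe : 1 - e <= x by lra.
  by rewrite /J !mx1 // mulr1 Ks Ls K1 // L1 // KLu; case: ifP.
exists J; split => //; last 2 first.
- by move=> s y; apply: Jd; lra.
- by move=> s y; apply: Ju; lra.
split.
- exact: smooth_cubeW JS.
- by move=> x y; exact: (flat_comp (fun u => if y <= 2^-1 then K (u * m y x) x else L
  (u * m y x) x) (flat_softclamp e4)).
- by move=> s y x; split=> h; [rewrite (Jd _ _ _ h) Jd|rewrite (Ju _ _ _ h) Ju] => //;
  lra.
- by move=> s x y; split=> h; [rewrite !Jy0|rewrite !Jy1] => //; lra.
- by move=> s x; apply: Jy0; lra.
- by move=> s x; apply: Jy1; lra.
- by move=> y; split; [exact: J0|exact: J0|apply: Jd; lra|apply: Ju; lra].
- exact: thin_cube_faces.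
Qed.

(** The right face of J and L are squares of rank at most 1 that agree on three
sides, because a rank-1 homotopy is constant at its ends. The homotopy between
them, used in the direction of t, is inserted in the right margin of J, where
at x = 0 and x = 1 it is invisible. *)
Lemma change_right_face e J A B L : 0 < e <= 4^-1 -> cube e J A B -> square e 1 L ->
  (forall s, L s 0 = A 1 s) -> (forall s, L s 1 = B 1 s) ->
  (forall x, L 0 x = A 1 0) -> (forall x, L 1 x = A 1 1) ->
  exists J', (exists2 e', 0 < e' <= e & cube e' J' A B) /\ J' 1 = L.
Proof.
move=> e4 HJ LS Ld Lu Ll Lr; have [JS Jt Js Jx J0 J1 Jc [_ Jr _ _]] := HJ.
have J1S : square e 1 (J 1) by split.
have [|||C [CH CS C0 Cd Cu]] := three_sides e4 J1S LS.
- by apply/funext => x; rewrite Ll; have [] := Jc x.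
- by move=> s; rewrite J0 Ld.
- by move=> s; rewrite J1 Lu.
have e2 : 0 < e / 2 <= 4^-1 by lra.
pose C' t s x := C s x t.
have HC : cube (e / 2) C' (fun _ => A 1) (fun _ => B 1).
  have [_ Ct Cs Cx CK CL _ _] := CH.
  have C'S : smooth_cube 1 C'.
    by apply: (smooth_rank3 (h1 := fun v : 'rV[R]_3 => v 0 1) (h2 := fun v => v 0 2)
      (h3 := fun v => v 0 0) CS); solve_smooth.
  split; rewrite /C' //; first exact: smooth_cubeW C'S.
  - by move=> t s; rewrite Cd J0.
  - by move=> t s; rewrite Cu J1.
  - by move=> x; rewrite !CK !CL Ll Lr; have [_ _ -> ->] := Jc x.
  - exact: (thin_cube_faces C'S).
pose G T := @glue R T (1 - e / 2 / 2) (fun t => t) (fun t => 2 / (e / 2) * (t - 1) + 1).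
(* In the margin a square is constant in t, so a collar that is constant in t
   as well changes nothing. *)
have GE (D : R -> R -> M) : flat e D -> G _ D (fun=> D 1) = D.
  move=> fD; apply/funext => t; rewrite /G /glue; case: lerP => // h.
  by rewrite (flat1 fD) //; lra.
have fA : flat e A.
  have E : (fun t s => J t s 0) = A by apply/funext => t; apply/funext => s; rewrite J0.
  by move=> t; rewrite -E; split=> h; apply/funext => s;
    [exact: flat0 (Jt s 0) h|exact: flat1 (Jt s 0) h].
have fB : flat e B.
  have E : (fun t s => J t s 1) = B by apply/funext => t; apply/funext => s; rewrite J1.
  by move=> t; rewrite -E; split=> h; apply/funext => s;
    [exact: flat0 (Jt s 1) h|exact: flat1 (Jt s 1) h].
exists (G _ J C'); split.
  exists ((e / 2) ^+ 2 / 4); first nra.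
  rewrite -[A in cube _ _ A](GE _ fA) -[B in cube _ _ _ B](GE _ fB).
  apply: (cube_glue (cut_collar1 e2)) HC _ => //; first by apply: cubeW HJ; lra.
  by move=> s x; rewrite /C'; have [_ _ _ _ CK _ _ _] := CH; rewrite CK.
apply/funext => s; apply/funext => x; rewrite /G /glue ifF /C'; last first.
  by apply/negbTE; rewrite -ltNge; lra.
by rewrite subrr mulr0 add0r; have [_ _ _ _ _ CL _ _] := CH; rewrite CL.
Qed.

(** The two homotopies differ on the common side; the first is changed there to
match the second. *)
Lemma concatR_wd A A' B B' : homotopic A A' -> homotopic B B' -> A 1 = B 0 ->
  A' 1 = B' 0 ->
  homotopic (concatR A B) (concatR A' B').
Proof.
move=> [J [e1 e1P H1]] [K [e2 e2P H2]] AB AB'.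
have [||e [e4 HJ HK]] := common_margin (P := fun e => cube e J A A')
  (Q := fun e => cube e K B B') e1P e2P _ _ H1 H2.
- by move=> ? ?; exact: cubeW.
- by move=> ? ?; exact: cubeW.
have [KS Kt Ks Kx K0 K1 Kc [Kl _ _ _]] := HK.
have K0S : square e 1 (K 0) by split.
have [||||J' [[e' e'e HJ'] J'K]] := change_right_face e4 HJ K0S.
- by move=> s; rewrite K0 AB.
- by move=> s; rewrite K1 AB'.
- by move=> x; rewrite AB; have [] := Kc x.
- by move=> x; rewrite AB; have [] := Kc x.
have e'4 : 0 < e' <= 4^-1 by lra.
have HK' : cube e' K B B' by apply: cubeW HK; lra.
have h4 : 0 < e' / 2 <= 4^-1 by lra.
by apply: (cube_homotopic h4 (cube_glue (cut_concat e'4) HJ' HK' _)) => s x;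
  rewrite J'K.
Qed.

End Thin.

(** * Collars, shrinking, and thin fillers *)

Section Collar.
Variables (R : realType) (n : nat) (M : smoothManifold R n).
Implicit Types (f : R -> M) (A B H : R -> R -> M) (J : R -> R -> R -> M) (e : R).

(** The homotopy draws H out of the left side of A; it is constant on the
bottom and top sides because H is. *)
Lemma collar_left e A H : 0 < e <= 4^-1 -> square e 2 A -> square e 1 H -> H 1 = A 0 ->
  (forall t, H t 0 = A 0 0) -> (forall t, H t 1 = A 0 1) ->
  exists A', [/\ homotopic A A',
    exists2 e', 0 < e' <= 4^-1 & forall r, (0 < r)%N -> square e r A -> square e' r A',
    A' 0 = H 0, A' 1 = A 1 & forall t, A' t 0 = A t 0 /\ A' t 1 = A t 1].
Proof.
move=> e4 AS HS HA Hd Hu; have e2 : 0 < e / 2 <= 4^-1 by lra.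
have e24 : 0 < (e / 2) ^+ 2 / 4 <= 4^-1 by nra.
have ee : e / 2 <= e by lra.
pose k t x := 1 - ramp x * (1 - softclamp e t).
have kS : jointly_smooth k by move=> V f g fS gS; rewrite /k; solve_smooth.
have HC : cube (e / 2) (fun t s x => H (k t x) s) (fun t s => H (k t 0) s)
    (fun t s => H (k t 1) s).
  have HS' : smooth_cube 1 (fun t s x => H (k t x) s).
    apply: (smooth_rank2 (h1 := fun v : 'rV[R]_3 => k (v 0 0) (v 0 2))
      (square_smooth HS)); last by solve_smooth.
    by apply: kS; solve_smooth.
  have [F0 F1 _ _] := thin_cube_faces HS'.
  apply: cube_param => //.
  - by have [] := square_rank2 HS.
  - by move=> t; exact: flatW ee (square_flat_s HS t).
  - by move=> x; exact: (flat_comp (fun u => 1 - ramp x * (1 - u)) (flat_softclamp e4)).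
  - by move=> t; exact: (flat_comp (fun u => 1 - u * (1 - softclamp e t))
    (flat_ramp e2)).
  - by move=> x; rewrite !Hd !Hu.
have kt0 t : k t 0 = 1 by rewrite /k ramp0; lra.
have kt1 t : k t 1 = softclamp e t by rewrite /k ramp1; lra.
have k1x x : k 1 x = 1 by rewrite /k softclamp1; lra.
have {}HC : cube (e / 2) (fun t s x => H (k t x) s) (fun=> A 0) H.
  move: HC; congr cube; apply/funext => t; apply/funext => s.
    by rewrite kt0 HA.
  by rewrite kt1 (softclamp_flat _ e4 (square_flat HS)).
(* The cube has margin e / 2, and the collar takes up half of it. *)
pose G T := @glue R T (e / 2 / 2) (fun t => 2 / (e / 2) * t) (fun t => t).
have AS2 := squareW ee AS.
have GA : G _ (fun=> A 0) A = A.
  apply/funext => t; rewrite /G /glue; case: lerP => // h.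
  by rewrite (flat0 (square_flat AS)) //; lra.
have HAs s : H 1 s = A 0 s by rewrite HA.
exists (G _ H A); split.
- have k1 s x : H (k 1 x) s = A 0 s by rewrite k1x HA.
  have := cube_glue (cut_collar0 e2) HC (cube_refl AS2) k1.
  rewrite -/(G _ (fun=> A 0) A) -/(G _ H A) GA; exact: cube_homotopic.
- exists ((e / 2) ^+ 2 / 4) => // r r0 Ar.
  have HSr : square (e / 2) r H.
    by apply: squareW ee _; case: HS => S1 S2 S3; split => //; exact: smooth_squareW S1.
  exact: (square_glue (cut_collar0 e2) HSr (squareW ee Ar) HAs).
- by rewrite /G /glue ifT ?mulr0 //; lra.
- by rewrite /G /glue ifF //; apply/negbTE; rewrite -ltNge; lra.
- move=> t; rewrite /G /glue; case: lerP => h //.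
  by rewrite Hd Hu (flat0 (square_flat AS)) //; lra.
Qed.

(** B retracts to its left side; the right face of this homotopy is B itself,
of rank at most 1. *)
Lemma concatR_shrink e A B : 0 < e <= 4^-1 -> square e 2 A -> square e 1 B ->
  A 1 = B 0 ->
  (forall t, B t 0 = A 1 0) -> (forall t, B t 1 = A 1 1) -> homotopic (concatR A B) A.
Proof.
move=> e4 AS BS AB Bd Bu; have e2 : 0 < e / 2 <= 4^-1 by lra.
have e22 : 0 < e / 2 / 2 <= 4^-1 by lra.
have ee : e / 2 <= e by lra.
pose k t x := (1 - ramp x) * softclamp e t.
have kS : jointly_smooth k by move=> V f g fS gS; rewrite /k; solve_smooth.
have HC : cube (e / 2) (fun t s x => B (k t x) s) (fun t s => B (k t 0) s)
    (fun t s => B (k t 1) s).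
  have BS' : smooth_cube 1 (fun t s x => B (k t x) s).
    apply: (smooth_rank2 (h1 := fun v : 'rV[R]_3 => k (v 0 0) (v 0 2))
      (square_smooth BS)); last by solve_smooth.
    by apply: kS; solve_smooth.
  have [F0 F1 _ _] := thin_cube_faces BS'.
  apply: cube_param => //.
  - by have [] := square_rank2 BS.
  - by move=> t; exact: flatW ee (square_flat_s BS t).
  - by move=> x; exact: (flat_comp (fun u => (1 - ramp x) * u) (flat_softclamp e4)).
  - by move=> t; exact: (flat_comp (fun u => (1 - u) * softclamp e t) (flat_ramp e2)).
  - by move=> x; rewrite !Bd !Bu.
have kt0 t : k t 0 = softclamp e t by rewrite /k ramp0; lra.
have kt1 t : k t 1 = 0 by rewrite /k ramp1; lra.
have k0x x : k 0 x = 0 by rewrite /k softclamp0; lra.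
have {}HC : cube (e / 2) (fun t s x => B (k t x) s) B (fun=> A 1).
  move: HC; congr cube; apply/funext => t; apply/funext => s.
    by rewrite kt0 (softclamp_flat _ e4 (square_flat BS)).
  by rewrite kt1 AB.
apply: homotopic_trans (concatR_idr e4 AS); apply: (cube_homotopic e22).
apply: (cube_glue (cut_concat e2) (cube_refl (squareW ee AS)) HC) => s x.
by rewrite k0x AB.
Qed.

(** The diagonal coordinate (t + s) / 2 runs through the paths, and s - t
decides between the bottom and the top of H. After softclamping t and s, the
transition takes place on the band where s - t is at most e / 2 in absolute
value, which meets the boundary of the square only near the two corners where H
is constant. *)
Lemma thin_filler_square e f g h k H : 0 < e <= 4^-1 -> flat e f -> flat e g ->
  flat e h -> flat e k -> f 1 = g 0 -> h 1 = k 0 -> square e 1 H ->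
  (forall t, H t 0 = concatR f g t) -> (forall t, H t 1 = concatR h k t) ->
  (forall x, H 0 x = H 0 0) -> (forall x, H 1 x = H 1 0) ->
  exists Q, [/\ square (e / 2) 1 Q, forall t, Q t 0 = f t, forall t, Q t 1 = k t,
    forall s, Q 0 s = h s & forall s, Q 1 s = g s].
Proof.
move=> e4 ff fg fh fk fg1 hk1 HS H0 H1 Hl Hr; have [e0 _] := andP e4.
pose Q t s := H ((softclamp e t + softclamp e s) / 2) (ramp
  (((softclamp e s - softclamp e t) / e + 1) / 2)).
have H00 u y : u <= e -> H u y = H 0 0.
  by move=> ue; rewrite (flat0 (square_flat_t HS y)) // Hl.
have H11 u y : 1 - e <= u -> H u y = H 1 0.
  by move=> ue; rewrite (flat1 (square_flat_t HS y)) // Hr.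
have S0 : softclamp e 0 = 0 by rewrite softclamp0 //; lra.
have S1 : softclamp e 1 = 1 by rewrite softclamp1 //; lra.
have s01 t : 0 <= softclamp e t <= 1 by exact: softclamp_01.
have below u v : v <= - (e / 2) -> H u (ramp ((v / e + 1) / 2)) = H u 0.
  move=> ve; rewrite (@ramp0 _ (_ / 2)) //.
  by have : v / e <= - 2^-1 by [rewrite ler_pdivrMr //; lra]; lra.
have above u v : e / 2 <= v -> H u (ramp ((v / e + 1) / 2)) = H u 1.
  move=> ve; rewrite (@ramp1 _ (_ / 2)) //.
  by have : 2^-1 <= v / e by [rewrite ler_pdivlMr //; lra]; lra.
exists Q; split.
- split.
  + apply: (smooth_rank2 (square_smooth HS)
     (h1 := fun v : 'rV[R]_2 => (softclamp e (v 0 0) + softclamp e (v 0 1)) / 2)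
     (h2 := fun v => ramp (((softclamp e (v 0 1) - softclamp e
       (v 0 0)) / e + 1) / 2))); solve_smooth.
  + by move=> s; exact: (flat_comp (fun u => H ((u + softclamp e s) / 2)
      (ramp (((softclamp e s - u) / e + 1) / 2))) (flat_softclamp e4)).
  + by move=> t; exact: (flat_comp (fun u => H ((softclamp e t + u) / 2)
      (ramp (((u - softclamp e t) / e + 1) / 2))) (flat_softclamp e4)).
- move=> t; rewrite /Q S0 -(softclamp_flat t e4 ff).
  have [u0 u1] := andP (s01 t); move: (softclamp e t) u0 u1 => u u0 u1.
  have -> : H ((u + 0) / 2) (ramp (((0 - u) / e + 1) / 2)) = H ((u + 0) / 2) 0.
    have [ue|ue] := lerP (e / 2) u; first by rewrite below //; lra.
    by rewrite !H00 //; lra.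
  rewrite H0 /concatR /glue ifT; last by lra.
  by congr (f _); lra.
- move=> t; rewrite /Q S1 -(softclamp_flat t e4 fk).
  have [u0 u1] := andP (s01 t); move: (softclamp e t) u0 u1 => u u0 u1.
  have -> : H ((u + 1) / 2) (ramp (((1 - u) / e + 1) / 2)) = H ((u + 1) / 2) 1.
    have [ue|ue] := lerP (e / 2) (1 - u); first by rewrite above //; lra.
    by rewrite !H11 //; lra.
  rewrite H1 /concatR /glue; case: lerP => [h0|_]; last by congr (k _); lra.
  have -> : u = 0 by lra.
  by rewrite -hk1; congr (h _); lra.
- move=> t; rewrite /Q S0 -(softclamp_flat t e4 fh).
  have [u0 u1] := andP (s01 t); move: (softclamp e t) u0 u1 => u u0 u1.
  have -> : H ((0 + u) / 2) (ramp (((u - 0) / e + 1) / 2)) = H ((0 + u) / 2) 1.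
    have [ue|ue] := lerP (e / 2) u; first by rewrite above //; lra.
    by rewrite !H00 //; lra.
  rewrite H1 /concatR /glue ifT; last by lra.
  by congr (h _); lra.
- move=> t; rewrite /Q S1 -(softclamp_flat t e4 fg).
  have [u0 u1] := andP (s01 t); move: (softclamp e t) u0 u1 => u u0 u1.
  have -> : H ((1 + u) / 2) (ramp (((u - 1) / e + 1) / 2)) = H ((1 + u) / 2) 0.
    have [ue|ue] := lerP (e / 2) (1 - u); first by rewrite below //; lra.
    by rewrite !H11 //; lra.
  rewrite H0 /concatR /glue; case: lerP => [h0|_]; last by congr (g _); lra.
  have -> : u = 0 by lra.
  by rewrite -fg1; congr (f _); lra.
Qed.

End Collar.

(** * From maps on the cube to maps on the whole space *)

Section Transfer.
Variables (R : realType) (n : nat) (M : smoothManifold R n).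
Local Notation I := {i01 R}.
Local Notation zero := (0%:i01 : I).
Local Notation one := (1%:i01 : I).
Implicit Types (f : I -> M) (G H : I -> I -> M) (J : I -> I -> I -> M).
Implicit Types (e : R).

Lemma clamp_le0 (t : R) : t <= 0 -> clamp t = zero.
Proof.
move=> t0; apply/val_inj => /=.
by rewrite (min_idPl _) ?(max_idPl _) //; lra.
Qed.

Lemma clamp_ge1 (t : R) : 1 <= t -> clamp t = one.
Proof.
move=> t0; apply/val_inj => /=.
by rewrite (min_idPr _) ?(max_idPr _) //; lra.
Qed.

Lemma clampK (t : R) : 0 <= t <= 1 -> (clamp t)%:num = t.
Proof.
move=> /andP[t0 t1] /=; by rewrite (min_idPl t1) (max_idPr t0).
Qed.

Lemma clamp0 : clamp (0 : R) = zero. Proof. exact: clamp_le0. Qed.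
Lemma clamp1 : clamp (1 : R) = one. Proof. exact: clamp_ge1. Qed.

Lemma clamp_num_le (t e : R) : 0 <= e -> t <= e -> (clamp t)%:num <= e.
Proof.
move=> e0 te; have [t0|t0] := lerP t 0; first by rewrite clamp_le0.
have [t1|t1] := lerP 1 t; first by rewrite clamp_ge1 //=; lra.
by rewrite clampK //; lra.
Qed.

Lemma clamp_num_ge (t e : R) : e <= 1 -> e <= t -> e <= (clamp t)%:num.
Proof.
move=> e0 te; have [t0|t0] := lerP t 0; first by rewrite clamp_le0 //=; lra.
have [t1|t1] := lerP 1 t; first by rewrite clamp_ge1.
by rewrite clampK //; lra.
Qed.

Lemma stationary_flat T e (f : I -> T) : 0 < e ->
  stationary_ends e f <-> flat e (fun t => f (clamp t)).
Proof.
move=> e0; split=> h t; split=> te.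
- by rewrite clamp0; apply: (h _).1; apply: clamp_num_le => //; exact: ltW.
- by rewrite clamp1; apply: (h _).2; apply: clamp_num_ge => //; lra.
- by have := (h t%:num).1 te; rewrite clampE clamp0.
- by have := (h t%:num).2 te; rewrite clampE clamp1.
Qed.

(** A function with flat ends is determined by its values on [0,1]. *)
Lemma flat_clamp T e (f : R -> T) t : 0 < e -> flat e f -> f (clamp t)%:num = f t.
Proof.
move=> e0 ff; have [t0|t0] := lerP t 0.
  by rewrite clamp_le0 // [in RHS](flat0 ff) //; lra.
have [t1|t1] := lerP 1 t; first by rewrite clamp_ge1 // [in RHS](flat1 ff) //; lra.
by rewrite clampK //; lra.
Qed.

(** Extensions by constancy along [clamp]; they are smooth for paths with a
margin, although [clamp] is not. *)
Definition ext1 f : R -> M := fun t => f (clamp t).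
Definition ext2 G : R -> R -> M := fun t s => G (clamp t) (clamp s).
Definition ext3 J : R -> R -> R -> M := fun t s x => J (clamp t) (clamp s) (clamp x).

Definition res1 (a : R -> M) : I -> M := fun t => a t%:num.
Definition res2 (A : R -> R -> M) : I -> I -> M := fun t s => A t%:num s%:num.
Definition res3 (J : R -> R -> R -> M) : I -> I -> I -> M :=
  fun t s x => J t%:num s%:num x%:num.

Lemma ext1K f : res1 (ext1 f) = f.
Proof. by apply/funext => t; rewrite /res1 /ext1 clampE. Qed.

Lemma res2K e r (A : R -> R -> M) : 0 < e -> square e r A -> ext2 (res2 A) = A.
Proof.
move=> e0 AS; apply/funext => t; apply/funext => s; rewrite /ext2 /res2.
by rewrite (flat_clamp _ e0 (square_flat_s AS _)) (flat_clamp t e0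
  (square_flat_t AS s)).
Qed.

Lemma res3K e (A B : R -> R -> M) (J : R -> R -> R -> M) : 0 < e -> cube e J A B ->
  ext3 (res3 J) = J.
Proof.
move=> e0 JS; apply/funext => t; apply/funext => s; apply/funext => x.
rewrite /ext3 /res3 (flat_clamp _ e0 (cube_flat_x JS _ _)) (flat_clamp s e0
  (cube_flat_s JS _ _)).
exact: (flat_clamp t e0 (cube_flat_t JS _ _)).
Qed.

Lemma small_margin (e : R) : 0 < e -> exists2 e', 0 < e' <= 4^-1 & e' <= e.
Proof.
move=> e0; exists (Num.min e 4^-1); rewrite ?lt_min ?ge_min lexx ?e0 ?orbT //.
by rewrite andbT; lra.
Qed.

Lemma path1P f : path1 f <-> exists2 e, 0 < e <= 4^-1 & smooth_path (ext1 f) /\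
  flat e (ext1 f).
Proof.
split=> [[fS [e e0 /(stationary_flat _ e0) ff]]|[e e4 [fS ff]]].
  have [e' e'4 ee] := small_margin e0; have {}ff := flatW ee ff.
  exists e' => //; split => //; apply: (rank_le_smooth_rank (e := e')) => //.
    by move=> y; rewrite /fun1 mxE; exact/esym/(softclamp_flat (y 0 0) e'4 ff).
  exact: smooth_on_cube_rank_le fS.
split; first exact: rank_le_smooth (smooth_rank_rank_le fS).
by exists e; [lra|apply/stationary_flat => //; lra].
Qed.

(** The margin makes the extended map insensitive to [softclamp], hence smooth
of the same rank on the whole plane. *)
Lemma path2_square r G : path2 G -> rank_le r (fun2 G) ->
  exists2 e, 0 < e <= 4^-1 & square e r (ext2 G).
Proof.
move=> [_ [e e0 [Gt Gs]]] GS; have [e' e'4 ee] := small_margin e0.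
have Gt' s : flat e' (fun t => ext2 G t s).
  by apply: (flatW ee); exact: (stationary_flat _ e0).1 (Gt (clamp s)).
have Gs' t : flat e' (ext2 G t).
  by apply: (flatW ee); exact: (stationary_flat _ e0).1 (Gs (clamp t)).
exists e' => //; split => //; apply: (rank_le_smooth_rank (e := e')) => //.
move=> y; rewrite /fun2 !mxE.
have E1 := softclamp_flat (y 0 1) e'4 (Gs' (softclamp e' (y 0 0))).
exact/esym/(etrans E1)/(softclamp_flat (y 0 0) e'4 (Gt' (y 0 1))).
Qed.

Lemma path2_square2 G : path2 G -> exists2 e, 0 < e <= 4^-1 & square e 2 (ext2 G).
Proof. by move=> GP; apply: path2_square => //; exact: smooth_on_cube_rank_le GP.1. Qed.

Lemma square_rank_le e r G : square e r (ext2 G) -> rank_le r (fun2 G).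
Proof. by move=> [/smooth_rank_rank_le]. Qed.

Lemma square_path2 e r G : 0 < e -> square e r (ext2 G) -> path2 G.
Proof.
move=> e0 GS; split; first exact: rank_le_smooth (square_rank_le GS).
case: GS => _ Gt Gs; exists e => //; split=> s; apply/stationary_flat => //.
  by have := Gt s%:num; rewrite /ext2 clampE.
by have := Gs s%:num; rewrite /ext2 clampE.
Qed.

Lemma square_restrict e r (A : R -> R -> M) : 0 < e -> square e r A ->
  path2 (res2 A) /\ rank_le r (fun2 (res2 A)).
Proof.
move=> e0 AS; have AS' : square e r (ext2 (res2 A)) by rewrite (res2K e0 AS).
by split; [exact: square_path2 AS'|exact: square_rank_le AS'].
Qed.

Definition path_homotopy (e : R) (H : R -> R -> M) (f g : R -> M) : Prop :=
  [/\ square e 1 H, forall x, H 0 x = f 0, forall x, H 1 x = f 1, forall t,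
    H t 0 = f t &
      forall t, H t 1 = g t].

Lemma rank1_homotopyP H f f' : rank1_homotopy H f f' <->
  exists2 e, 0 < e <= 4^-1 & path_homotopy e (ext2 H) (ext1 f) (ext1 f').
Proof.
split=> [[HP Hl Hr Hd Hu HS]|[e e4 [HS Hl Hr Hd Hu]]].
  have [e e4 HS'] := path2_square HP HS; exists e => //; split=> //.
  - move=> x; rewrite /ext2 /ext1 clamp0 -Hd; exact: (Hl (clamp x)).
  - move=> x; rewrite /ext2 /ext1 clamp1 -Hd; exact: (Hr (clamp x)).
  - by move=> t; rewrite /ext2 /ext1 clamp0 -Hd.
  - by move=> t; rewrite /ext2 /ext1 clamp1 -Hu.
have Hd' : bdd H = f.
  by apply/funext => t; have := Hd t%:num; rewrite /ext2 /ext1 clampE clamp0.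
split => //.
- by apply: square_path2 HS; lra.
- move=> t; have := Hl t%:num; have := Hl 0.
  by rewrite /ext2 /ext1 /bdl clampE clamp0 => -> ->.
- move=> t; have := Hr t%:num; have := Hr 0.
  by rewrite /ext2 /ext1 /bdr clampE clamp1 clamp0 => -> ->.
- by apply/funext => t; have := Hu t%:num; rewrite /ext2 /ext1 clampE clamp1.
- exact: square_rank_le HS.
Qed.

(** That the faces of J are rank-1 homotopies comes down to their rank and to
the corners being fixed; smoothness and margins are inherited from J. *)
Lemma rank2_homotopicP G G' : rank2_homotopic G G' <-> homotopic (ext2 G) (ext2 G').
Proof.
split.
  move=> [J [JS J0 J1 Jl Jr Jd Ju [e e0 [Jt Js Jx]] JR]].
  have [e' e4 ee] := small_margin e0.
  have ft s x : flat e' (fun t => ext3 J t s x).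
    by apply: (flatW ee); exact: (stationary_flat _ e0).1 (Jt _ _).
  have fs t x : flat e' (fun s => ext3 J t s x).
    by apply: (flatW ee); exact: (stationary_flat _ e0).1 (Js _ _).
  have fx t s : flat e' (ext3 J t s).
    by apply: (flatW ee); exact: (stationary_flat _ e0).1 (Jx _ _).
  have fc H f f' : rank1_homotopy H f f' -> smooth_square 1 (ext2 H).
    by move=> /rank1_homotopyP [? _ []] [].
  exists (ext3 J), e' => //; split => //.
  - apply: (rank_le_smooth_rank (e := e')) => // y.
    rewrite /fun3 !mxE.
    have E1 := softclamp_flat (y 0 2) e4 (fx (softclamp e' (y 0 0)) (softclamp e'
      (y 0 1))).
    have E2 := softclamp_flat (y 0 1) e4 (fs (softclamp e' (y 0 0)) (y 0 2)).
    exact/esym/(etrans E1)/(etrans E2)/(softclamp_flat (y 0 0) e4 (ft _ _)).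
  - by move=> t s; rewrite /ext3 /ext2 clamp0.
  - by move=> t s; rewrite /ext3 /ext2 clamp1.
  - move=> x; rewrite /ext3 /ext2 clamp0 clamp1 -!J0.
    by split; [exact: (rank1_homotopy_bdl Jl)|exact: (rank1_homotopy_bdr Jl)
      |exact: (rank1_homotopy_bdl Jr)|exact: (rank1_homotopy_bdr Jr)].
  - split.
    + by have := fc _ _ _ Jl; rewrite -clamp0.
    + by have := fc _ _ _ Jr; rewrite -clamp1.
    + by have := fc _ _ _ Jd; rewrite -clamp0.
    + by have := fc _ _ _ Ju; rewrite -clamp1.
move=> [J [e e4 HJ]]; have e0 : 0 < e by lra.
have JK := res3K e0 HJ.
have [JS Jt Js Jx J0 J1 Jc [Jl Jr Jd Ju]] := HJ.
have num0 : zero%:num = 0 :> R by [].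
have num1 : one%:num = 1 :> R by [].
have e0E t s : J t%:num s%:num 0 = G t s by rewrite J0 /ext2 !clampE.
have e1E t s : J t%:num s%:num 1 = G' t s by rewrite J1 /ext2 !clampE.
(* Each of the four faces of J restricts to a rank-1 homotopy by this. *)
have face (S : R -> R -> M) f f' : smooth_square 1 S -> (forall s,
  flat e (fun t => S t s)) ->
   (forall t, flat e (S t)) -> (forall x, S 0 x = S 0 0) -> (forall x, S 1 x = S 1 0) ->
   (forall t : I, S t%:num 0 = f t) -> (forall t : I, S t%:num 1 = f' t) ->
   rank1_homotopy (res2 S) f f'.
  move=> SS St Ss Sl Sr Sd Su.
  have SQ : square e 1 S by split.
  apply/rank1_homotopyP; exists e => //; rewrite (res2K e0 SQ); split=> //.
  - by move=> x; rewrite Sl /ext1 -Sd clamp0.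
  - by move=> x; rewrite Sr /ext1 -Sd clamp1.
  - by move=> t; rewrite /ext1 -Sd (flat_clamp t e0 (St 0)).
  - by move=> t; rewrite /ext1 -Su (flat_clamp t e0 (St 1)).
have cor x : [/\ J 0 0 x = J 0 0 0, J 0 1 x = J 0 1 0, J 1 0 x = J 1 0 0 &
    J 1 1 x = J 1 1 0] by rewrite !J0.
have J3 : rank_le 2 (fun3 (res3 J)).
  have -> : fun3 (res3 J) = (fun v : 'rV[R]_3 => J (v 0 0) (v 0 1) (v 0 2)).
    by rewrite -[in RHS]JK.
  exact: smooth_rank_rank_le.
exists (res3 J); split.
- exact: rank_le_smooth J3.
- by move=> t s; rewrite /res3 num0 e0E.
- by move=> t s; rewrite /res3 num1 e1E.
- apply: (face (J 0)) => //; try by move=> x; have [] := cor x.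
  + by move=> t; rewrite -[0]num0 e0E.
  + by move=> t; rewrite -[X in J X]num0 e1E.
- apply: (face (J 1)) => //; try by move=> x; have [] := cor x.
  + by move=> t; rewrite -[X in J X]num1 e0E.
  + by move=> t; rewrite -[X in J X]num1 e1E.
- apply: (face (fun t x => J t 0 x)) => //; try by move=> x; have [] := cor x.
  + by move=> t; rewrite -[X in J _ X]num0 e0E.
  + by move=> t; rewrite -[X in J _ X]num0 e1E.
- apply: (face (fun t x => J t 1 x)) => //; try by move=> x; have [] := cor x.
  + by move=> t; rewrite -[X in J _ X]num1 e0E.
  + by move=> t; rewrite -[X in J _ X]num1 e1E.
- exists e => //; split=> a b; apply/stationary_flat => //.
  + by have := Jt a%:num b%:num; rewrite -{1}JK /ext3 !clampE.
  + by have := Js a%:num b%:num; rewrite -{1}JK /ext3 !clampE.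
  + by have := Jx a%:num b%:num; rewrite -{1}JK /ext3 !clampE.
- exact: J3.
Qed.

Lemma concat_clamp T (f g : I -> T) (t : R) :
  concat f g (clamp t) = concatR (fun u => f (clamp u)) (fun u => g (clamp u)) t.
Proof.
rewrite /concat /concatR /glue; have [t0|t0] := lerP t 0.
  rewrite clamp_le0 // ifT //= ifT; last by lra.
  by rewrite mulr0 !clamp_le0 //; lra.
have [t1|t1] := lerP 1 t.
  rewrite clamp_ge1 //= !ifF; first by rewrite !clamp_ge1 //; lra.
    by apply/negbTE; rewrite -ltNge; lra.
  by apply/negbTE; rewrite -ltNge; lra.
by rewrite clampK //; lra.
Qed.

Lemma ext1_concat f g : ext1 (concat f g) = concatR (ext1 f) (ext1 g).
Proof. by apply/funext => t; exact: concat_clamp. Qed.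

Lemma ext2_hconcat G H : ext2 (hconcat G H) = concatR (ext2 G) (ext2 H).
Proof.
apply/funext => t; apply/funext => s; rewrite /ext2 /hconcat concat_clamp.
by rewrite /concatR /glue; case: ifP.
Qed.

End Transfer.

(** * Reversal and degenerate squares *)

Section Reverse.
Variables (R : realType) (n : nat) (M : smoothManifold R n).
Implicit Types (A B H : R -> R -> M) (J : R -> R -> R -> M) (e : R).

Lemma square_rev e r A : square e r A -> square e r (fun t => A (1 - t)).
Proof.
move=> [AS At As]; split=> //.
  by apply: (smooth_rank2 (h1 := fun v : 'rV[R]_2 => 1 - v 0 0) AS); solve_smooth.
by move=> s; exact: flat_rev (At s).
Qed.

Lemma homotopic_rev A B : homotopic A B -> homotopic (fun t => A (1 - t)) (fun t => B
  (1 - t)).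
Proof.
move=> [J [e e4 [JS Jt Js Jx J0 J1 Jc [Jl Jr Jd Ju]]]].
apply: (cube_homotopic e4 (J := fun t s x => J (1 - t) s x)); split => //.
- by apply: (smooth_rank3 (h1 := fun v : 'rV[R]_3 => 1 - v 0 0) JS); solve_smooth.
- by move=> s x; exact: flat_rev (Jt s x).
- by move=> x; rewrite subr0 subrr; have [] := Jc x.
- rewrite subr0 subrr; split => //.
  + by apply: (smooth_rank2 (h1 := fun v : 'rV[R]_2 => 1 - v 0 0) Jd); solve_smooth.
  + by apply: (smooth_rank2 (h1 := fun v : 'rV[R]_2 => 1 - v 0 0) Ju); solve_smooth.
Qed.

Lemma homotopic_degenerate e H (f g : R -> M) : 0 < e <= 4^-1 ->
  path_homotopy e H f g ->
  homotopic (fun=> f) (fun=> g).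
Proof.
move=> e4 [[HS Ht Hs] Hl Hr Hd Hu].
apply: (cube_homotopic e4 (J := fun _ => H)); split => //.
- by apply: smooth_cubeW (_ : 1 <= 2)%N _ => //; apply: (smooth_rank2 HS); solve_smooth.
- split => //.
  + by apply: (smooth_path_comp (f := H 0) (h := fun v : 'rV[R]_2 => v 0 1)) => //;
      [exact: smooth_square_row HS|solve_smooth].
  + by apply: (smooth_path_comp (f := H 1) (h := fun v : 'rV[R]_2 => v 0 1)) => //;
      [exact: smooth_square_row HS|solve_smooth].
Qed.

Lemma collar_right e A H : 0 < e <= 4^-1 -> square e 2 A -> square e 1 H -> H 1 = A 1 ->
  (forall t, H t 0 = A 1 0) -> (forall t, H t 1 = A 1 1) ->
  exists A', [/\ homotopic A A',
    exists2 e', 0 < e' <= 4^-1 & forall r, (0 < r)%N -> square e r A -> square e' r A',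
    A' 1 = H 0, A' 0 = A 0 & forall t, A' t 0 = A t 0 /\ A' t 1 = A t 1].
Proof.
move=> e4 AS HS HA Hd Hu.
have A1 : (fun t => A (1 - t)) 0 = A 1 by rewrite subr0.
have [|||B [AB [e' e'4 Be] B0 B1 Bt]] := @collar_left _ _ _ e (fun t => A
  (1 - t)) H e4 (square_rev AS) HS.
- by rewrite A1.
- by move=> t; rewrite A1.
- by move=> t; rewrite A1.
have rr (T : Type) (f : R -> T) : (fun t => f (1 - (1 - t))) = f.
  by apply/funext => t; congr f; ring.
exists (fun t => B (1 - t)); split.
- by have := homotopic_rev AB; rewrite rr.
- exists e' => // r r0 Ar; apply: square_rev; apply: Be => //; exact: square_rev.
- by rewrite subrr.
- by rewrite subr0 B1 subrr.
- by move=> t; have := Bt (1 - t); rewrite (_ : 1 - (1 - t) = t) //; ring.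
Qed.

End Reverse.

(** * The laws for 1-paths and 2-paths *)

Section Interface.
Variables (R : realType) (n : nat) (M : smoothManifold R n).
Local Notation I := {i01 R}.
Local Notation zero := (0%:i01 : I).
Local Notation one := (1%:i01 : I).
Implicit Types (f g : I -> M) (G H : I -> I -> M) (J : I -> I -> I -> M).
Implicit Types (e : R).

Lemma square_common r r' (A B : R -> R -> M) e1 e2 : 0 < e1 <= 4^-1 -> 0 < e2 <= 4^-1 ->
  square e1 r A -> square e2 r' B -> exists e, [/\ 0 < e <= 4^-1,
    square e r A & square e r' B].
Proof.
move=> e14 e24 AS BS.
apply: (common_margin (P := fun e => square e r A) (Q :=
  fun e => square e r' B) e14 e24) => //.
- by move=> ? ? ?; exact: squareW.
- by move=> ? ? ?; exact: squareW.
Qed.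

Lemma ext2_left G : ext2 G 0 = ext1 (bdl G).
Proof. by rewrite /ext2 clamp0. Qed.

Lemma ext2_right G : ext2 G 1 = ext1 (bdr G).
Proof. by rewrite /ext2 clamp1. Qed.

Lemma ext2_bottom G t : ext2 G t 0 = ext1 (bdd G) t.
Proof. by rewrite /ext2 clamp0. Qed.

Lemma ext2_top G t : ext2 G t 1 = ext1 (bdu G) t.
Proof. by rewrite /ext2 clamp1. Qed.

Lemma ext1_inj f g : ext1 f = ext1 g -> f = g.
Proof. by move=> /(congr1 (@res1 _ _ _)); rewrite !ext1K. Qed.

Lemma rank2_homotopic_equiv : equivalence_on (@path2 R n M) (@rank2_homotopic R n M).
Proof.
split=> [G GP|G G' _ _|G1 G2 G3 _ _ _].
- by apply/rank2_homotopicP; have [e e4 GS] := path2_square2 GP;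
  exact: homotopic_refl e4 GS.
- by move=> /rank2_homotopicP GG; apply/rank2_homotopicP; exact: homotopic_sym.
- move=> /rank2_homotopicP GG /rank2_homotopicP GG'; apply/rank2_homotopicP.
  exact: homotopic_trans GG GG'.
Qed.

Lemma path1_square f : path1 f -> exists2 e, 0 < e <= 4^-1 & square e 1 (ext2
  (fun _ : I => f)).
Proof.
move=> /path1P [e e4 [fS ff]]; exists e => //; split => //.
by apply: (smooth_rank1 (h := fun v : 'rV[R]_2 => v 0 1) fS); solve_smooth.
Qed.

Lemma degenerate_path2 f : path1 f ->
  path2 (fun _ : I => f) /\ rank_le 1 (fun2 (fun _ : I => f)).
Proof.
move=> /path1_square [e e4 fS]; split; last exact: square_rank_le fS.
by apply: square_path2 fS; lra.
Qed.

Lemma path2_faces G : path2 G -> [/\ path1 (bdl G), path1 (bdr G),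
  path1 (bdd G) & path1 (bdu G)].
Proof.
move=> /path2_square2 [e e4 [GS Gt Gs]]; split; apply/path1P; exists e => //; split.
- by rewrite -ext2_left; exact: smooth_square_row GS.
- by rewrite -ext2_left.
- by rewrite -ext2_right; exact: smooth_square_row GS.
- by rewrite -ext2_right.
- by rewrite -(funext (ext2_bottom G)); exact: smooth_square_col GS.
- by rewrite -(funext (ext2_bottom G)).
- by rewrite -(funext (ext2_top G)); exact: smooth_square_col GS.
- by rewrite -(funext (ext2_top G)).
Qed.

Lemma rank2_homotopic_faces G G' : rank2_homotopic G G' ->
  [/\ rank1_homotopic (bdl G) (bdl G'), rank1_homotopic (bdr G) (bdr G'),
      rank1_homotopic (bdd G) (bdd G') & rank1_homotopic (bdu G) (bdu G')].
Proof.
by move=> [J [_ _ _ Jl Jr Jd Ju _ _]]; split; [exists (fun s x => J zero s x)|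
  exists (fun s x => J one s x)|exists (fun t x => J t zero x)|exists
    (fun t x => J t one x)].
Qed.

(** Reduces statements on 1-paths to statements on squares constant in t. *)
Lemma rank1_homotopic_degenerate f g : rank1_homotopic f g <->
  rank2_homotopic (fun _ : I => f) (fun _ : I => g).
Proof.
split=> [[H /rank1_homotopyP [e e4 fH]]|/rank2_homotopic_faces[]//].
by apply/rank2_homotopicP; exact: (homotopic_degenerate e4 fH).
Qed.

Lemma rank1_homotopic_equiv : equivalence_on (@path1 R n M) (@rank1_homotopic R n M).
Proof.
have [r s t] := rank2_homotopic_equiv; have D f := @degenerate_path2 f.
split=> [f /D[fP _]|f g /D[fP _] /D[gP _]|f g h /D[fP _] /D[gP _] /D[hP _]];
  rewrite !rank1_homotopic_degenerate; [exact: r|exact: s|exact: t].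
Qed.

Lemma path2_transpose G : path2 G -> path2 (transpose G).
Proof.
move=> /path2_square2 [e e4 GS]; have e0 : 0 < e by lra.
exact: (square_path2 (G := transpose G) e0 (square_swap GS)).
Qed.

Lemma rank2_homotopic_transpose G G' : rank2_homotopic G G' ->
  rank2_homotopic (transpose G) (transpose G').
Proof. by move=> /rank2_homotopicP GG; apply/rank2_homotopicP;
  exact: (homotopic_swap GG). Qed.

Lemma thin_transpose G : path2 G -> rank_le 1 (fun2 G) ->
  rank_le 1 (fun2 (transpose G)).
Proof.
move=> GP GR; have [e e4 GS] := path2_square GP GR.
exact: (square_rank_le (G := transpose G) (square_swap GS)).
Qed.

Lemma bdl_hconcat G H : bdl (hconcat G H) = bdl G.
Proof.
apply/ext1_inj; rewrite -!ext2_left ext2_hconcat /concatR /glue ifT; last by lra.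
by rewrite mulr0.
Qed.

Lemma bdr_hconcat G H : bdr (hconcat G H) = bdr H.
Proof.
apply/ext1_inj; rewrite -!ext2_right ext2_hconcat /concatR /glue ifF.
  by congr (ext2 H _); lra.
by apply/negbTE; rewrite -ltNge; lra.
Qed.

Lemma rank_le_hconcat r G H : path2 G -> path2 H -> bdr G = bdl H ->
  rank_le r (fun2 G) -> rank_le r (fun2 H) ->
  path2 (hconcat G H) /\ rank_le r (fun2 (hconcat G H)).
Proof.
move=> GP HP GH GR HR; have [e1 e14 GS1] := path2_square GP GR; have [e2 e24 HS1] :=
  path2_square HP HR.
have [e [e4 GS HS]] := square_common e14 e24 GS1 HS1.
have S : square (e / 2) r (ext2 (hconcat G H)).
  rewrite ext2_hconcat; apply: (square_glue (cut_concat e4) GS HS) => s.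
  by rewrite ext2_left ext2_right GH.
by split; [apply: square_path2 S; lra|exact: square_rank_le S].
Qed.

Lemma path2_hconcat G H : path2 G -> path2 H -> bdr G = bdl H -> path2 (hconcat G H).
Proof.
move=> GP HP GH.
exact: (rank_le_hconcat GP HP GH (smooth_on_cube_rank_le GP.1)
  (smooth_on_cube_rank_le HP.1)).1.
Qed.

Lemma hconcat_wd G G' H H' : rank2_homotopic G G' -> rank2_homotopic H H' ->
  bdr G = bdl H -> bdr G' = bdl H' -> rank2_homotopic (hconcat G H) (hconcat G' H').
Proof.
move=> /rank2_homotopicP GG /rank2_homotopicP HH GH GH'; apply/rank2_homotopicP.
by rewrite !ext2_hconcat; apply: concatR_wd; rewrite // ext2_left ext2_right ?GH ?GH'.
Qed.

Lemma hconcat_assoc G1 G2 G3 : path2 G1 -> path2 G2 -> path2 G3 ->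
  bdr G1 = bdl G2 -> bdr G2 = bdl G3 ->
  rank2_homotopic (hconcat G1 (hconcat G2 G3)) (hconcat (hconcat G1 G2) G3).
Proof.
move=> /path2_square2 [e1 e14 S1] /path2_square2 [e2 e24 S2] /path2_square2 [e3 e34 S3]
  G12 G23.
have [e [e4 S1' S2']] := square_common e14 e24 S1 S2.
have [e' [e'4 S2'' S3']] := square_common e4 e34 S2' S3.
have [e'' [e''4 S1'' S3'']] := square_common e4 e'4 S1' S3'.
have [d [d4 S12 S23]] : exists d, [/\ 0 < d <= 4^-1,
    square d 2 (ext2 G1) /\ square d 2 (ext2 G3) & square d 2 (ext2 G2)].
  apply: (common_margin (P := fun d => square d 2 (ext2 G1) /\ square d 2 (ext2 G3))
    (Q := fun d => square d 2 (ext2 G2)) e''4 e24) => //.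
  - by move=> a b ab [? ?]; split; apply: squareW ab _.
  - by move=> a b ab ?; apply: squareW ab _.
have [S13 S31] := S12.
apply/rank2_homotopicP; rewrite !ext2_hconcat; apply: (concatR_assoc d4) => //.
  by rewrite ext2_left ext2_right G12.
by rewrite ext2_left ext2_right G23.
Qed.

Lemma hconcat_idl G : path2 G -> rank2_homotopic (hconcat (fun _ : I => bdl G) G) G.
Proof.
move=> /path2_square2 [e e4 S]; apply/rank2_homotopicP; rewrite ext2_hconcat.
by have := concatR_idl e4 S; rewrite ext2_left.
Qed.

Lemma hconcat_idr G : path2 G -> rank2_homotopic (hconcat G (fun _ : I => bdr G)) G.
Proof.
move=> /path2_square2 [e e4 S]; apply/rank2_homotopicP; rewrite ext2_hconcat.
by have := concatR_idr e4 S; rewrite ext2_right.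
Qed.

Lemma hconcat_inv G : path2 G -> exists G', [/\ path2 G', bdl G' = bdr G,
  bdr G' = bdl G,
  rank2_homotopic (hconcat G G') (fun _ : I => bdl G) &
  rank2_homotopic (hconcat G' G) (fun _ : I => bdr G)].
Proof.
move=> /path2_square2 [e e4 S]; have e0 : 0 < e by lra.
have S' := square_rev S; pose G' := res2 (fun t => ext2 G (1 - t)).
have E : ext2 G' = fun t => ext2 G (1 - t) by exact: res2K e0 S'.
exists G'; split.
- by have [] := square_restrict e0 S'.
- by apply/ext1_inj; rewrite -ext2_left E subr0 ext2_right.
- by apply/ext1_inj; rewrite -ext2_right E subrr ext2_left.
- apply/rank2_homotopicP; rewrite ext2_hconcat E.
  by have := concatR_inv e4 S; rewrite ext2_left.
- apply/rank2_homotopicP; rewrite ext2_hconcat E.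
  have := concatR_inv e4 S'; rewrite subr0 ext2_right.
  rewrite (_ : (fun t => ext2 G (1 - (1 - t))) = ext2 G) //.
  by apply/funext => t; congr ext2; ring.
Qed.

(** Lets one collar construction treat thin and arbitrary squares together. *)
Lemma rank_le_or_thin (G : I -> I -> M) : path2 G -> exists r, [/\ (0 < r)%N,
  rank_le r (fun2 G) &
  rank_le 1 (fun2 G) -> r = 1%N].
Proof.
move=> GP; have [h|h] := pselect (rank_le 1 (fun2 G)); first by exists 1%N.
by exists 2; split => //; exact: smooth_on_cube_rank_le GP.1.
Qed.

(** A rank-1 homotopy read with its homotopy parameter first, as a square to be
attached to a vertical side. *)
Lemma collar_data f g e H : path_homotopy e (ext2 H) (ext1 f) (ext1 g) ->
  [/\ square e 1 (fun x s => ext2 H s x), (fun s => ext2 H s 1) = ext1 g,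
    (fun s => ext2 H s 0) = ext1 f,
    forall x, ext2 H 0 x = ext1 g 0 & forall x, ext2 H 1 x = ext1 g 1].
Proof.
move=> [HS Hl Hr Hd Hu]; split.
- exact: square_swap.
- exact/funext.
- exact/funext.
- by move=> x; rewrite Hl -Hu Hl.
- by move=> x; rewrite Hr -Hu Hr.
Qed.

Lemma collar_left_face G f : path2 G -> rank1_homotopic f (bdl G) ->
  exists G', [/\ path2 G', rank2_homotopic G G',
    rank_le 1 (fun2 G) -> rank_le 1 (fun2 G'), bdl G' = f &
    [/\ bdr G' = bdr G, bdd G' = bdd G & bdu G' = bdu G]].
Proof.
move=> GP [H /rank1_homotopyP [e1 e14 HH]]; have [r [r0 Gr rt]] := rank_le_or_thin GP.
have [e2 e24 GS2] := path2_square GP Gr.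
have [HS1 H1 H0 Hl Hr] := collar_data HH.
have [e [e4 HS GS]] := square_common e14 e24 HS1 GS2.
have [|||A' [AA [e' e'4 A'S] A0 A1 At]] :=
    collar_left (A := ext2 G) (H := fun x s => ext2 H s x) e4 (square_rank2 GS) HS.
- by rewrite H1 ext2_left.
- by move=> x; rewrite Hl ext2_left.
- by move=> x; rewrite Hr ext2_left.
have e'0 : 0 < e' by lra.
have S' := A'S _ r0 GS; have [P' R'] := square_restrict e'0 S'.
have E : ext2 (res2 A') = A' := res2K e'0 S'.
exists (res2 A'); split => //.
- by apply/rank2_homotopicP; rewrite E.
- by move=> /rt rE; rewrite rE in R'.
- by apply/ext1_inj; rewrite -ext2_left E A0.
- split; apply/ext1_inj.
  + by rewrite -!ext2_right E.
  + by rewrite -!(funext (ext2_bottom _)) E; apply/funext => t; have [] := At t.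
  + by rewrite -!(funext (ext2_top _)) E; apply/funext => t; have [] := At t.
Qed.

Lemma collar_right_face G f : path2 G -> rank1_homotopic f (bdr G) ->
  exists G', [/\ path2 G', rank2_homotopic G G',
    rank_le 1 (fun2 G) -> rank_le 1 (fun2 G'), bdr G' = f &
    [/\ bdl G' = bdl G, bdd G' = bdd G & bdu G' = bdu G]].
Proof.
move=> GP [H /rank1_homotopyP [e1 e14 HH]]; have [r [r0 Gr rt]] := rank_le_or_thin GP.
have [e2 e24 GS2] := path2_square GP Gr.
have [HS1 H1 H0 Hl Hr] := collar_data HH.
have [e [e4 HS GS]] := square_common e14 e24 HS1 GS2.
have [|||A' [AA [e' e'4 A'S] A0 A1 At]] :=
    collar_right (A := ext2 G) (H := fun x s => ext2 H s x) e4 (square_rank2 GS) HS.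
- by rewrite H1 ext2_right.
- by move=> x; rewrite Hl ext2_right.
- by move=> x; rewrite Hr ext2_right.
have e'0 : 0 < e' by lra.
have S' := A'S _ r0 GS; have [P' R'] := square_restrict e'0 S'.
have E : ext2 (res2 A') = A' := res2K e'0 S'.
exists (res2 A'); split => //.
- by apply/rank2_homotopicP; rewrite E.
- by move=> /rt rE; rewrite rE in R'.
- by apply/ext1_inj; rewrite -ext2_right E A0.
- split; apply/ext1_inj.
  + by rewrite -!ext2_left E.
  + by rewrite -!(funext (ext2_bottom _)) E; apply/funext => t; have [] := At t.
  + by rewrite -!(funext (ext2_top _)) E; apply/funext => t; have [] := At t.
Qed.

(** Absorbs an inserted rank-1 homotopy, so that composites can be computed
without one. *)
Lemma hconcat_shrink G H f : path2 G -> rank1_homotopy H (bdr G) f ->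
  [/\ path2 (hconcat G (transpose H)), rank2_homotopic G (hconcat G (transpose H)) &
    bdr (hconcat G (transpose H)) = f].
Proof.
move=> GP HH; have HP := rank1_homotopy_path2 HH.
have bH : bdr G = bdl (transpose H) by rewrite -(rank1_homotopy_bdd HH).
split.
- exact: path2_hconcat GP (path2_transpose HP) bH.
- apply/rank2_homotopicP/homotopic_sym; rewrite ext2_hconcat.
  have /rank1_homotopyP [e1 e14 HH'] := HH; have [e2 e24 GS2] := path2_square2 GP.
  have [HS1 H1 H0 _ _] := collar_data HH'; have [_ Hl Hr _ _] := HH'.
  have [e [e4 HS GS]] := square_common e14 e24 HS1 GS2.
  apply: (concatR_shrink e4 GS HS).
  + by rewrite ext2_right -H0.
  + by move=> t; rewrite ext2_right Hl.
  + by move=> t; rewrite Hr ext2_right.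
- by rewrite bdr_hconcat -(rank1_homotopy_bdu HH).
Qed.

Lemma thin_unique G G' : path2 G -> path2 G' -> rank_le 1 (fun2 G) ->
  rank_le 1 (fun2 G') ->
  bdl G = bdl G' -> bdd G = bdd G' -> bdu G = bdu G' -> rank2_homotopic G G'.
Proof.
move=> GP GP' GR GR' El Ed Eu.
have [e1 e14 S1] := path2_square GP GR; have [e2 e24 S2] := path2_square GP' GR'.
have [e [e4 S S']] := square_common e14 e24 S1 S2; have e2' : 0 < e / 2 <= 4^-1 by lra.
have [|||J [HJ _ _ _ _]] := three_sides e4 S S'.
- by rewrite !ext2_left El.
- by move=> s; rewrite !ext2_bottom Ed.
- by move=> s; rewrite !ext2_top Eu.
by apply/rank2_homotopicP; exact: cube_homotopic e2' HJ.
Qed.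

Lemma thin_exists f g h k : path1 f -> path1 g -> path1 h -> path1 k ->
  f one = g zero -> h one = k zero -> rank1_homotopic (concat f g) (concat h k) ->
  exists Q, path2 Q /\ [/\ rank_le 1 (fun2 Q), bdd Q = f, bdr Q = g,
    bdl Q = h & bdu Q = k].
Proof.
move=> /path1P [e1 e14 [_ f1]] /path1P [e2 e24 [_ f2]] /path1P [e3 e34 [_ f3]].
move=> /path1P [e4' e44 [_ f4]] fg hk [H /rank1_homotopyP [e5 e54]].
rewrite !ext1_concat => -[HS Hl Hr Hd Hu].
pose e := Num.min e1 (Num.min e2 (Num.min e3 (Num.min e4' e5))).
have [l1 l2 l3 l4 l5] : [/\ e <= e1, e <= e2, e <= e3, e <= e4' & e <= e5].
  by rewrite /e; split; rewrite !ge_min lexx ?orbT.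
have e4 : 0 < e <= 4^-1.
  by rewrite (le_trans l1) ?andbT ?lt_min; lra.
have [||||Q [QS Qd Qu Ql Qr]] := thin_filler_square e4 (flatW l1 f1) (flatW l2 f2)
    (flatW l3 f3) (flatW l4 f4) _ _ (squareW l5 HS) Hd Hu _ _.
- by rewrite /ext1 clamp0 clamp1.
- by rewrite /ext1 clamp0 clamp1.
- by move=> x; rewrite !Hl.
- by move=> x; rewrite !Hr.
have e20 : 0 < e / 2 by lra.
have [P' R'] := square_restrict e20 QS; have E : ext2 (res2 Q) = Q := res2K e20 QS.
exists (res2 Q); split => //; split => //; apply/ext1_inj.
- by rewrite -(funext (ext2_bottom _)) E; exact/funext.
- by rewrite -ext2_right E; exact/funext.
- by rewrite -ext2_left E; exact/funext.
- by rewrite -(funext (ext2_top _)) E; exact/funext.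
Qed.

End Interface.

(** * Quotients presented as sets of representatives *)

Section Quotient.
Variables (T : Type) (P : set T) (r : T -> T -> Prop).
Hypothesis equiv : equivalence_on P r.

(** The types of 1-tracks and of 2-tracks are instances of this one by
conversion. *)
Definition quot : Type := {X : set T | exists2 f, P f & X = [set g | P g /\ r f g]}.
Implicit Types X Y : quot.

Lemma quot_mem X f : sval X f -> P f.
Proof. by case: X => /= _ [g _ ->] []. Qed.

Lemma quot_rep X : exists f, sval X f.
Proof. by have [rr _ _] := equiv; case: X => /= _ [g Pg ->]; exists g; split => //;
  exact: rr. Qed.

Lemma quot_rel X f g : sval X f -> sval X g -> r f g.
Proof.
have [_ rs rt] := equiv; case: X => /= _ [h Ph ->] [Pf hf] [Pg hg].
by apply: (rt _ h) => //; exact: rs.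
Qed.

Lemma quot_closed X f g : sval X f -> P g -> r f g -> sval X g.
Proof.
have [_ rs rt] := equiv; case: X => /= _ [h Ph ->] [Pf hf] Pg fg; split => //.
exact: rt fg.
Qed.

Lemma quot_eq X Y f : sval X f -> sval Y f -> X = Y.
Proof.
move=> Xf Yf; have : sval X = sval Y.
  apply/seteqP; split=> g ?.
    by apply: (quot_closed Yf); [exact: (@quot_mem X)|exact: (@quot_rel X)].
  by apply: (quot_closed Xf); [exact: (@quot_mem Y)|exact: (@quot_rel Y)].
by case: X Y {Xf Yf} => x px [y py] /= ?; exact: eq_exist.
Qed.

Lemma quot_mk f : P f -> exists X, sval X f.
Proof.
have [rr _ _] := equiv; move=> Pf.
by exists (exist _ [set g | P g /\ r f g] (ex_intro2 _ _ f Pf erefl)); split => //;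
  exact: rr.
Qed.

End Quotient.

Lemma transport_groupoid (C1 C2 : Type) (src tgt : C2 -> C1) (idm : C1 -> C2)
    (cmp : C2 -> C2 -> C2) (T : C2 -> C2) : involutive T ->
  is_groupoid src tgt idm cmp ->
  is_groupoid (fun X => src (T X)) (fun X => tgt (T X)) (fun a => T (idm a))
    (fun X Y => T (cmp (T X) (T Y))).
Proof.
move=> TT [s1 t1 sc tc a l r i]; split.
- by move=> x; rewrite TT.
- by move=> x; rewrite TT.
- by move=> X Y XY; rewrite TT sc.
- by move=> X Y XY; rewrite TT tc.
- by move=> X Y Z XY YZ; rewrite !TT a.
- by move=> X; rewrite TT l.
- by move=> X; rewrite TT r.
- move=> X; have [Y [h1 h2 h3 h4]] := i (T X); exists (T Y).
  by rewrite !TT h1 h2 h3 h4.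
Qed.

(** * The double groupoid of tracks *)

Section Tracks.
Variables (R : realType) (n : nat) (M : smoothManifold R n).
Local Notation I := {i01 R}.
Local Notation zero := (0%:i01 : I).
Local Notation one := (1%:i01 : I).
Implicit Types (f g : I -> M) (G H : I -> I -> M) (a b : track1 M) (X Y Z W : track2 M).

Let E1 := @rank1_homotopic_equiv R n M.
Let E2 := @rank2_homotopic_equiv R n M.

Lemma represents1_path a f : represents1 f a -> path1 f.
Proof. exact: quot_mem. Qed.
Lemma represents1_ex a : exists f, represents1 f a.
Proof. exact: (quot_rep E1). Qed.
Lemma represents1_hom a f g : represents1 f a -> represents1 g a -> rank1_homotopic f g.
Proof. exact: (quot_rel E1). Qed.
Lemma represents1_closed a f g : represents1 f a -> path1 g -> rank1_homotopic f g ->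
  represents1 g a.
Proof. exact: (quot_closed E1). Qed.
Lemma represents1_eq a b f : represents1 f a -> represents1 f b -> a = b.
Proof. exact: (quot_eq E1). Qed.
Lemma represents1_mk f : path1 f -> exists a : track1 M, represents1 f a.
Proof. exact: (quot_mk E1). Qed.

Lemma represents2_path X G : represents2 G X -> path2 G.
Proof. exact: quot_mem. Qed.
Lemma represents2_ex X : exists G, represents2 G X.
Proof. exact: (quot_rep E2). Qed.
Lemma represents2_hom X G H : represents2 G X -> represents2 H X -> rank2_homotopic G H.
Proof. exact: (quot_rel E2). Qed.
Lemma represents2_closed X G H : represents2 G X -> path2 H -> rank2_homotopic G H ->
  represents2 H X.
Proof. exact: (quot_closed E2). Qed.
Lemma represents2_eq X Y G : represents2 G X -> represents2 G Y -> X = Y.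
Proof. exact: (quot_eq E2). Qed.
Lemma represents2_mk G : path2 G -> exists X : track2 M, represents2 G X.
Proof. exact: (quot_mk E2). Qed.

Lemma rank1_homotopic_ends f g : rank1_homotopic f g -> f zero = g zero /\
  f one = g one.
Proof.
move=> [H [_ Hl Hr Hd Hu _]]; rewrite -Hd -Hu.
by split; [exact/esym/(Hl one)|exact/esym/(Hr one)].
Qed.

Lemma track_src_ex a : exists p, forall f, represents1 f a -> p = f zero.
Proof.
have [f fa] := represents1_ex a; exists (f zero) => g ga.
by have [] := rank1_homotopic_ends (represents1_hom fa ga).
Qed.

Lemma track_tgt_ex a : exists p, forall f, represents1 f a -> p = f one.
Proof.
have [f fa] := represents1_ex a; exists (f one) => g ga.
by have [] := rank1_homotopic_ends (represents1_hom fa ga).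
Qed.

Lemma path1_cst (p : M) : path1 (fun _ : I => p).
Proof.
have [c ac cp] := atlas_cover p.
split; last by exists 1 => // t; split.
move=> x _; exists c, setT, (fun=> to_coord c p); split => //; first exact: openT.
by move=> k; rewrite Ck_onE; apply/(Ck_rowP _ _ openT) => i; exact: Ck_cst.
Qed.

Lemma track_deg_ex (p : M) : exists a : track1 M, represents1 (fun=> p) a.
Proof. exact/represents1_mk/path1_cst. Qed.

Lemma track_fl_ex X : exists a : track1 M, forall G, represents2 G X ->
  represents1 (bdl G) a.
Proof.
have [G GX] := represents2_ex X; have [Gl _ _ _] := path2_faces (represents2_path GX).
have [a aG] := represents1_mk Gl; exists a => H HX.
have [Hl _ _ _] := path2_faces (represents2_path HX).
apply: (represents1_closed aG) => //.
by have [] := rank2_homotopic_faces (represents2_hom GX HX).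
Qed.

Lemma track_fr_ex X : exists a : track1 M, forall G, represents2 G X ->
  represents1 (bdr G) a.
Proof.
have [G GX] := represents2_ex X; have [_ Gl _ _] := path2_faces (represents2_path GX).
have [a aG] := represents1_mk Gl; exists a => H HX.
have [_ Hl _ _] := path2_faces (represents2_path HX).
apply: (represents1_closed aG) => //.
by have [] := rank2_homotopic_faces (represents2_hom GX HX).
Qed.

Lemma track_degh_ex a : exists X : track2 M, forall f, represents1 f a ->
  represents2 (fun _ : I => f) X.
Proof.
have [f fa] := represents1_ex a.
have [X fX] := represents2_mk (degenerate_path2 (represents1_path fa)).1.
exists X => g ga; apply: (represents2_closed fX).
  exact: (degenerate_path2 (represents1_path ga)).1.
exact/rank1_homotopic_degenerate/(represents1_hom fa ga).
Qed.

Lemma track_transpose_ex X : exists Y : track2 M, forall G, represents2 G X ->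
  represents2 (transpose G) Y.
Proof.
have [G GX] := represents2_ex X.
have [Y GY] := represents2_mk (path2_transpose (represents2_path GX)).
exists Y => H HX; apply: (represents2_closed GY).
  exact/path2_transpose/(represents2_path HX).
exact/rank2_homotopic_transpose/(represents2_hom GX HX).
Qed.

Definition track_src a : M := sval (cid (track_src_ex a)).
Definition track_tgt a : M := sval (cid (track_tgt_ex a)).
Definition track_deg (p : M) : track1 M := sval (cid (track_deg_ex p)).
Definition track_fl X : track1 M := sval (cid (track_fl_ex X)).
Definition track_fr X : track1 M := sval (cid (track_fr_ex X)).
Definition track_degh a : track2 M := sval (cid (track_degh_ex a)).
Definition track_transpose X : track2 M := sval (cid (track_transpose_ex X)).

Lemma track_srcE a f : represents1 f a -> track_src a = f zero.
Proof. exact: (svalP (cid (track_src_ex a))). Qed.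
Lemma track_tgtE a f : represents1 f a -> track_tgt a = f one.
Proof. exact: (svalP (cid (track_tgt_ex a))). Qed.
Lemma track_degE p : represents1 (fun=> p) (track_deg p).
Proof. exact: (svalP (cid (track_deg_ex p))). Qed.
Lemma track_flE X G : represents2 G X -> represents1 (bdl G) (track_fl X).
Proof. exact: (svalP (cid (track_fl_ex X))). Qed.
Lemma track_frE X G : represents2 G X -> represents1 (bdr G) (track_fr X).
Proof. exact: (svalP (cid (track_fr_ex X))). Qed.
Lemma track_deghE a f : represents1 f a -> represents2 (fun _ : I => f) (track_degh a).
Proof. exact: (svalP (cid (track_degh_ex a))). Qed.
Lemma track_transposeE X G : represents2 G X ->
  represents2 (transpose G) (track_transpose X).
Proof. exact: (svalP (cid (track_transpose_ex X))). Qed.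

Lemma track_transposeK : involutive track_transpose.
Proof.
move=> X; have [G GX] := represents2_ex X.
exact: (represents2_eq (G := G) (track_transposeE (track_transposeE GX)) GX).
Qed.

(** Only the left side changes, so several sides can be matched one after
another. *)
Lemma match_left X G f : represents2 G X -> represents1 f (track_fl X) ->
  exists G', [/\ represents2 G' X, rank_le 1 (fun2 G) -> rank_le 1 (fun2 G'),
    bdl G' = f &
    [/\ bdr G' = bdr G, bdd G' = bdd G & bdu G' = bdu G]].
Proof.
move=> GX fX; have fG := represents1_hom fX (track_flE GX).
have [G' [G'P GG' G't Gl Gf]] := collar_left_face (represents2_path GX) fG.
by exists G'; split => //; exact: represents2_closed GX G'P GG'.
Qed.

Lemma match_right X G f : represents2 G X -> represents1 f (track_fr X) ->
  exists G', [/\ represents2 G' X, rank_le 1 (fun2 G) -> rank_le 1 (fun2 G'),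
    bdr G' = f &
    [/\ bdl G' = bdl G, bdd G' = bdd G & bdu G' = bdu G]].
Proof.
move=> GX fX; have fG := represents1_hom fX (track_frE GX).
have [G' [G'P GG' G't Gl Gf]] := collar_right_face (represents2_path GX) fG.
by exists G'; split => //; exact: represents2_closed GX G'P GG'.
Qed.

(** Stated as a total relation, with the junk value X when the faces differ, so
that choice yields a function. *)
Lemma track_hcomp_ex (XY : track2 M * track2 M) : exists Z : track2 M,
  track_fr XY.1 = track_fl XY.2 -> forall G H, represents2 G XY.1 ->
    represents2 H XY.2 ->
  bdr G = bdl H -> represents2 (hconcat G H) Z.
Proof.
case: XY => X Y /=; have [e|e] := pselect (track_fr X = track_fl Y); last by exists X.
have [G GX] := represents2_ex X; have [H HY] := represents2_ex Y.
have [|H' [H'Y _ GH' _]] := match_left (f := bdr G) HY; first by rewrite -e;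
  exact: track_frE.
have GP := represents2_path GX; have HP := represents2_path H'Y.
have [Z GZ] := represents2_mk (path2_hconcat GP HP (esym GH')).
exists Z => _ K L KX LY KL; apply: (represents2_closed GZ).
  exact: path2_hconcat (represents2_path KX) (represents2_path LY) KL.
by apply: hconcat_wd => //; [exact: represents2_hom GX KX|exact: represents2_hom H'Y
  LY].
Qed.

Definition track_hcomp X Y : track2 M := sval (cid (track_hcomp_ex (X, Y))).

Lemma track_hcompE X Y G H : represents2 G X -> represents2 H Y -> bdr G = bdl H ->
  represents2 (hconcat G H) (track_hcomp X Y).
Proof.
move=> GX HY GH; apply: (svalP (cid (track_hcomp_ex (X, Y)))) => //=.
by apply: (represents1_eq (track_frE GX)); rewrite GH; exact: track_flE.
Qed.

Lemma matching_square X Y : track_fr X = track_fl Y -> forall G, represents2 G X ->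
  exists2 H, represents2 H Y & bdr G = bdl H.
Proof.
move=> e G GX; have [H HY] := represents2_ex Y.
have [|H' [H'Y _ GH' _]] := match_left (f := bdr G) HY; first by rewrite -e;
  exact: track_frE.
by exists H'.
Qed.

Lemma track_hcomp_groupoid : is_groupoid track_fl track_fr track_degh track_hcomp.
Proof.
split.
- move=> a; have [f fa] := represents1_ex a.
  exact: (represents1_eq (track_flE (track_deghE fa)) fa).
- move=> a; have [f fa] := represents1_ex a.
  exact: (represents1_eq (track_frE (track_deghE fa)) fa).
- move=> X Y e; have [G GX] := represents2_ex X; have [H HY GH] := matching_square e GX.
  apply: (represents1_eq (f := bdl G)); last exact: track_flE.
  by rewrite -(bdl_hconcat G H); exact/track_flE/track_hcompE.
- move=> X Y e; have [G GX] := represents2_ex X; have [H HY GH] := matching_square e GX.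
  apply: (represents1_eq (f := bdr H)); last exact: track_frE.
  by rewrite -(bdr_hconcat G H); exact/track_frE/track_hcompE.
- move=> X Y Z XY YZ; have [G GX] := represents2_ex X.
  have [H HY GH] := matching_square XY GX; have [K KZ HK] := matching_square YZ HY.
  have GHK : represents2 (hconcat G (hconcat H K)) (track_hcomp X (track_hcomp Y Z)).
    by apply: track_hcompE; rewrite ?bdl_hconcat //; exact: track_hcompE.
  have GHK' : represents2 (hconcat (hconcat G H) K) (track_hcomp (track_hcomp X Y) Z).
    by apply: track_hcompE; rewrite ?bdr_hconcat //; exact: track_hcompE.
  apply: (represents2_eq _ GHK'); apply: (represents2_closed GHK).
    exact: represents2_path GHK'.
  by apply: hconcat_assoc => //; apply: represents2_path; eassumption.
- move=> X; have [G GX] := represents2_ex X.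
  have GX' := track_hcompE (track_deghE (track_flE GX)) GX erefl.
  apply: (represents2_eq _ GX); apply: (represents2_closed GX').
    exact: represents2_path GX.
  exact/hconcat_idl/(represents2_path GX).
- move=> X; have [G GX] := represents2_ex X.
  have GX' := track_hcompE GX (track_deghE (track_frE GX)) erefl.
  apply: (represents2_eq _ GX); apply: (represents2_closed GX').
    exact: represents2_path GX.
  exact/hconcat_idr/(represents2_path GX).
- move=> X; have [G GX] := represents2_ex X.
  have [H [HP Hl Hr GH HG]] := hconcat_inv (represents2_path GX).
  have [Y HY] := represents2_mk HP; exists Y; split.
  + by apply: (represents1_eq (f := bdr G)); [rewrite -Hl;
    exact: track_flE|exact: track_frE].
  + by apply: (represents1_eq (f := bdl G)); [rewrite -Hr;
    exact: track_frE|exact: track_flE].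
  + have D := track_deghE (track_flE GX).
    apply: (represents2_eq _ D); apply: (represents2_closed (track_hcompE GX HY
      (esym Hl))) => //.
    exact: represents2_path D.
  + have D := track_deghE (track_frE GX).
    apply: (represents2_eq _ D); apply: (represents2_closed
      (track_hcompE HY GX Hr)) => //.
    exact: represents2_path D.
Qed.

Definition track_fd X : track1 M := track_fl (track_transpose X).
Definition track_fu X : track1 M := track_fr (track_transpose X).
Definition track_degv a : track2 M := track_transpose (track_degh a).
Definition track_vcomp X Y : track2 M := track_transpose (track_hcomp
  (track_transpose X) (track_transpose Y)).
(** The composition of 1-tracks is read off the bottom of squares constant in
s, so that its groupoid laws follow from those of squares. *)
Definition track_comp a b : track1 M := track_fd (track_hcomp (track_degv a)
  (track_degv b)).

Lemma track_fdE X G : represents2 G X -> represents1 (bdd G) (track_fd X).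
Proof. by move=> /track_transposeE /track_flE. Qed.
Lemma track_fuE X G : represents2 G X -> represents1 (bdu G) (track_fu X).
Proof. by move=> /track_transposeE /track_frE. Qed.
Lemma track_degvE a f : represents1 f a -> represents2 (fun t _ : I => f t)
  (track_degv a).
Proof. by move=> /track_deghE /track_transposeE. Qed.
Lemma track_vcompE X Y G H : represents2 G X -> represents2 H Y -> bdu G = bdd H ->
  represents2 (vconcat G H) (track_vcomp X Y).
Proof. by move=> /track_transposeE GX /track_transposeE HY GH;
  apply: (track_transposeE (track_hcompE GX HY GH)). Qed.

Lemma track_vcomp_groupoid : is_groupoid track_fd track_fu track_degv track_vcomp.
Proof. exact: (transport_groupoid track_transposeK track_hcomp_groupoid). Qed.

Lemma track_compE a b f g : represents1 f a -> represents1 g b -> f one = g zero ->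
  represents1 (concat f g) (track_comp a b).
Proof.
move=> fa gb fg; have := track_fdE (track_hcompE (track_degvE fa) (track_degvE gb) _);
  apply.
by apply/funext.
Qed.

Lemma track_ends_match a b : track_tgt a = track_src b -> forall f g,
  represents1 f a -> represents1 g b ->
  f one = g zero.
Proof. by move=> e f g fa gb; rewrite -(track_tgtE fa) e (track_srcE gb). Qed.

Lemma track_fd_hcomp X Y : track_fr X = track_fl Y ->
  track_fd (track_hcomp X Y) = track_comp (track_fd X) (track_fd Y).
Proof.
move=> e; have [G GX] := represents2_ex X; have [H HY GH] := matching_square e GX.
apply: (represents1_eq (track_fdE (track_hcompE GX HY GH))); apply: track_compE;
  [exact: track_fdE|exact: track_fdE|].
exact: (congr1 (@^~ zero) GH).
Qed.

Lemma track_fu_hcomp X Y : track_fr X = track_fl Y ->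
  track_fu (track_hcomp X Y) = track_comp (track_fu X) (track_fu Y).
Proof.
move=> e; have [G GX] := represents2_ex X; have [H HY GH] := matching_square e GX.
apply: (represents1_eq (track_fuE (track_hcompE GX HY GH))); apply: track_compE;
  [exact: track_fuE|exact: track_fuE|].
exact: (congr1 (@^~ one) GH).
Qed.

Lemma track_transpose_degv a : track_transpose (track_degv a) = track_degh a.
Proof. exact: track_transposeK. Qed.

Lemma track_fl_degv a : track_fl (track_degv a) = track_deg (track_src a).
Proof.
have [f fa] := represents1_ex a; rewrite (track_srcE fa).
exact: (represents1_eq (track_flE (track_degvE fa)) (track_degE _)).
Qed.

Lemma track_fr_degv a : track_fr (track_degv a) = track_deg (track_tgt a).
Proof.
have [f fa] := represents1_ex a; rewrite (track_tgtE fa).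
exact: (represents1_eq (track_frE (track_degvE fa)) (track_degE _)).
Qed.

Lemma track_fd_degh a : track_fd (track_degh a) = track_deg (track_src a).
Proof.
have [f fa] := represents1_ex a; rewrite (track_srcE fa).
exact: (represents1_eq (track_fdE (track_deghE fa)) (track_degE _)).
Qed.

Lemma track_fu_degh a : track_fu (track_degh a) = track_deg (track_tgt a).
Proof.
have [f fa] := represents1_ex a; rewrite (track_tgtE fa).
exact: (represents1_eq (track_fuE (track_deghE fa)) (track_degE _)).
Qed.

Lemma track_fd_degv a : track_fd (track_degv a) = a.
Proof. by have [h _ _ _ _ _ _ _] := track_vcomp_groupoid; exact: h. Qed.

Lemma track_src_deg p : track_src (track_deg p) = p.
Proof. exact: track_srcE (track_degE p). Qed.

Lemma track_tgt_deg p : track_tgt (track_deg p) = p.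
Proof. exact: track_tgtE (track_degE p). Qed.

Lemma track_corners X : [/\ track_src (track_fl X) = track_src (track_fd X),
  track_tgt (track_fl X) = track_src (track_fu X),
  track_src (track_fr X) = track_tgt (track_fd X) & track_tgt (track_fr X) = track_tgt
    (track_fu X)].
Proof.
have [G GX] := represents2_ex X.
rewrite !(track_srcE (track_flE GX), track_srcE (track_fdE GX),
  track_tgtE (track_flE GX), track_srcE (track_fuE GX),
  track_srcE (track_frE GX), track_tgtE (track_fdE GX), track_tgtE (track_frE GX),
    track_tgtE (track_fuE GX)).
by [].
Qed.

Lemma track_degv_comp a b : track_tgt a = track_src b ->
  track_degv (track_comp a b) = track_hcomp (track_degv a) (track_degv b).
Proof.
move=> e; have [f fa] := represents1_ex a; have [g gb] := represents1_ex b.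
have fg := track_ends_match e fa gb.
apply: (represents2_eq (track_degvE (track_compE fa gb fg))).
by apply: (track_hcompE (track_degvE fa) (track_degvE gb)); apply/funext.
Qed.

Lemma track_degh_comp a b : track_tgt a = track_src b ->
  track_degh (track_comp a b) = track_vcomp (track_degh a) (track_degh b).
Proof. by move=> e; rewrite -!track_transpose_degv track_degv_comp // /track_vcomp
  !track_transposeK. Qed.

(** Each law is the bottom face of the same law for squares of the form
[track_degv a], on which [track_fd] is inverse to [track_degv]. *)
Lemma track_comp_groupoid : is_groupoid track_src track_tgt track_deg track_comp.
Proof.
have [s1 t1 sc tc ac il ir iv] := track_hcomp_groupoid.
have vv a b : track_tgt a = track_src b -> track_fr (track_degv a) = track_fl
  (track_degv b).
  by move=> e; rewrite track_fr_degv track_fl_degv e.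
have cs a b : track_tgt a = track_src b -> track_src (track_comp a b) = track_src a.
  move=> e; rewrite -(track_src_deg (track_src
    (track_comp a b))) -track_fl_degv track_degv_comp // sc; last exact: vv.
  by rewrite track_fl_degv track_src_deg.
have ct a b : track_tgt a = track_src b -> track_tgt (track_comp a b) = track_tgt b.
  move=> e; rewrite -(track_src_deg (track_tgt
    (track_comp a b))) -track_fr_degv track_degv_comp // tc; last exact: vv.
  by rewrite track_fr_degv track_src_deg.
split => //; [exact: track_src_deg|exact: track_tgt_deg|..].
- move=> a b c ab bc.
  rewrite -[LHS]track_fd_degv -[RHS]track_fd_degv !track_degv_comp ?cs ?ct // ac //;
    exact: vv.
- move=> a; have := congr1 track_fd (il (track_degv a)).
  by rewrite track_fd_hcomp ?t1 // track_fl_degv track_fd_degh track_src_deg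
    track_fd_degv.
- move=> a; have := congr1 track_fd (ir (track_degv a)).
  by rewrite track_fd_hcomp ?s1 // track_fr_degv track_fd_degh track_src_deg
    track_fd_degv.
- move=> a; have [Y [Y1 Y2 Y3 Y4]] := iv (track_degv a); have [c1 c2 c3 c4] :=
  track_corners Y.
  exists (track_fd Y); split.
  + by rewrite -c1 Y1 track_fr_degv track_src_deg.
  + by rewrite -c3 Y2 track_fl_degv track_src_deg.
  + by have := congr1 track_fd Y3; rewrite track_fd_hcomp // track_fd_degv
    track_fl_degv track_fd_degh track_src_deg.
  + by have := congr1 track_fd Y4; rewrite track_fd_hcomp // track_fd_degv
    track_fr_degv track_fd_degh track_src_deg.
Qed.

Lemma track_fl_vcomp X Y : track_fu X = track_fd Y ->
  track_fl (track_vcomp X Y) = track_comp (track_fl X) (track_fl Y).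
Proof.
by move=> e; rewrite -[track_vcomp X Y]track_transposeK -/(track_fd _) /track_vcomp
  track_transposeK track_fd_hcomp // /track_fd !track_transposeK.
Qed.

Lemma track_fr_vcomp X Y : track_fu X = track_fd Y ->
  track_fr (track_vcomp X Y) = track_comp (track_fr X) (track_fr Y).
Proof.
by move=> e; rewrite -[track_vcomp X Y]track_transposeK -/(track_fu _) /track_vcomp
  track_transposeK track_fu_hcomp // /track_fu !track_transposeK.
Qed.

Lemma concat_interchange G1 G2 G3 G4 :
  vconcat (hconcat G1 G2) (hconcat G3 G4) = hconcat (vconcat G1 G3) (vconcat G2 G4).
Proof.
by apply/funext => t; apply/funext => s; rewrite /vconcat /hconcat /concat;
  do 2 case: ifP.
Qed.

Lemma match_bottom X G f : represents2 G X -> represents1 f (track_fd X) ->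
  exists G', [/\ represents2 G' X, rank_le 1 (fun2 G) -> rank_le 1 (fun2 G'),
    bdd G' = f &
    [/\ bdl G' = bdl G, bdr G' = bdr G & bdu G' = bdu G]].
Proof.
move=> GX fX; have [G' [G'X G't Gl [Gr Gd Gu]]] := match_left (track_transposeE GX) fX.
exists (transpose G'); split => //; first by rewrite -[X]track_transposeK;
  exact: track_transposeE.
move=> Gt; apply/thin_transpose; first exact: represents2_path G'X.
by apply/G't/thin_transpose => //; exact: represents2_path GX.
Qed.

Lemma match_top X G f : represents2 G X -> represents1 f (track_fu X) ->
  exists G', [/\ represents2 G' X, rank_le 1 (fun2 G) -> rank_le 1 (fun2 G'),
    bdu G' = f &
    [/\ bdl G' = bdl G, bdr G' = bdr G & bdd G' = bdd G]].
Proof.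
move=> GX fX; have [G' [G'X G't Gl [Gr Gd Gu]]] := match_right (track_transposeE GX) fX.
exists (transpose G'); split => //; first by rewrite -[X]track_transposeK;
  exact: track_transposeE.
move=> Gt; apply/thin_transpose; first exact: represents2_path G'X.
by apply/G't/thin_transpose => //; exact: represents2_path GX.
Qed.

(** Both sides are the class of one square, once representatives are chosen
that match exactly: G4 is first fitted to the right of G3, then on top of G2,
and the second adjustment keeps the left side. *)
Lemma track_interchange X Y Z W : track_fr X = track_fl Y -> track_fr Z = track_fl W ->
  track_fu X = track_fd Z ->
  track_fu Y = track_fd W ->
  track_vcomp (track_hcomp X Y) (track_hcomp Z W) = track_hcomp (track_vcomp X Z)
    (track_vcomp Y W).
Proof.
move=> XY ZW XZ YW; have [G1 GX] := represents2_ex X.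
have [G2 GY G12] := matching_square XY GX.
have [G3' GZ'] := represents2_ex Z.
have [|G3 [GZ _ G13 _]] := match_bottom (f := bdu G1) GZ'; first by rewrite -XZ;
  exact: track_fuE.
have [G4' GW' G34'] := matching_square ZW GZ.
have [|G4 [GW _ G24 [G4l _ _]]] := match_bottom (f := bdu G2) GW'.
  by rewrite -YW; exact: track_fuE.
have G34 : bdr G3 = bdl G4 by rewrite G4l.
have hv := concat_interchange G1 G2 G3 G4.
apply: (represents2_eq (G := vconcat (hconcat G1 G2) (hconcat G3 G4))).
  apply: track_vcompE; [exact: track_hcompE|exact: track_hcompE|].
  by rewrite -[bdu _]/(concat (bdu G1) (bdu G2)) -G13 -G24.
rewrite hv; apply: track_hcompE; [exact: track_vcompE|exact: track_vcompE|].
by rewrite -[bdr _]/(concat (bdr G1) (bdr G3)) G12 G34.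
Qed.

Definition track_double_groupoid : doubleGroupoid M (track1 M) (track2 M) :=
  DoubleGroupoid (fun X => let: And4 h _ _ _ := track_corners X in h)
    (fun X => let: And4 _ h _ _ := track_corners X in h)
    (fun X => let: And4 _ _ h _ := track_corners X in h)
    (fun X => let: And4 _ _ _ h := track_corners X in h)
    track_fd_degh track_fu_degh track_fl_degv track_fr_degv
    (fun p => represents2_eq (track_deghE (track_degE p)) (track_degvE (track_degE p)))
    track_comp_groupoid track_hcomp_groupoid track_vcomp_groupoid
    track_fd_hcomp track_fu_hcomp track_fl_vcomp track_fr_vcomp track_degh_comp
      track_degv_comp track_interchange.

(** Composing with H inserted does not change the first factor up to homotopy,
and afterwards the sides match. *)
Lemma represents2_hcomp X Y G G' H : represents2 G X -> represents2 G' Y ->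
  rank1_homotopy H (bdr G) (bdl G') ->
  represents2 (hconcat (hconcat G (transpose H)) G') (track_hcomp X Y).
Proof.
move=> GX GY HH; have [GP GG Gr] := hconcat_shrink (represents2_path GX) HH.
by apply: track_hcompE => //; exact: represents2_closed GX GP GG.
Qed.

Lemma track_double_groupoidP : is_thin_homotopy_double_groupoid track_double_groupoid.
Proof.
split.
- exact: track_srcE.
- exact: track_tgtE.
- exact: track_degE.
- exact: track_compE.
- exact: track_flE.
- exact: track_frE.
- exact: track_fdE.
- exact: track_fuE.
- exact: track_deghE.
- exact: track_degvE.
- exact: represents2_hcomp.
- move=> X Y G G' H GX GY HH.
  exact: (track_transposeE (represents2_hcomp (track_transposeE GX)
    (track_transposeE GY) HH)).
Qed.

Lemma thin_track_transpose X : thin_track X -> thin_track (track_transpose X).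
Proof.
move=> [G GX GR]; exists (transpose G); first exact: track_transposeE.
by apply: thin_transpose => //; exact: represents2_path GX.
Qed.

Lemma thin_track_degh a : thin_track (track_degh a).
Proof.
have [f fa] := represents1_ex a; exists (fun _ : I => f); first exact: track_deghE.
exact: (degenerate_path2 (represents1_path fa)).2.
Qed.

Lemma thin_track_hcomp X Y : track_fr X = track_fl Y -> thin_track X -> thin_track Y ->
  thin_track (track_hcomp X Y).
Proof.
move=> e [G GX GR] [H' HY' HR'].
have [|H [HY HR GH _]] := match_left (f := bdr G) HY'; first by rewrite -e;
  exact: track_frE.
exists (hconcat G H); first by apply: track_hcompE.
have [_ //] := rank_le_hconcat (represents2_path GX) (represents2_path HY)
  (esym GH) GR (HR HR').
Qed.

(** Uniqueness: a second thin filler is given collars so that it agrees with Q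
on the left, bottom and top sides, and then three sides decide. *)
Lemma thin_track_filler a b c d : track_tgt a = track_src b ->
  track_tgt c = track_src d -> track_comp a b = track_comp c d ->
  exists! X, thin_track X /\ [/\ track_fd X = a, track_fr X = b,
    track_fl X = c & track_fu X = d].
Proof.
move=> ab cd abcd.
have [f fa] := represents1_ex a; have [g gb] := represents1_ex b.
have [h hc] := represents1_ex c; have [k kd] := represents1_ex d.
have fg := track_ends_match ab fa gb; have hk := track_ends_match cd hc kd.
have [|Q [QP [QR Qd Qr Ql Qu]]] := thin_exists (represents1_path fa)
  (represents1_path gb)
    (represents1_path hc) (represents1_path kd) fg hk.
  by apply: (represents1_hom (track_compE fa gb fg)); rewrite abcd; exact: track_compE.
have [X QX] := represents2_mk QP; exists X; split.
  split; first by exists Q.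
  split; [apply: (represents1_eq (track_fdE QX))|apply: (represents1_eq (track_frE QX))
    |apply: (represents1_eq (track_flE QX))|apply: (represents1_eq (track_fuE QX))].
  - by rewrite Qd.
  - by rewrite Qr.
  - by rewrite Ql.
  - by rewrite Qu.
move=> Y [[G0 GY0 GR0] [Ya Yb Yc Yd]].
have [|G1 [GY1 GR1 G1l [G1r G1d G1u]]] := match_left (f := h) GY0; first by rewrite Yc.
have [|G2 [GY2 GR2 G2d [G2l G2r G2u]]] := match_bottom (f := f) GY1;
  first by rewrite Ya.
have [|G3 [GY3 GR3 G3u [G3l G3r G3d]]] := match_top (f := k) GY2; first by rewrite Yd.
apply: (represents2_eq _ GY3); apply: (represents2_closed QX).
  exact: represents2_path GY3.
apply: thin_unique => //; first exact: represents2_path GY3.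
- exact/GR3/GR2/GR1.
- by rewrite Ql G3l G2l G1l.
- by rewrite Qd G3d G2d.
- by rewrite Qu G3u.
Qed.

Lemma track_thin_structure : thin_structure track_double_groupoid (@thin_track R n M).
Proof.
split.
- exact: thin_track_degh.
- by move=> a; exact/thin_track_transpose/thin_track_degh.
- exact: thin_track_filler.
- exact: thin_track_hcomp.
- by move=> X Y e Xt Yt; apply: thin_track_transpose; apply: thin_track_hcomp => //;
  exact: thin_track_transpose.
Qed.

End Tracks.

Theorem theorem2p14 (R : realType) (n : nat) (M : smoothManifold R n) :
  [/\ equivalence_on (@path1 R n M) (@rank1_homotopic R n M),
      equivalence_on (@path2 R n M) (@rank2_homotopic R n M) &
      exists D : doubleGroupoid M (track1 M) (track2 M),
        is_thin_homotopy_double_groupoid D /\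
        thin_structure D (@thin_track R n M)].
Proof.
split; [exact: rank1_homotopic_equiv|exact: rank2_homotopic_equiv|].
exists (track_double_groupoid M); split; first exact: track_double_groupoidP.
exact: track_thin_structure.
Qed.
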